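(* Let $p$ be an odd prime and let $V$ be an elementary abelian $p$-group of rank $n$. Then, as a module over the polynomial part $S(V^* )$ of the cohomology ring $H^*(V,\mathbb{F}_p)$, the essential ideal $\operatorname{Ess}(V)$ is free on the set of Mùi invariants $\{M_{n,S} : S \subseteq \{1,\dots,n\}\}$.
   Context: For a finite group $G$, a class in $H^m(G,\mathbb{F}_p)$ is called essential if its restriction to every proper subgroup of $G$ is zero. The essential classes form an ideal $\operatorname{Ess}(G)$ of $H^*(G,\mathbb{F}_p)$. For $p$ odd and $V$ elementary abelian of rank $n$ (viewed as an $\mathbb{F}_p$-vector space with dual $V^*$), choose a basis $a_1,\dots,a_n$ of $H^1(V,\mathbb{F}_p)=\operatorname{Hom}(V,\mathbb{F}_p)=V^*$ and put $x_i=\beta(a_i)\in H^2(V,\mathbb{F}_p)$, where $\beta$ is the Bockstein. Then, as graded-commutative algebras, $H^*(V,\mathbb{F}_p)\cong \mathbb{F}_p[x_1,\dots,x_n]\otimes_{\mathbb{F}_p}\Lambda(a_1,\dots,a_n)=S(V^* )\otimes_{\mathbb{F}_p}\Lambda(V^* )$, where $S(V^* )=\mathbb{F}_p[x_1,\dots,x_n]$. Let $C$ be the $n\times n$ matrix with entries $C_{s,i}=x_i^{p^{s-1}}$ for $1\le s,i\le n$, and let $L_n(V)=\det C$. For $1\le s\le n$ let $E(s)$ be the matrix obtained from $C$ by deleting row $s$ and then prefixing $(a_1\ a_2\ \cdots\ a_n)$ as new first row. Define $$M_{n,s}=\det E(s)=\sum_{i=1}^n(-1)^{i+1}\gamma_{s,i}a_i,$$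 where $\gamma_{s,i}$ is the determinant of the matrix obtained from $C$ by removing row $s$ and column $i$. For a subset $S=\{s_1<s_2<\cdots<s_r\}\subseteq\{1,\dots,n\}$, the Mùi invariant $M_{n,S}\in H^*(V,\mathbb{F}_p)$ is defined by $$M_{n,S}=\frac{1}{L_n(V)^{r-1}}M_{n,s_1}M_{n,s_2}\cdots M_{n,s_r}.$$ The division is possible in $H^*(V,\mathbb{F}_p)$, and the result is unique since $L_n(V)$ is a non-zero-divisor. In particular $M_{n,\emptyset}=L_n(V)$. *)

(* Defs.v *)
From HB Require Import structures.
From mathcomp Require Import all_boot all_order all_fingroup all_algebra.
From mathcomp Require Import all_solvable generic_quotient ring_quotient ring.
From mathcomp Require Import boolp classical_sets.
From mathcomp Require Import mpoly.

Set Implicit Arguments.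
Unset Strict Implicit.
Unset Printing Implicit Defensive.

Import GRing.Theory.
Local Open Scope ring_scope.
Local Open Scope quotient_scope.

(* Group cohomology is computed by inhomogeneous (bar) cochains with trivial  *)
(* coefficients. A function G^m -> R is encoded as a function on words        *)
(* supported on the words of size m, so that the direct sum over m of the     *)
(* cochain groups is the set of the functions on words that are supported on  *)
(* words of bounded size (see [bounded] below). The type [cochain] itself is  *)
(* the direct product over m.                                                 *)
Definition cochain (gT : finGroupType) (R : comNzRingType) := seq gT -> R.

HB.instance Definition _ gT R := gen_eqMixin (cochain gT R).
HB.instance Definition _ gT R := gen_choiceMixin (cochain gT R).

Section Cochain.
Variables (gT : finGroupType) (R : comNzRingType).
Implicit Types (f g h : cochain gT R) (w : seq gT).

Lemma cochainP f g : f =1 g -> f = g. Proof. exact: funext. Qed.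

Definition cochain_zero : cochain gT R := fun _ => 0.
Definition cochain_opp f : cochain gT R := fun w => - f w.
Definition cochain_add f g : cochain gT R := fun w => f w + g w.

Fact cochain_addA : associative cochain_add.
Proof. by move=> f g h; apply: cochainP => w; apply: addrA. Qed.
Fact cochain_addC : commutative cochain_add.
Proof. by move=> f g; apply: cochainP => w; apply: addrC. Qed.
Fact cochain_add0 : left_id cochain_zero cochain_add.
Proof. by move=> f; apply: cochainP => w; apply: add0r. Qed.
Fact cochain_addN : left_inverse cochain_zero cochain_opp cochain_add.
Proof. by move=> f; apply: cochainP => w; apply: addNr. Qed.

HB.instance Definition _ := GRing.isZmodule.Build (cochain gT R)
  cochain_addA cochain_addC cochain_add0 cochain_addN.

Lemma cochain0E w : (0 : cochain gT R) w = 0. Proof. by []. Qed.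
Lemma cochainNE f w : (- f) w = - f w. Proof. by []. Qed.
Lemma cochainDE f g w : (f + g) w = f w + g w. Proof. by []. Qed.
Lemma cochainBE f g w : (f - g) w = f w - g w. Proof. by []. Qed.

Definition cochain_scale (c : R) f : cochain gT R := fun w => c * f w.

Fact cochain_scaleA a b f :
  cochain_scale a (cochain_scale b f) = cochain_scale (a * b) f.
Proof. by apply: cochainP => w; apply: mulrA. Qed.
Fact cochain_scale1 : left_id 1 cochain_scale.
Proof. by move=> f; apply: cochainP => w; apply: mul1r. Qed.
Fact cochain_scaleDr : right_distributive cochain_scale +%R.
Proof. by move=> c f g; apply: cochainP => w; apply: mulrDr. Qed.
Fact cochain_scaleDl f : {morph cochain_scale^~ f : a b / a + b}.
Proof. by move=> a b; apply: cochainP => w; apply: mulrDl. Qed.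

HB.instance Definition _ := GRing.Zmodule_isLmodule.Build R (cochain gT R)
  cochain_scaleA cochain_scale1 cochain_scaleDr cochain_scaleDl.

Lemma cochainZE (c : R) f w : (c *: f) w = c * f w. Proof. by []. Qed.

(* For f of degree m and g of degree k, this is the cup product               *)
(* (f g)(v_1, .., v_(m + k)) = f(v_1, .., v_m) g(v_(m + 1), .., v_(m + k)).   *)
Definition cochain_one : cochain gT R := fun w => (nilp w)%:R.
Definition cup f g : cochain gT R :=
  fun w => \sum_(i < (size w).+1) f (take i w) * g (drop i w).

(* left translate of a cochain by a letter *)
Definition lshiftc (x : gT) f : cochain gT R := fun w => f (x :: w).

Lemma cup_nil f g : cup f g [::] = f [::] * g [::].
Proof. by rewrite /cup big_ord1. Qed.

Lemma cup_cons f g x w :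
  cup f g (x :: w) = f [::] * g (x :: w) + cup (lshiftc x f) g w.
Proof. by rewrite /cup big_ord_recl. Qed.

Fact cupDl : left_distributive cup +%R.
Proof.
move=> f g h; apply: cochainP => w; rewrite /cup cochainDE -big_split /=.
by apply: eq_bigr => i _; rewrite -mulrDl.
Qed.
Fact cupDr : right_distributive cup +%R.
Proof.
move=> f g h; apply: cochainP => w; rewrite /cup cochainDE -big_split /=.
by apply: eq_bigr => i _; rewrite -mulrDr.
Qed.
Fact cupZl (c : R) f g : c *: cup f g = cup (c *: f) g.
Proof.
apply: cochainP => w; rewrite /cup cochainZE mulr_sumr.
by apply: eq_bigr => i _; rewrite mulrA.
Qed.
Fact cupZr (c : R) f g : c *: cup f g = cup f (c *: g).
Proof.
apply: cochainP => w; rewrite /cup cochainZE mulr_sumr.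
by apply: eq_bigr => i _; rewrite mulrCA.
Qed.
Fact cup0 g : cup 0 g = 0.
Proof.
by apply: cochainP => w; rewrite /cup big1 // => i _; rewrite cochain0E mul0r.
Qed.

Lemma lshiftc_cup x f g :
  lshiftc x (cup f g) = f [::] *: lshiftc x g + cup (lshiftc x f) g.
Proof. by apply: cochainP => w; rewrite /lshiftc cup_cons. Qed.

Fact cupA : associative cup.
Proof.
move=> f g h; apply: cochainP => w; elim: w f g => [|x w IHw] f g.
  by rewrite !cup_nil mulrA.
rewrite !cup_cons IHw lshiftc_cup cupDl cochainDE -cupZl cochainZE.
by rewrite cup_nil mulrDr !addrA mulrA.
Qed.

Fact cup1l : left_id cochain_one cup.
Proof.
move=> f; apply: cochainP => -[|x w].
  by rewrite cup_nil mul1r.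
rewrite cup_cons mul1r (_ : lshiftc x cochain_one = 0) ?cup0 ?addr0 //.
Qed.

Fact cup1r : right_id cochain_one cup.
Proof.
move=> f; apply: cochainP => w; elim: w f => [|x w IHw] f.
  by rewrite cup_nil mulr1.
by rewrite cup_cons mulr0 add0r IHw.
Qed.

Fact cochain_one_neq0 : cochain_one != 0.
Proof.
apply/eqP => /(congr1 (fun f : cochain gT R => f [::])) /eqP.
by rewrite cochain0E /cochain_one /= oner_eq0.
Qed.

HB.instance Definition _ := GRing.Zmodule_isNzRing.Build (cochain gT R)
  cupA cup1l cup1r cupDl cupDr cochain_one_neq0.
HB.instance Definition _ := GRing.Lmodule_isLalgebra.Build R (cochain gT R)
  cupZl.
HB.instance Definition _ := GRing.Lalgebra_isAlgebra.Build R (cochain gT R)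
  cupZr.

(* (v_0, .., v_m) |-> (v_0, .., v_i v_(i + 1), .., v_m) *)
Definition merge_at (i : nat) w : seq gT :=
  take i w ++ (nth 1%g w i * nth 1%g w i.+1)%g :: drop i.+2 w.

(* (d f)(v_0, .., v_m) = f(v_1, .., v_m)                                      *)
(*     + sum_(i < m) (-1)^(i + 1) f(v_0, .., v_i v_(i + 1), .., v_m)          *)
(*     + (-1)^(m + 1) f(v_0, .., v_(m - 1)).                                  *)
Definition coboundary f : cochain gT R := fun w =>
  if w is _ :: s then
    f s + \sum_(i < size s) (-1) ^+ i.+1 * f (merge_at i w)
      + (-1) ^+ (size s).+1 * f (take (size s) w)
  else 0.

Lemma size_merge_at i x s : (i < size s)%N -> size (merge_at i (x :: s)) = size s.
Proof.
move=> lt_is; rewrite size_cat /= size_drop size_takel /= ?leqW 1?ltnW //.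
by rewrite addnS -addSn subnKC.
Qed.

Definition bounded f : Prop := exists N, forall w, (N < size w)%N -> f w = 0.

(* The coboundary is split as face0 f + cobd1 f; cobd1 satisfies a recursion  *)
(* on the word, from which all the identities below are derived.              *)
Let cobd1 f : cochain gT R := fun w =>
  if w is _ :: s then
    \sum_(i < size s) (-1) ^+ i.+1 * f (merge_at i w)
      + (-1) ^+ (size s).+1 * f (take (size s) w)
  else 0.
Let face0 f : cochain gT R := fun w => if w is _ :: s then f s else 0.
Let lmerge x f : cochain gT R := fun w =>
  if w is y :: s then f ((x * y)%g :: s) else f [::].

Let coboundaryE f : coboundary f = face0 f + cobd1 f.
Proof. by apply: cochainP => -[|x w]; rewrite cochainDE /= ?addr0 ?addrA. Qed.

Let cobd1_cons f x w : cobd1 f (x :: w) = - lmerge x f w - cobd1 (lshiftc x f) w.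
Proof.
case: w => [|y s]; first by rewrite /= big_ord0 add0r expr1 mulN1r subr0.
rewrite /cobd1 [size (y :: s)]/= big_ord_recl expr1 mulN1r -addrA.
rewrite {1}/merge_at /= drop0; congr (_ + _).
rewrite opprD -sumrN; congr (_ + _); last by rewrite exprS mulN1r mulNr.
by apply: eq_bigr => i _; rewrite exprS mulN1r mulNr.
Qed.

Let cobd1D : {morph cobd1 : f g / f + g}.
Proof.
move=> f g; apply: cochainP => -[|x s]; rewrite cochainDE /= ?addr0 //.
rewrite addrACA -big_split /= cochainDE mulrDr; congr (_ + _).
by apply: eq_bigr => i _; rewrite -mulrDr.
Qed.

Let cobd1Z (c : R) f : cobd1 (c *: f) = c *: cobd1 f.
Proof.
apply: cochainP => -[|x s]; rewrite cochainZE /= ?mulr0 //.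
rewrite mulrDr mulr_sumr cochainZE mulrCA; congr (_ + _).
by apply: eq_bigr => i _; rewrite mulrCA.
Qed.

Let face0D : {morph face0 : f g / f + g}.
Proof. by move=> f g; apply: cochainP => -[|x s] //=; rewrite cochainDE addr0. Qed.

Lemma coboundaryD : {morph coboundary : f g / f + g}.
Proof. by move=> f g; rewrite !coboundaryE cobd1D face0D addrACA. Qed.

Lemma coboundaryZ (c : R) f : coboundary (c *: f) = c *: coboundary f.
Proof.
rewrite !coboundaryE cobd1Z scalerDr; congr (_ + _).
by apply: cochainP => -[|x s]; rewrite ?cochainZE //= mulr0.
Qed.

Lemma coboundary0 : coboundary 0 = 0.
Proof. by rewrite -[X in coboundary X](scale0r 0) coboundaryZ scale0r. Qed.

Lemma coboundaryN : {morph coboundary : f / - f}.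
Proof. by move=> f; rewrite -scaleN1r coboundaryZ scaleN1r. Qed.

Lemma coboundaryB : {morph coboundary : f g / f - g}.
Proof. by move=> f g; rewrite coboundaryD coboundaryN. Qed.

Let cobd1K f : cobd1 (cobd1 f) = 0.
Proof.
apply: cochainP => w; elim: w f => [|x w IHw] f //.
rewrite cobd1_cons.
have -> : lshiftc x (cobd1 f) = - lmerge x f - cobd1 (lshiftc x f).
  by apply: cochainP => v; exact: cobd1_cons.
rewrite -[- lmerge x f]scaleN1r -[- cobd1 _]scaleN1r cobd1D !cobd1Z !scaleN1r.
rewrite cochainDE !cochainNE IHw !cochain0E subr0 opprK.
case: w {IHw} => [|y s]; first by rewrite /= oppr0 addr0.
rewrite [lmerge _ _ _]/lmerge !cobd1_cons opprB addrC.
have -> : lshiftc y (lmerge x f) = lshiftc (x * y)%g f by [].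
have -> : lmerge y (lmerge x f) s = lmerge (x * y)%g f s.
  by case: s => //= z s; rewrite mulgA.
by rewrite opprK addrA subrK addNr.
Qed.

Lemma coboundaryK f : coboundary (coboundary f) = 0.
Proof.
rewrite !coboundaryE face0D cobd1D cobd1K addr0.
apply: cochainP => -[|x w]; first by rewrite !cochainDE /= !addr0.
rewrite !cochainDE cobd1_cons /=.
have -> : lshiftc x (face0 f) = f by [].
have -> : lmerge x (face0 f) w = face0 f w by case: w.
by rewrite -opprD subrr.
Qed.

(* multiplication by (-1)^m in degree m *)
Definition sgnc f : cochain gT R := fun w => (-1) ^+ size w * f w.

Let mul_nil f g : (f * g) [::] = f [::] * g [::].
Proof. exact: cup_nil. Qed.
Let mul_cons f g x w :
  (f * g) (x :: w) = f [::] * g (x :: w) + (lshiftc x f * g) w.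
Proof. exact: cup_cons. Qed.
Let lshiftc_mul x f g :
  lshiftc x (f * g) = f [::] *: lshiftc x g + lshiftc x f * g.
Proof. exact: lshiftc_cup. Qed.

Let lmerge_mul x f g :
  lmerge x (f * g) = lmerge x f * g + f [::] *: (lmerge x g - g).
Proof.
apply: cochainP => -[|y s]; rewrite cochainDE cochainZE cochainBE.
  by rewrite /lmerge !mul_nil subrr mulr0 addr0.
rewrite [LHS]mul_cons mul_cons /= mulrBr.
have -> : lshiftc y (lmerge x f) = lshiftc (x * y)%g f by [].
by rewrite [RHS]addrC addrA subrK.
Qed.

Let lshiftc_sgn x f : lshiftc x (sgnc f) = - sgnc (lshiftc x f).
Proof.
by apply: cochainP => w; rewrite cochainNE /lshiftc /sgnc /= exprS mulN1r mulNr.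
Qed.

Lemma coboundaryM f g :
  coboundary (f * g) = coboundary f * g + sgnc f * coboundary g.
Proof.
rewrite coboundaryE [coboundary f]coboundaryE mulrDl -addrA; congr (_ + _).
  apply: cochainP => -[|x w]; first by rewrite mul_nil mul0r.
  by rewrite [RHS]mul_cons mul0r add0r.
apply: cochainP => w; rewrite cochainDE.
elim: w f => [|x w IHw] f; first by rewrite !mul_nil /= mul0r mulr0 addr0.
rewrite cobd1_cons lshiftc_mul lmerge_mul cobd1D cobd1Z !cochainDE IHw.
rewrite !mul_cons lshiftc_sgn.
have -> : lshiftc x (cobd1 f) = - lmerge x f - cobd1 (lshiftc x f).
  by apply: cochainP => v; exact: cobd1_cons.
rewrite coboundaryE !cochainDE [face0 _ (_ :: _)]/= cobd1_cons.
rewrite [cobd1 f [::]]/= mul0r add0r [sgnc f [::]]mul1r.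
rewrite mulrDl !mulNr -coboundaryE !cochainDE !cochainNE !cochainZE !cochainBE.
ring.
Qed.

Lemma bounded0 : bounded 0. Proof. by exists 0. Qed.

Lemma boundedD f g : bounded f -> bounded g -> bounded (f + g).
Proof.
move=> [M fM] [N gN]; exists (maxn M N) => w; rewrite gtn_max => /andP[Mw Nw].
by rewrite cochainDE fM ?gN ?addr0.
Qed.

Lemma boundedZ (c : R) f : bounded f -> bounded (c *: f).
Proof. by case=> N fN; exists N => w /fN; rewrite cochainZE => ->; apply: mulr0. Qed.

Lemma bounded1 : bounded 1.
Proof. by exists 0 => -[]. Qed.

Lemma boundedM f g : bounded f -> bounded g -> bounded (f * g).
Proof.
move=> [M fM] [N gN]; exists (M + N)%N => w ltMNw.
rewrite [LHS]big1 // => i _; have [leiM|ltMi] := leqP i M; last first.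
  by rewrite fM ?mul0r // size_takel // -ltnS.
rewrite [g _]gN ?mulr0 // size_drop ltn_subRL (leq_ltn_trans _ ltMNw) //.
by rewrite leq_add2r.
Qed.

Lemma bounded_sgnc f : bounded f -> bounded (sgnc f).
Proof. by case=> N fN; exists N => w /fN; rewrite /sgnc => ->; apply: mulr0. Qed.

Lemma bounded_coboundary f : bounded f -> bounded (coboundary f).
Proof.
case=> N fN; exists N.+1 => -[|x s] //= ltNs.
rewrite !fN ?mulr0 ?addr0 ?add0r ?size_takel // big1 // => i _.
by rewrite fN ?mulr0 // size_merge_at.
Qed.

Lemma coboundary1 : coboundary 1 = 0.
Proof.
have := coboundaryM 1 1; have -> : sgnc 1 = 1 :> cochain gT R.
  by apply: cochainP => -[|x w]; rewrite /sgnc /= ?mul1r // mulr0.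
by rewrite !mulr1 mul1r -[LHS]addr0 => /addrI.
Qed.

Definition is_cocycle : pred (cochain gT R) :=
  fun f => `[< bounded f /\ coboundary f = 0 >].

Fact sgnc_cocycle f : coboundary f = 0 -> coboundary (sgnc f) = 0.
Proof.
suff -> : coboundary (sgnc f) = - sgnc (coboundary f).
  by move=> ->; apply: cochainP => w; rewrite cochainNE /sgnc mulr0 oppr0.
apply: cochainP => -[|x s]; rewrite cochainNE /sgnc /= ?mulr0 ?oppr0 //.
rewrite exprS mulN1r !mulNr opprK !mulrDr mulr_sumr; congr (_ + _ + _).
  apply: eq_bigr => i _; rewrite [LHS]mulrCA.
  by rewrite size_merge_at.
by rewrite mulrN size_takel //= leqnSn.
Qed.

Fact is_cocycle_subalg : GRing.subsemialg_closed is_cocycle.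
Proof.
split.
- by apply/asboolP; split; [exact: bounded1 | exact: coboundary1].
- split; first by apply/asboolP; split; [exact: bounded0 | exact: coboundary0].
  move=> f g /asboolP[bf df] /asboolP[bg dg]; apply/asboolP; split.
    exact: boundedD.
  by rewrite coboundaryD df dg addr0.
- move=> c f /asboolP[bf df]; apply/asboolP; split; first exact: boundedZ.
  by rewrite coboundaryZ df scaler0.
- move=> f g /asboolP[bf df] /asboolP[bg dg]; apply/asboolP; split.
    exact: boundedM.
  by rewrite coboundaryM df dg mul0r mulr0 addr0.
Qed.

HB.instance Definition _ :=
  GRing.isSubalgClosed.Build R (cochain gT R) is_cocycle is_cocycle_subalg.
End Cochain.

Record cocycle (gT : finGroupType) (R : comNzRingType) :=
  Cocycle { cocycle_val :> cochain gT R; _ : is_cocycle cocycle_val }.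

HB.instance Definition _ gT R := [isSub for @cocycle_val gT R].
HB.instance Definition _ gT R := [Choice of cocycle gT R by <:].
HB.instance Definition _ gT R := [SubChoice_isSubAlgebra of cocycle gT R by <:].

Section Cohomology.
Variables (gT : finGroupType) (R : comNzRingType).
Implicit Types (z : cocycle gT R).

Lemma bounded_cocycle z : bounded z.
Proof. by case: z => f /= /asboolP[]. Qed.

Lemma coboundary_cocycle z : coboundary z = 0.
Proof. by case: z => f /= /asboolP[]. Qed.

Definition is_coboundary : cocycle gT R -> bool :=
  fun z => `[< exists2 f, bounded f & val z = coboundary f >].

Fact is_coboundary_zmod : zmod_closed is_coboundary.
Proof.
split=> [|y z /asboolP[f bf yE] /asboolP[g bg zE]]; apply/asboolP.
  by exists 0; [exact: bounded0 | rewrite raddf0 coboundary0].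
exists (f - g); last by rewrite raddfB /= yE zE coboundaryB.
by apply: boundedD => //; rewrite -scaleN1r; apply: boundedZ.
Qed.

HB.instance Definition _ := GRing.isZmodClosed.Build (cocycle gT R)
  is_coboundary is_coboundary_zmod.

Lemma is_coboundaryMr z y : is_coboundary y -> is_coboundary (z * y).
Proof.
move=> /asboolP[f bf yE]; apply/asboolP; exists (sgnc z * f).
  by apply: boundedM => //; apply: bounded_sgnc; apply: bounded_cocycle.
rewrite coboundaryM sgnc_cocycle ?coboundary_cocycle // mul0r add0r -yE.
rewrite rmorphM /=; congr (_ * _); apply: cochainP => w.
by rewrite /sgnc mulrA -exprMn mulrNN mulr1 expr1n mul1r.
Qed.

Lemma is_coboundaryMl z y : is_coboundary y -> is_coboundary (y * z).
Proof.
move=> /asboolP[f bf yE]; apply/asboolP; exists (f * val z).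
  by apply: boundedM => //; apply: bounded_cocycle.
by rewrite coboundaryM coboundary_cocycle mulr0 addr0 -yE rmorphM.
Qed.

Lemma is_coboundaryZ (c : R) z : is_coboundary z -> is_coboundary (c *: z).
Proof. by move=> dz; rewrite -mulr_algl; apply: is_coboundaryMr. Qed.

Lemma is_coboundary1 : ~~ is_coboundary 1.
Proof.
apply/asboolP => -[f _ /(congr1 (fun g : cochain gT R => g [::]))].
by rewrite rmorph1 => /eqP; rewrite [X in X == _]/(1%R) /= oner_eq0.
Qed.

(* The cohomology ring H^*(gT, R), the direct sum of all the H^m(gT, R). *)
Definition cohomology :=
  Quotient.quot (GRing.ZmodClosed.clone (cocycle gT R) is_coboundary _).

HB.instance Definition _ := GRing.Zmodule.on cohomology.

Definition cclass (z : cocycle gT R) : cohomology := \pi_cohomology z.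

Lemma cclassP y z : reflect (cclass y = cclass z) (is_coboundary (y - z)).
Proof.
have -> : is_coboundary (y - z) = (y == z %[mod cohomology]).
  by rewrite -Quotient.idealrBE.
exact: eqP.
Qed.

Lemma cclass_repr (c : cohomology) : cclass (repr c) = c.
Proof. exact: reprK. Qed.

Lemma cclassD : {morph cclass : y z / y + z}.
Proof. by move=> y z; rewrite /cclass piE. Qed.

Lemma cclass0 : cclass 0 = 0.
Proof. by rewrite /cclass piE. Qed.

Let cohomology_ind (P : cohomology -> Prop) :
  (forall z, P (cclass z)) -> forall c, P c.
Proof. by move=> Pz c; rewrite -[c]cclass_repr. Qed.

Definition cohomology_one : cohomology := cclass 1.
Definition cohomology_mul (c d : cohomology) : cohomology :=
  cclass (repr c * repr d).
Definition cohomology_scale (r : R) (c : cohomology) : cohomology :=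
  cclass (r *: repr c).

Let is_coboundary_repr z : is_coboundary (repr (cclass z) - z).
Proof. by apply/cclassP; rewrite cclass_repr. Qed.

Let cclassM_def y z : cohomology_mul (cclass y) (cclass z) = cclass (y * z).
Proof.
apply/cclassP; rewrite -[repr _ * _](subrK (y * repr (cclass z))) -mulrBl.
rewrite -addrA -mulrBr; apply: rpredD.
  by apply: is_coboundaryMl; apply: is_coboundary_repr.
by apply: is_coboundaryMr; apply: is_coboundary_repr.
Qed.

Let cclassZ_def r z : cohomology_scale r (cclass z) = cclass (r *: z).
Proof.
by apply/cclassP; rewrite -scalerBr; apply/is_coboundaryZ/is_coboundary_repr.
Qed.

Fact cohomology_mulA : associative cohomology_mul.
Proof.
elim/cohomology_ind => x; elim/cohomology_ind => y; elim/cohomology_ind => z.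
by rewrite !cclassM_def mulrA.
Qed.
Fact cohomology_mul1l : left_id cohomology_one cohomology_mul.
Proof. by elim/cohomology_ind => x; rewrite cclassM_def mul1r. Qed.
Fact cohomology_mul1r : right_id cohomology_one cohomology_mul.
Proof. by elim/cohomology_ind => x; rewrite cclassM_def mulr1. Qed.
Fact cohomology_mulDl : left_distributive cohomology_mul +%R.
Proof.
elim/cohomology_ind => x; elim/cohomology_ind => y; elim/cohomology_ind => z.
by rewrite -cclassD !cclassM_def -cclassD mulrDl.
Qed.
Fact cohomology_mulDr : right_distributive cohomology_mul +%R.
Proof.
elim/cohomology_ind => x; elim/cohomology_ind => y; elim/cohomology_ind => z.
by rewrite -cclassD !cclassM_def -cclassD mulrDr.
Qed.
Fact cohomology_one_neq0 : cohomology_one != 0.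
Proof.
apply/eqP; rewrite -cclass0 => /cclassP; rewrite subr0.
exact/negP/is_coboundary1.
Qed.

HB.instance Definition _ := GRing.Zmodule_isNzRing.Build cohomology
  cohomology_mulA cohomology_mul1l cohomology_mul1r
  cohomology_mulDl cohomology_mulDr cohomology_one_neq0.

Fact cohomology_scaleA a b c :
  cohomology_scale a (cohomology_scale b c) = cohomology_scale (a * b) c.
Proof. by elim/cohomology_ind: c => z; rewrite !cclassZ_def scalerA. Qed.
Fact cohomology_scale1 : left_id 1 cohomology_scale.
Proof. by elim/cohomology_ind => z; rewrite cclassZ_def scale1r. Qed.
Fact cohomology_scaleDr : right_distributive cohomology_scale +%R.
Proof.
move=> r; elim/cohomology_ind => y; elim/cohomology_ind => z.
by rewrite -cclassD !cclassZ_def -cclassD scalerDr.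
Qed.
Fact cohomology_scaleDl c : {morph cohomology_scale^~ c : a b / a + b}.
Proof.
by elim/cohomology_ind: c => z a b; rewrite !cclassZ_def -cclassD scalerDl.
Qed.

HB.instance Definition _ := GRing.Zmodule_isLmodule.Build R cohomology
  cohomology_scaleA cohomology_scale1 cohomology_scaleDr cohomology_scaleDl.

Lemma cclassM : {morph cclass : y z / y * z}.
Proof. by move=> y z; rewrite -cclassM_def. Qed.

Lemma cclass1 : cclass 1 = 1. Proof. by []. Qed.

Lemma cclassZ r z : cclass (r *: z) = r *: cclass z.
Proof. by rewrite -cclassZ_def. Qed.

Fact cohomology_scaleAl r (c d : cohomology) : r *: (c * d) = (r *: c) * d.
Proof.
elim/cohomology_ind: c => y; elim/cohomology_ind: d => z.
by rewrite -!(cclassM, cclassZ) scalerAl.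
Qed.
Fact cohomology_scaleAr r (c d : cohomology) : r *: (c * d) = c * (r *: d).
Proof.
elim/cohomology_ind: c => y; elim/cohomology_ind: d => z.
by rewrite -!(cclassM, cclassZ) scalerAr.
Qed.

HB.instance Definition _ := GRing.Lmodule_isLalgebra.Build R cohomology
  cohomology_scaleAl.
HB.instance Definition _ := GRing.Lalgebra_isAlgebra.Build R cohomology
  cohomology_scaleAr.

(* c lies in the summand H^m(gT, R) of the cohomology ring *)
Definition has_degree (m : nat) (c : cohomology) : Prop :=
  exists2 z : cocycle gT R,
    forall w, size w != m -> (z : cochain gT R) w = 0 & c = cclass z.

End Cohomology.

Section Restriction.
Variables (gT : finGroupType) (R : comNzRingType) (H : {group gT}).

Definition res_cochain (f : cochain gT R) : cochain (subg_of H) R :=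
  fun w => f (map sgval w).

Lemma nth_map_sgval (u : seq (subg_of H)) i :
  nth 1%g (map sgval u) i = sgval (nth 1%g u i).
Proof.
by have [ltiu|leui] := ltnP i (size u);
  [exact: nth_map | rewrite !nth_default ?size_map].
Qed.

Lemma res_coboundary f :
  res_cochain (coboundary f) = coboundary (res_cochain f).
Proof.
apply: cochainP => -[|x s] //; rewrite /res_cochain /= size_map map_take /=.
congr (_ + _ + _); apply: eq_bigr => i _; congr (_ * f _).
rewrite /merge_at map_cat map_take /= map_drop /=; congr (_ ++ _ :: _).
by rewrite -!nth_map_sgval.
Qed.

Lemma res_bounded f : bounded f -> bounded (res_cochain f).
Proof. by case=> N fN; exists N => w ltNw; apply: fN; rewrite size_map. Qed.

Fact res_is_cocycle (z : cocycle gT R) : is_cocycle (res_cochain z).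
Proof.
apply/asboolP; split; first exact/res_bounded/bounded_cocycle.
by rewrite -res_coboundary coboundary_cocycle.
Qed.

Definition res_cocycle (z : cocycle gT R) : cocycle (subg_of H) R :=
  Cocycle (res_is_cocycle z).

(* Restriction to a subgroup; by [resE] below, it does not depend on the      *)
(* chosen representative.                                                     *)
Definition res (c : cohomology gT R) : cohomology (subg_of H) R :=
  cclass (res_cocycle (repr c)).

Lemma resE z : res (cclass z) = cclass (res_cocycle z).
Proof.
have /asboolP[f bf fE] : is_coboundary (repr (cclass z) - z).
  by apply/cclassP; rewrite cclass_repr.
apply/cclassP/asboolP; exists (res_cochain f); first exact: res_bounded.
rewrite -res_coboundary -fE.
by apply: cochainP => w; rewrite !raddfB.
Qed.

Lemma resD : {morph res : c d / c + d}.
Proof.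
move=> c d; rewrite -[c]cclass_repr -[d]cclass_repr -cclassD !resE -cclassD.
congr cclass; apply: val_inj => /=.
by apply: cochainP => w.
Qed.

Lemma resM : {morph res : c d / c * d}.
Proof.
move=> c d; rewrite -[c]cclass_repr -[d]cclass_repr -cclassM !resE -cclassM.
congr cclass; apply: val_inj => /=.
apply: cochainP => w; rewrite /res_cochain.
rewrite [LHS]/(cup _ _ _) [RHS]/(cup _ _ _) /cup size_map.
by apply: eq_bigr => i _; rewrite map_take map_drop.
Qed.

End Restriction.

(* Restriction preserves degrees, so that an element of the cohomology ring   *)
(* is in Ess iff all its homogeneous components are essential classes.        *)
Definition Ess (gT : finGroupType) (R : comNzRingType)
    (c : cohomology gT R) : Prop :=
  forall H : {group gT}, H \proper [set: gT] -> res H c = 0.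

Lemma Ess_ideal (gT : finGroupType) (R : comNzRingType) :
  [/\ @Ess gT R 0, forall c d, @Ess gT R c -> Ess d -> Ess (c + d),
      forall c d, @Ess gT R d -> Ess (c * d)
    & forall c d, @Ess gT R c -> Ess (c * d)].
Proof.
split=> [H _|c d Ec Ed H HG|c d Ed H HG|c d Ec H HG].
- by apply/(@addrI _ (res H 0)); rewrite -resD !addr0.
- by rewrite resD Ec // Ed // addr0.
- by rewrite resM Ed // mulr0.
- by rewrite resM Ec // mul0r.
Qed.

Section Bockstein.
Variables (gT : finGroupType) (p : nat).

Local Notation q := (#|'F_p|%:Z).

(* Values in 'F_p are lifted to integers between 0 and #|'F_p| - 1, and       *)
(* #|'F_p| is p when p is prime.                                              *)
Definition lift_cochain (f : cochain gT 'F_p) : cochain gT int :=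
  fun w => (f w : nat)%:Z.
Definition red_cochain (f : cochain gT int) : cochain gT 'F_p :=
  fun w => (f w)%:~R.
Definition div_cochain (f : cochain gT int) : cochain gT int :=
  fun w => (f w %/ q)%Z.

Let Fp_nat (m : nat) : (m%:R == 0 :> 'F_p) = (#|'F_p| %| m)%N.
Proof.
have Zp_nat_eq0 k : (m%:R == 0 :> 'I_k.+2) = (k.+2 %| m)%N.
  by rewrite Zp_nat -val_eqE.
by rewrite card_ord; apply: Zp_nat_eq0.
Qed.

Let red_eq0 (m : int) : (m%:~R == 0 :> 'F_p) = (q %| m)%Z.
Proof.
by case: m => m; rewrite ?NegzE ?mulrNz ?oppr_eq0 ?dvdzN -pmulrn Fp_nat dvdzE.
Qed.

Let red_lift f : red_cochain (lift_cochain f) = f.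
Proof.
by apply: cochainP => w; rewrite /red_cochain /lift_cochain -pmulrn natr_Zp.
Qed.

Let red_coboundary f : red_cochain (coboundary f) = coboundary (red_cochain f).
Proof.
apply: cochainP => -[|x s]; rewrite /red_cochain //=.
rewrite !rmorphD /= rmorphM rmorphXn rmorphN1 rmorph_sum /=.
congr (_ + _ + _); apply: eq_bigr => i _.
by rewrite rmorphM rmorphXn rmorphN1.
Qed.

Let redB f g : red_cochain (f - g) = red_cochain f - red_cochain g.
Proof. by apply: cochainP => w; rewrite /red_cochain cochainBE rmorphB. Qed.

Let q_neq0 : q != 0.
Proof. by rewrite card_ord. Qed.

Let div_cochainK f : red_cochain f = 0 -> q *: div_cochain f = f.
Proof.
move=> rf0; apply: cochainP => w; rewrite cochainZE mulrC divzK // -red_eq0.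
by apply/eqP; have := congr1 (fun g : cochain gT 'F_p => g w) rf0.
Qed.

Let scale_inj (f g : cochain gT int) : q *: f = q *: g -> f = g.
Proof.
move=> eq_qfg; apply: cochainP => w.
by have /(mulfI q_neq0) := congr1 (fun h : cochain gT int => h w) eq_qfg.
Qed.

Let bounded_lift f : bounded f -> bounded (lift_cochain f).
Proof. by case=> N fN; exists N => w /fN; rewrite /lift_cochain => ->. Qed.
Let bounded_red f : bounded f -> bounded (red_cochain f).
Proof. by case=> N fN; exists N => w /fN; rewrite /red_cochain => ->. Qed.
Let bounded_div f : bounded f -> bounded (div_cochain f).
Proof.
by case=> N fN; exists N => w /fN; rewrite /div_cochain => ->; rewrite div0z.
Qed.

(* The connecting map of 0 -> Z/p -> Z/p^2 -> Z/p -> 0, computed with         *)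
(* integral lifts: if d f~ = p g for an integral lift f~ of the cocycle f,    *)
(* then the Bockstein of the class of f is the class of g mod p.              *)
Definition bockstein_cochain (f : cochain gT 'F_p) : cochain gT 'F_p :=
  red_cochain (div_cochain (coboundary (lift_cochain f))).

Let red_coboundary_lift (z : cocycle gT 'F_p) :
  red_cochain (coboundary (lift_cochain z)) = 0.
Proof. by rewrite red_coboundary red_lift coboundary_cocycle. Qed.

Fact bockstein_is_cocycle (z : cocycle gT 'F_p) :
  is_cocycle (bockstein_cochain z).
Proof.
apply/asboolP; split.
  by apply/bounded_red/bounded_div/bounded_coboundary/bounded_lift/bounded_cocycle.
rewrite -red_coboundary (_ : coboundary (div_cochain _) = 0).
  by apply: cochainP.
apply: scale_inj.
by rewrite -coboundaryZ div_cochainK // coboundaryK scaler0.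
Qed.

Definition bockstein_cocycle (z : cocycle gT 'F_p) : cocycle gT 'F_p :=
  Cocycle (bockstein_is_cocycle z).

(* By [bocksteinE], it does not depend on the chosen representative.          *)
Definition bockstein (c : cohomology gT 'F_p) : cohomology gT 'F_p :=
  cclass (bockstein_cocycle (repr c)).

Lemma bocksteinE z : bockstein (cclass z) = cclass (bockstein_cocycle z).
Proof.
have : is_coboundary (repr (cclass z) - z).
  by apply/cclassP; rewrite cclass_repr.
rewrite /bockstein; move: (repr _) => y /asboolP[f bf fE].
pose g := lift_cochain y - lift_cochain z - coboundary (lift_cochain f).
have bg : bounded g.
  do 2 ?[apply: boundedD | rewrite -scaleN1r; apply: boundedZ].
  - exact/bounded_lift/bounded_cocycle.
  - by rewrite -scaleN1r; apply/boundedZ/bounded_lift/bounded_cocycle.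
  - exact/bounded_coboundary/bounded_lift.
have rg : red_cochain g = 0.
  by rewrite !redB red_coboundary !red_lift -fE; exact: subrr.
apply/cclassP/asboolP; exists (red_cochain (div_cochain g)).
  exact/bounded_red/bounded_div.
rewrite raddfB /= /bockstein_cochain -redB -red_coboundary; congr red_cochain.
apply: scale_inj; rewrite scalerBr !div_cochainK // -coboundaryZ div_cochainK //.
by rewrite !coboundaryB coboundaryK subr0.
Qed.

End Bockstein.

Definition H1_basis (gT : finGroupType) (p n : nat)
    (a : 'I_n -> cohomology gT 'F_p) : Prop :=
  (forall i, has_degree 1 (a i)) /\
  (forall c, has_degree 1 c ->
     exists! k : 'rV['F_p]_n, c = \sum_i k 0 i *: a i).

Section Mui.
Variables (gT : finGroupType) (p n : nat).
Variable a : 'I_n -> cohomology gT 'F_p.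

Definition poly_gen (i : 'I_n) : cohomology gT 'F_p := bockstein (a i).

Local Notation x := poly_gen.

(* The indices s and i start at 0. The determinants are taken in the          *)
(* noncommutative ring H^*(gT, F_p) with the Leibniz formula, in which the    *)
(* factors are ordered by their rows.                                         *)
Definition mui_mx : 'M[cohomology gT 'F_p]_n :=
  \matrix_(s, i) x i ^+ (p ^ s).

Definition mui_L : cohomology gT 'F_p := \det mui_mx.

(* the row a, followed by the rows of mui_mx other than row s *)
Definition mui_E (s : 'I_n) : 'M[cohomology gT 'F_p]_n :=
  \matrix_(j, i) if val j is k.+1 then x i ^+ (p ^ bump s k) else a i.

Definition mui_M (s : 'I_n) : cohomology gT 'F_p := \det (mui_E s).

(* The product runs through S in increasing order.                            *)
Definition mui (S : {set 'I_n}) : cohomology gT 'F_p :=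
  if S == finset.set0 then mui_L
  else xget 0 [set m | mui_L ^+ #|S|.-1 * m = \prod_(s in S) mui_M s]%classic.

(* H^*(gT, F_p) is a module over F_p[x_1, .., x_n] via the evaluation         *)
(* morphism 'X_i |-> x_i.                                                     *)
Definition poly_eval (f : {mpoly 'F_p[n]}) : cohomology gT 'F_p :=
  mmap (GRing.in_alg (cohomology gT 'F_p)) x f.

Definition free_on (E : cohomology gT 'F_p -> Prop) (I : finType)
    (m : I -> cohomology gT 'F_p) : Prop :=
  (forall i, E (m i)) /\
  (forall e, E e -> exists! k : {ffun I -> {mpoly 'F_p[n]}},
     e = \sum_i poly_eval (k i) * m i).

End Mui.

(* Main.v *)
(* The cohomology ring H of V is computed by induction on the rank, along the *)
(* kernel W of a nonzero class a of degree 1, with x = beta(a): a class is    *)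
(* zero on W iff it lies in a H + x H, multiplication by x is injective, and  *)
(* a v + x v' = 0 implies that v is zero on W. These facts come from the      *)
(* exact sequences 0 -> F_p -> M -> M -> F_p -> 0 for M the module of the     *)
(* functions on V / W, whose cohomology is that of W. Hence H is free over S  *)
(* on the exterior monomials in the a_i, and e is essential iff x_l divides   *)
(* a_l e for all linear forms l <> 0.                                         *)
(* L_n is, up to a constant, the product of the x_l over the lines of V^*, so *)
(* that a class divisible by all the x_l is divisible by L_n. It follows that *)
(* the product of two essential classes is L_n times an essential class; this *)
(* gives the M_(n,S). By Cramer's rule, L_n a_i = sum_s (-1)^s x_i^(p^s) M_s, *)
(* so that L_n H is contained in the S-span of the M_(n,S). If e is essential *)
(* and D e = sum_S g_S M_(n,S), then D divides each g_S: multiplying by the   *)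
(* Mui invariant of the complement of S isolates g_S, since M_(n,S) times it  *)
(* is L_n a_1 .. a_n up to sign. The theorem follows by taking D = L_n for    *)
(* generation and D = 0 for independence.                                     *)
Require Import Defs.
From mathcomp Require Import all_boot all_order all_fingroup all_algebra.
From mathcomp Require Import all_solvable mxabelem ring zify boolp mpoly.
From mathcomp Require classical_sets.

Set Implicit Arguments.
Unset Strict Implicit.
Unset Printing Implicit Defensive.

Import GRing.Theory.
Local Open Scope ring_scope.

(** * Cochains and twisted coboundaries *)

(** The proof first determines the ring [H] of [V]: it is generated by the [a_i] and [x_i]
    ([cbelow_gen]), and it is free over the polynomials on the exterior monomials in the [a_i]
    ([ext_mon_span], [ext_mon_indep]). Both facts come from restricting to the kernel of one nonzero
    class of degree 1, where the statements collected in [gysin_at] take the place of a Kunneth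
    formula. They are proved on cochains, with values in the functions on F_p, in [gysin_exact],
    [gysin_regular] and [gysin_res].

    Freeness turns divisibility in [H] into divisibility of coefficients, and being essential
    becomes an arithmetic condition at each nonzero linear form ([EssP]). The Moore determinant [L]
    is, up to a scalar, the product of one linear form per line ([moore_factor]) and hence
    squarefree, so a product of two essential classes is [L] times an essential class
    ([Ess_mul_cdvd]). This single lemma does two jobs: it produces the Mui invariants and shows that
    they are essential ([muiP]), and it clears denominators in [mui_coef_dvd].

    By Cramer's rule [L] times any class lies in the span of the Mui invariants ([a_mul_mui_span],
    [in_span_stable]). For [e] essential, pairing an expansion of [L e] with the invariants of
    complementary sets ([mui_mul_setC]) shows that [L] divides every coefficient, so that [e] itself
    lies in the span. The same argument with 0 in place of [L] gives uniqueness. *)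

Section TwistedCochains.

Variables (gT : finGroupType) (R : comNzRingType).
Implicit Types (f g : cochain gT R) (w : seq gT).

(** An explicit degree bound, sharper than [bounded]; the inductions on the degree run on it. *)
Definition below (m : nat) f := forall w, (m <= size w)%N -> f w = 0.

Lemma bounded_below f : bounded f <-> exists m, below m f.
Proof. by split=> [[N fN]|[m fm]]; [exists N.+1 | exists m => w /ltnW/fm]. Qed.

Lemma below_bounded m f : below m f -> bounded f.
Proof. by move=> fm; apply/bounded_below; exists m. Qed.

Lemma boundedB f g : bounded f -> bounded g -> bounded (f - g).
Proof. by move=> bf bg; rewrite -scaleN1r; apply/boundedD/boundedZ. Qed.

Lemma belowD m f g : below m f -> below m g -> below m (f + g).
Proof. by move=> fm gm w mw; rewrite cochainDE fm ?gm ?addr0. Qed.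

Lemma belowN m f : below m f -> below m (- f).
Proof. by move=> fm w mw; rewrite cochainNE fm ?oppr0. Qed.

Lemma belowB m f g : below m f -> below m g -> below m (f - g).
Proof. by move=> fm gm; apply/belowD/belowN. Qed.

Lemma belowZ m (c : R) f : below m f -> below m (c *: f).
Proof. by move=> fm w mw; rewrite cochainZE fm ?mulr0. Qed.

Lemma below_sum (I : finType) m (F : I -> cochain gT R) :
  (forall i, below m (F i)) -> below m (\sum_i F i).
Proof. by move=> Fm; elim/big_ind: _ => // f g; apply: belowD. Qed.

Lemma below0 f : below 0 f -> f = 0.
Proof. by move=> f0; apply: cochainP => w; apply: f0. Qed.

Lemma below_leq m k f : (m <= k)%N -> below m f -> below k f.
Proof. by move=> lemk fm w /(leq_trans lemk)/fm. Qed.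

Lemma belowM m k f g : below m.+1 f -> below k g -> below (m + k) (f * g).
Proof.
move=> fm gk w mkw; rewrite [LHS]big1 // => i _.
have [lti|] := ltnP m i; last first.
  move=> leim; rewrite [X in _ * X]gk ?mulr0 // size_drop leq_subRL.
    by rewrite (leq_trans _ mkw) // leq_add2r.
  by rewrite -ltnS ltn_ord.
by rewrite fm ?mul0r // size_takel // -ltnS.
Qed.

Definition cut m f : cochain gT R := fun w => if (size w < m)%N then f w else 0.

Lemma below_cut m f : below m (cut m f).
Proof. by move=> w mw; rewrite /cut ltnNge mw. Qed.

Lemma cut_below m f : below m f -> cut m f = f.
Proof.
move=> fm; apply: cochainP => w; rewrite /cut; case: ltnP => // mw.
by rewrite fm.
Qed.

(** Thanks to this, a primitive that is only known to be bounded can be truncated to one of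
    controlled degree. *)
Lemma coboundary_cut m f : coboundary (cut m f) = cut m.+1 (coboundary f).
Proof.
apply: cochainP => -[|x s]; rewrite /cut //= ltnS size_takel //.
have [ltsm|lems] := ltnP (size s) m.
  congr (_ + _ + _); apply: eq_bigr => i _.
  by rewrite size_merge_at // ltsm.
rewrite mulr0 addr0 add0r big1 // => i _.
by rewrite size_merge_at // ltnNge lems mulr0.
Qed.

Lemma below_coboundary m f : below m f -> below m.+1 (coboundary f).
Proof. by move=> fm; rewrite -(cut_below fm) coboundary_cut; apply: below_cut. Qed.

Definition indeg m f := forall w, size w != m -> f w = 0.

Lemma indeg_below m f : indeg m f -> below m.+1 f.
Proof. by move=> fm w; rewrite leqNgt ltnS => mw; apply/fm/eqP => ?; lia. Qed.

Lemma indeg_coboundary m f : indeg m f -> indeg m.+1 (coboundary f).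
Proof.
move=> fm [|x s] //=; rewrite eqSS => ms; rewrite !fm ?size_takel // mulr0 addr0 add0r.
by rewrite big1 // => i _; rewrite fm ?mulr0 // size_merge_at.
Qed.

Lemma indegM m k f g : indeg m f -> indeg k g -> indeg (m + k) (f * g).
Proof.
move=> fm gk w mkw; rewrite [LHS]big1 // => i _.
have [eim|nim] := eqVneq (i : nat) m; last first.
  by rewrite fm ?mul0r // size_takel // -ltnS.
rewrite [X in _ * X]gk ?mulr0 // size_drop eim.
by have := ltn_ord i; rewrite eim; lia.
Qed.

Lemma indegD m f g : indeg m f -> indeg m g -> indeg m (f + g).
Proof. by move=> fm gm w mw; rewrite cochainDE fm ?gm ?addr0. Qed.

Lemma indegN m f : indeg m f -> indeg m (- f).
Proof. by move=> fm w mw; rewrite cochainNE fm ?oppr0. Qed.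

Lemma indegB m f g : indeg m f -> indeg m g -> indeg m (f - g).
Proof. by move=> fm gm; apply/indegD/indegN. Qed.

Lemma indeg_eq m f g : indeg m f -> indeg m g ->
  (forall w, size w = m -> f w = g w) -> f = g.
Proof.
move=> fm gm fg; apply: cochainP => w.
by have [/fg|/[dup] /fm -> /gm] := eqVneq (size w) m.
Qed.

Definition face0 f : cochain gT R := fun w => if w is _ :: s then f s else 0.
(** All faces but the first. The first face is the only one that sees an action on the coefficients,
    so [cobd1] is common to the plain and the twisted coboundary. *)
Definition cobd1 f : cochain gT R := coboundary f - face0 f.
Definition lmerge (x : gT) f : cochain gT R := fun w =>
  if w is y :: s then f ((x * y)%g :: s) else f [::].

Lemma cobd1_nil f : cobd1 f [::] = 0.
Proof. by rewrite /cobd1 cochainBE subr0. Qed.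

Lemma cobd1_cons f x w : cobd1 f (x :: w) = - lmerge x f w - cobd1 (lshiftc x f) w.
Proof.
have cancel (a b c : R) : a + b + c - a = b + c by ring.
rewrite /cobd1 !cochainBE /= cancel.
case: w => [|y s]; first by rewrite /= big_ord0 !subr0 add0r mulN1r.
rewrite [coboundary _ _]/= [face0 _ _]/= cancel big_ord_recl expr1 mulN1r -addrA.
rewrite {1}/merge_at /= drop0; congr (_ + _).
rewrite opprD -sumrN; congr (_ + _); last by rewrite exprS mulN1r mulNr.
by apply: eq_bigr => i _; rewrite exprS mulN1r mulNr.
Qed.

Variables (C : zmodType) (lam : gT -> C).
Hypothesis (lamM : forall x y, lam (x * y)%g = lam x + lam y).
Implicit Types (F : C -> cochain gT R) (c : C).

(* [tcob] is the coboundary on the cochains with values in the module of      *)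
(* functions C -> R, on which x in gT acts by translation by lam x.           *)
Definition tcob F c : cochain gT R := fun w =>
  (if w is x :: s then F (c + lam x) s else 0) + cobd1 (F c) w.

Lemma tcobE F c : tcob F c = coboundary (F c) +
  ((fun w => if w is x :: s then F (c + lam x) s - F c s else 0) : cochain gT R).
Proof.
apply: cochainP => w; rewrite /tcob /cobd1 cochainBE cochainDE.
case: w => [|x s]; first by rewrite /= add0r subr0 addr0.
by rewrite [face0 _ _]/= addrCA.
Qed.

Lemma tcobD F G c : tcob (fun c => F c + G c) c = tcob F c + tcob G c.
Proof.
rewrite !tcobE coboundaryD addrACA; congr (_ + _).
by apply: cochainP => -[|x s]; rewrite cochainDE ?addr0 // !cochainDE opprD addrACA.
Qed.

Lemma tcobN F c : tcob (fun c => - F c) c = - tcob F c.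
Proof.
rewrite !tcobE coboundaryN opprD; congr (_ + _).
by apply: cochainP => -[|x s]; rewrite cochainNE ?oppr0 // !cochainNE opprD.
Qed.

Lemma tcobB F G c : tcob (fun c => F c - G c) c = tcob F c - tcob G c.
Proof. by rewrite tcobD tcobN. Qed.

Lemma tcob_const f c : tcob (fun _ => f) c = coboundary f.
Proof.
rewrite tcobE; apply: cochainP => w; rewrite cochainDE.
by case: w => [|x s] /=; rewrite ?subrr addr0.
Qed.

Lemma tcob_shift d F c : tcob (fun c => F (d + c)) c = tcob F (d + c).
Proof. by rewrite !tcobE; congr (_ + _); apply: cochainP => -[|x s]; rewrite ?addrA. Qed.

Lemma tcobM F f c :
  tcob (fun c => F c * f) c = tcob F c * f + sgnc (F c) * coboundary f.
Proof.
rewrite !tcobE coboundaryM mulrDl addrAC; congr (_ + _).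
congr (_ + _); apply: cochainP => -[|x s].
  by rewrite [RHS]cup_nil mul0r.
rewrite [RHS]cup_cons mul0r add0r /=.
rewrite -[RHS]/((((fun s => F (c + lam x) s - F c s) : cochain gT R) * f) s).
by rewrite -cochainBE -mulrBl.
Qed.

Lemma tcobK F c : tcob (tcob F) c = 0.
Proof.
rewrite tcobE [X in coboundary X]tcobE coboundaryD coboundaryK add0r.
set tw := (X in coboundary X); apply: cochainP => -[|x s]; rewrite cochainDE ?addr0 //.
have d_cons (f : cochain gT R) v : coboundary f v = face0 f v + cobd1 f v.
  by rewrite /cobd1 cochainBE addrC subrK.
rewrite d_cons cobd1_cons (_ : lshiftc x tw = F (c + lam x) - F c) //.
rewrite !tcobE !cochainDE -/tw addrACA.
have -> : cobd1 (F (c + lam x) - F c) s = coboundary (F (c + lam x)) s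
    - coboundary (F c) s - face0 (F (c + lam x) - F c) s.
  by rewrite /cobd1 coboundaryB !cochainBE.
rewrite [face0 tw _]/=; case: s => [|y s].
  by rewrite cochain0E /=; ring.
rewrite cochain0E [tw _]/= [lmerge _ _ _]/= [face0 _ _]/= lamM [c + (_ + _)]addrA cochainBE.
by ring.
Qed.

Lemma below_tcob m F c : (forall c, below m (F c)) -> below m.+1 (tcob F c).
Proof.
move=> Fm; rewrite tcobE; apply: belowD; first exact: below_coboundary.
by case=> //= x s ltms; rewrite !Fm // subr0.
Qed.

Variables (pi : gT -> gT) (tau : C -> gT).
Hypotheses (lam_pi : forall x, lam (pi x) = 0) (lam_tau : cancel tau lam).
Hypothesis (piM : {morph pi : x y / (x * y)%g}).
Hypothesis (tauM : forall c x, (tau c * x = pi x * tau (c + lam x))%g).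

(* The homotopy induced by the natural isomorphism tau between the identity   *)
(* of the action groupoid of C and the retraction pi onto the kernel of lam.  *)
Fixpoint thom c f w : R :=
  if w is x :: s then f [:: tau c, x & s] - thom (c + lam x) (lshiftc (pi x) f) s
  else f [:: tau c].

Let thomD c f g w : thom c (f + g) w = thom c f w + thom c g w.
Proof.
elim: w c f g => [|x w IHw] c f g //=.
rewrite (_ : lshiftc _ (f + g) = lshiftc (pi x) f + lshiftc (pi x) g) //.
by rewrite IHw opprD addrACA.
Qed.

Let thomN c f w : thom c (- f) w = - thom c f w.
Proof.
elim: w c f => [|x w IHw] c f //=.
rewrite (_ : lshiftc _ (- f) = - lshiftc (pi x) f) //.
by rewrite IHw opprD.
Qed.

Lemma below_thom c m f : below m f -> below m.-1 (thom c f).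
Proof.
move=> fm w; have {}fm : forall v, (m <= size v)%N -> f v = 0 by [].
elim: w m c f fm => [|x w IHw] m c f fm /= lemw.
  by apply: fm; rewrite -subn1 leq_subLR in lemw.
rewrite fm /=; last by rewrite -subn1 leq_subLR in lemw.
rewrite (IHw m.-1) ?subr0 // => [v lemv|].
  by apply: fm => /=; rewrite -subn1 leq_subLR in lemv.
by rewrite -subn1 leq_subLR.
Qed.

Let cobd1D f g : cobd1 (f + g) = cobd1 f + cobd1 g.
Proof.
rewrite /cobd1 coboundaryD [RHS]addrACA; congr (_ + _); rewrite -opprD; congr (- _).
by apply: cochainP => -[|x s]; rewrite cochainDE /= ?addr0.
Qed.

Let cobd1N f : cobd1 (- f) = - cobd1 f.
Proof.
rewrite /cobd1 coboundaryN opprD; congr (_ - _).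
by apply: cochainP => -[|x s]; rewrite cochainNE /= ?oppr0.
Qed.

(** The prism identity: [thom] is the alternating sum over the places where [tau] is inserted, with
    the letters before it projected by [pi]. Neighbouring merges cancel by [tauM], and the last face
    leaves the projected word. The other end of the prism is absent because [cobd1] has no first
    face. *)
Let thom_cobd1 c f w :
  thom c (cobd1 f) w + cobd1 (thom c f) w = - f (map pi w).
Proof.
elim: w c f => [|x w IHw] c f.
  by rewrite cobd1_nil addr0 /= cobd1_cons cobd1_nil subr0.
rewrite /= (_ : lshiftc (pi x) (cobd1 f) =
    - lmerge (pi x) f - cobd1 (lshiftc (pi x) f)); last first.
  by apply: cochainP => v; rewrite cochainBE -cobd1_cons.
rewrite thomD !thomN !cobd1_cons.
have -> : lshiftc x (thom c f) = lshiftc x (lshiftc (tau c) f)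
    - (thom (c + lam x) (lshiftc (pi x) f) : cochain gT R).
  by apply: cochainP.
rewrite cobd1D cobd1N cochainDE cochainNE.
have /eqP := IHw (c + lam x) (lshiftc (pi x) f).
rewrite -subr_eq0 opprK => /eqP IH.
have E : - lmerge (tau c) f (x :: w) + lmerge x (lshiftc (tau c) f) w
    + thom (c + lam x) (lmerge (pi x) f) w - lmerge x (thom c f) w = 0.
  rewrite [lmerge _ _ (_ :: _)]/=.
  case: w {IHw IH} => [|y s] /=; rewrite /lshiftc /= ?tauM; first ring.
  by rewrite lamM piM [c + (_ + _)]addrA; ring.
rewrite [f (pi x :: _)](_ : _ = lshiftc (pi x) f (map pi w)) //.
apply/eqP; rewrite -subr_eq0 opprK; apply/eqP.
rewrite -[RHS]addr0 -{2}IH -E; ring.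
Qed.

(** The part of Shapiro's lemma that is needed, with an explicit primitive. Closedness at 0 makes
    [cobd1 (F 0)] minus the cochain [G] that evaluates [F] at [lam] of the first letter, and the
    leading term of [thom c G] is [F c]. *)
Lemma thomP F c w : (forall v, tcob F 0 v = 0) ->
  F c w = F 0 (map pi w) + tcob (fun c => thom c (F 0)) c w.
Proof.
move=> dF; have dF0 : tcob F 0 = 0 by apply: cochainP.
pose G : cochain gT R := fun w => if w is x :: s then F (lam x) s else 0.
have dG : cobd1 (F 0) = - G.
  apply: cochainP => v; rewrite cochainNE; apply/eqP; rewrite -addr_eq0 addrC.
  by rewrite -(dF v) /tcob /G; case: v => [|x s] //; rewrite add0r.
have -> : F 0 (map pi w) = thom c G w - cobd1 (thom c (F 0)) w.
  by rewrite -[LHS]opprK -(thom_cobd1 c) dG thomN; ring.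
rewrite /tcob; case: w => [|x s]; first by rewrite /= lam_tau; ring.
rewrite [thom c G _]/= lam_tau (_ : lshiftc (pi x) G = F 0); first by ring.
by apply: cochainP => v; rewrite /lshiftc /= lam_pi.
Qed.

End TwistedCochains.

Section Pullback.

Variables (gT hT : finGroupType) (R : comNzRingType) (phi : gT -> hT).
Hypothesis phiM : {morph phi : x y / (x * y)%g}.

Definition pullback (f : cochain hT R) : cochain gT R := fun w => f (map phi w).

Lemma coboundary_pullback f : coboundary (pullback f) = pullback (coboundary f).
Proof.
apply: cochainP => -[|x s] //; rewrite /pullback /= size_map map_take /=.
congr (_ + _ + _); apply: eq_bigr => i _; congr (_ * f _).
rewrite /merge_at map_cat map_take /= map_drop phiM.
by rewrite -!(nth_map _ 1%g phi) //= ltnW // ltnS.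
Qed.

Lemma below_pullback m f : below m f -> below m (pullback f).
Proof. by move=> fm w mw; apply: fm; rewrite size_map. Qed.

End Pullback.

(** * Carry cocycles *)

Section Carry.

Variable p : nat.
Implicit Types a b c d : 'F_p.

Definition carry_nat a b := ((a + b) %/ #|'F_p|)%N.
(** The 2-cocycle of the extension of Z/p by Z/p with middle group Z/p^2; it computes Bocksteins in
    [bockstein_homc]. *)
Definition carry a b : 'F_p := (carry_nat a b)%:R.

Lemma carry_natE a b :
  (a + b = carry_nat a b * #|'F_p| + (a + b)%R)%N.
Proof. by rewrite {1}[LHS](divn_eq _ #|'F_p|) [X in (_ %% X)%N]card_ord. Qed.

Lemma carryC a b : carry a b = carry b a.
Proof. by rewrite /carry /carry_nat addnC. Qed.

Let card_Fp' : (0 < #|'F_p|)%N. Proof. by rewrite card_ord. Qed.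

Lemma carryA a b c : carry a b + carry (a + b) c = carry b c + carry a (b + c).
Proof.
rewrite /carry -!natrD; congr _%:R.
have := carry_natE a b; have := carry_natE (a + b) c.
have := carry_natE b c; have := carry_natE a (b + c).
rewrite addrA; move: (carry_nat a b) (carry_nat b c) => k1 k2.
move: (carry_nat (a + b) c) (carry_nat a (b + c)) card_Fp' => k3 k4.
move: (nat_of_ord (a + b + c)) (nat_of_ord (b + c)) (nat_of_ord (a + b)) => r s t.
move: (nat_of_ord a) (nat_of_ord b) (nat_of_ord c) #|_| => x y z q q_gt0 E1 E2 E3 E4.
apply/eqP; rewrite -(eqn_pmul2r q_gt0) !mulnDl; lia.
Qed.

Lemma carryAr a b c :
  carry a (b + c) = carry a b + carry (a + b) c - carry b c.
Proof. by rewrite carryA; ring. Qed.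

Lemma carryAl a b c :
  carry (a + b) c = carry b c + carry a (b + c) - carry a b.
Proof. by rewrite -carryA; ring. Qed.

Lemma carry1 c : carry 1 c = (c == -1)%:R.
Proof.
rewrite -addr_eq0 addrC /carry; congr _%:R.
have := carry_natE 1 c; rewrite -val_eqE /= [#|_|]card_ord.
have : (c < (Zp_trunc (pdiv p)).+2)%N by [].
set q := (Zp_trunc _).+2; rewrite [(1 %% q)%N]modn_small //.
case: eqP => [->|/eqP]; nia.
Qed.

Lemma sum_carry1 : \sum_c carry 1 c = 1.
Proof.
rewrite (bigD1 (-1)) //= carry1 eqxx big1 ?addr0 // => c /negPf cN1.
by rewrite carry1 cN1.
Qed.

Lemma carry_shift c d : carry (1 + c) d - carry c d = carry 1 (c + d) - carry 1 c.
Proof. by rewrite -[carry (1 + c) d](addKr (carry 1 c)) carryA; ring. Qed.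

End Carry.

(** * Cocycles attached to homomorphisms, and their commutation *)

Section HomClasses.

Variables (p : nat) (gT : finGroupType).
Implicit Types (lam mu : gT -> 'F_p) (f : cochain gT 'F_p).

Definition is_hom lam := forall x y, lam (x * y)%g = lam x + lam y.

Definition homc lam : cochain gT 'F_p :=
  fun w => if w is [:: x] then lam x else 0.

Definition carryc lam : cochain gT 'F_p :=
  fun w => if w is [:: x; y] then carry (lam x) (lam y) else 0.

Lemma indeg_homc lam : indeg 1 (homc lam).
Proof. by case=> [|x [|y s]]. Qed.

Lemma indeg_carryc lam : indeg 2 (carryc lam).
Proof. by case=> [|x [|y [|z s]]]. Qed.

Definition cochain2 (h : gT -> gT -> 'F_p) : cochain gT 'F_p :=
  fun w => if w is [:: x; y] then h x y else 0.

Definition cochain3 (h : gT -> gT -> gT -> 'F_p) : cochain gT 'F_p :=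
  fun w => if w is [:: x; y; z] then h x y z else 0.

Lemma indeg_cochain2 h : indeg 2 (cochain2 h).
Proof. by case=> [|x [|y [|z s]]]. Qed.

Lemma indeg_cochain3 h : indeg 3 (cochain3 h).
Proof. by case=> [|x [|y [|z [|t s]]]]. Qed.

Lemma coboundary_cochain2 (h : gT -> gT -> 'F_p) x y z :
  coboundary (cochain2 h) [:: x; y; z] =
  h y z - h (x * y)%g z + h x (y * z)%g - h x y.
Proof. by rewrite /= !big_ord_recl big_ord0 /=; ring. Qed.

Lemma coboundary_cochain3 (h : gT -> gT -> gT -> 'F_p) x y z t :
  coboundary (cochain3 h) [:: x; y; z; t] =
  h y z t - h (x * y)%g z t + h x (y * z)%g t - h x y (z * t)%g + h x y z.
Proof. by rewrite /= !big_ord_recl big_ord0 /=; ring. Qed.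

Lemma cobd_homc lam : is_hom lam -> coboundary (homc lam) = 0.
Proof.
move=> lamM; apply/(@indeg_eq _ _ 2); [exact/indeg_coboundary/indeg_homc|by []|].
move=> [|x [|y [|z s]]] // _; rewrite /= big_ord_recl big_ord0 /= lamM cochain0E.
by ring.
Qed.

Lemma homcM lam mu : homc lam * homc mu = cochain2 (fun x y => lam x * mu y).
Proof.
apply/(@indeg_eq _ _ 2); [exact: indegM (indeg_homc _) (indeg_homc _)|exact: indeg_cochain2|].
move=> [|x [|y [|z s]]] // _.
by rewrite [LHS]/(cup _ _ _) /cup /= !big_ord_recl big_ord0 /=; ring.
Qed.

Lemma homc_anticomm lam mu : is_hom lam -> is_hom mu ->
  homc lam * homc mu + homc mu * homc lam =
  coboundary (- homc (fun x => lam x * mu x)).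
Proof.
move=> lamM muM; rewrite !homcM; apply/(@indeg_eq _ _ 2).
- by apply: indegD; apply: indeg_cochain2.
- exact/indeg_coboundary/indegN/indeg_homc.
move=> [|x [|y [|z s]]] // _; rewrite cochainDE /= big_ord_recl big_ord0 /= !cochainNE /=.
by rewrite lamM muM; ring.
Qed.

(* Steenrod's cup-1 product gives the homotopies between f g and g f. *)
Lemma carryc_homc lam mu : is_hom lam -> is_hom mu ->
  carryc lam * homc mu - homc mu * carryc lam =
  coboundary (cochain2 (fun x y => carry (lam x) (lam y) * (mu x + mu y))).
Proof.
move=> lamM muM; apply/(@indeg_eq _ _ 3).
- apply: indegB; first exact: indegM (indeg_carryc _) (indeg_homc _).
  exact: indegM (indeg_homc _) (indeg_carryc _).
- exact/indeg_coboundary/indeg_cochain2.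
move=> [|x [|y [|z [|t s]]]] // _; rewrite coboundary_cochain2 cochainBE.
rewrite [X in X - _]/(cup _ _ _) [X in _ - X]/(cup _ _ _) /cup /=.
rewrite !big_ord_recl !big_ord0 /= !lamM !muM.
by rewrite carryAr; ring.
Qed.

Lemma carryc_comm lam mu : is_hom lam -> is_hom mu ->
  carryc mu * carryc lam - carryc lam * carryc mu =
  coboundary (cochain3 (fun x y z =>
    carry (lam x + lam y) (lam z) * carry (mu x) (mu y)
    - carry (lam x) (lam y + lam z) * carry (mu y) (mu z))).
Proof.
move=> lamM muM; apply/(@indeg_eq _ _ 4).
- by apply: indegB; exact: indegM (indeg_carryc _) (indeg_carryc _).
- exact/indeg_coboundary/indeg_cochain3.
move=> [|x [|y [|z [|t [|r s]]]]] // _; rewrite coboundary_cochain3 cochainBE.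
rewrite [X in X - _]/(cup _ _ _) [X in _ - X]/(cup _ _ _) /cup /=.
rewrite !big_ord_recl !big_ord0 /= !lamM !muM -!addrA.
by rewrite !carryAl -!addrA; ring.
Qed.

End HomClasses.

(** * Gysin sequences on cochains *)

Section Gysin.

Variables (p : nat) (gT : finGroupType) (lam : gT -> 'F_p).
Variables (pi : gT -> gT) (tau : 'F_p -> gT).
Hypotheses (p_pr : prime p) (lamM : is_hom lam).
Hypotheses (lam_pi : forall x, lam (pi x) = 0) (lam_tau : cancel tau lam).
Hypothesis (piM : {morph pi : x y / (x * y)%g}).
Hypothesis (tauM : forall c x, (tau c * x = pi x * tau (c + lam x))%g).

Implicit Types (f : cochain gT 'F_p) (F : 'F_p -> cochain gT 'F_p).

(** The middle map of 0 -> F_p -> M -> M -> F_p -> 0 for M the functions on F_p: its kernel consists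
    of the constants, and its image is where the sum over F_p vanishes. *)
Let delta F c := F (1 + c) - F c.

Let tcob_delta F c : tcob lam (delta F) c = delta (tcob lam F) c.
Proof. by rewrite tcobB tcob_shift. Qed.

Let coboundary_sum F : coboundary (\sum_c F c) = \sum_c coboundary (F c).
Proof. exact: (big_morph _ (@coboundaryD _ _) (@coboundary0 _ _)). Qed.

Let sum_tcob F : \sum_c tcob lam F c = coboundary (\sum_c F c).
Proof.
under eq_bigr do rewrite tcobE; rewrite big_split coboundary_sum.
rewrite [X in _ + X = _](_ : _ = 0) ?addr0 //.
have sumE G w : (\sum_c G c : cochain gT 'F_p) w = \sum_c G c w.
  by apply: (big_morph (fun f : cochain gT 'F_p => f w)).
apply: cochainP => -[|x s]; rewrite sumE; first by rewrite big1.
by rewrite big_split /= sumrN [X in _ - X](reindex_inj (addIr (lam x))) /= subrr.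
Qed.

Let sum_const f : \sum_(c : 'F_p) f = 0.
Proof.
rewrite sumr_const card_Fp // -scaler_nat.
by have /andP[_ /eqP ->] := pchar_Fp p_pr; rewrite scale0r.
Qed.

Let tcob_scalar (phi : 'F_p -> 'F_p) c :
  tcob lam (fun c => (phi c)%:A) c = homc (fun x => phi (c + lam x) - phi c).
Proof.
rewrite tcobE coboundaryZ coboundary1 scaler0 add0r.
apply: cochainP => -[|x [|y s]] //; rewrite !cochainZE ?mulr0 ?subr0 //.
by rewrite /homc !mulr1.
Qed.

(* The 0-cochain A and the 1-cochains U c satisfy dA = lam, dU = carryc lam,  *)
(* delta A = 1, delta U = du for u = carry 1, which is the indicator of -1.   *)
Let U c : cochain gT 'F_p := homc (fun x => carry c (lam x)).
Let u c : cochain gT 'F_p := (carry 1 c)%:A.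
Let A c : cochain gT 'F_p := c%:A.

Let tcob_A c : tcob lam A c = homc lam.
Proof.
rewrite (tcob_scalar id); apply: cochainP => -[|x [|y s]] //.
by rewrite /homc /= addrAC subrr add0r.
Qed.

Let tcob_U c : tcob lam U c = carryc lam.
Proof.
apply: cochainP => w; rewrite tcobE cochainDE.
case: w => [|x [|y [|z s]]].
- by rewrite addr0.
- by rewrite /= big_ord0 /U /=; ring.
- by rewrite /= big_ord_recl big_ord0 /U /= lamM carryAr; ring.
- have -> : U (c + lam x) [:: y, z & s] - U c [:: y, z & s] = 0 by exact: subrr.
  rewrite addr0 -[LHS]/(coboundary (U c) [:: x, y, z & s]).
  exact: (indeg_coboundary (indeg_homc _)).
Qed.

Let delta_U c : delta U c = tcob lam u c.
Proof.
rewrite tcob_scalar /delta; apply: cochainP => w; rewrite cochainBE.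
case: w => [|x [|y s]]; rewrite ?subr0 //.
by rewrite /U /homc carry_shift addrC.
Qed.

Let tcob_u f c : coboundary f = 0 ->
  tcob lam (fun c => u c * f) c = delta (fun c => U c * f) c.
Proof.
move=> df; rewrite tcobM df mulr0 addr0 /delta -mulrBl.
by rewrite -[_ - _]/(delta U c) delta_U.
Qed.

Let sum_u f : \sum_c u c * f = f.
Proof. by rewrite -mulr_suml -scaler_suml sum_carry1 scale1r mul1r. Qed.

(** A partial sum: on representatives, [carry c (-1 - b)] is 1 exactly when b < c. *)
Let prim F c := \sum_b carry c (-1 - b) *: F b.

(** Differences of partial sums recover [F] except at -1, where the wrap-around subtracts the total;
    the indicator [u] of -1 puts it back. *)
Let primP F c : F c = u c * (\sum_c F c) + delta (prim F) c.
Proof.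
rewrite /delta /prim -sumrB mulr_algl scaler_sumr -big_split /=.
have shiftE b : carry 1 c + (carry (1 + c) (-1 - b) - carry c (-1 - b))
    = (c == b)%:R.
  rewrite carry_shift addrC subrK carry1 addrCA -subr_eq0 addrAC subrr add0r.
  by rewrite subr_eq0.
rewrite (bigD1 c) //= big1 ?addr0 => [|b /negPf bc].
  by rewrite -scalerBl -scalerDl shiftE eqxx scale1r.
by rewrite -scalerBl -scalerDl shiftE eq_sym bc scale0r.
Qed.

Let split_tcob F : (forall c, tcob lam F c = 0) ->
  exists2 E, (forall m, below m (F 0) -> forall c, below m.-1 (E c)) &
    forall c, F c = pullback pi (F 0) + tcob lam E c.
Proof.
move=> dF; exists (fun c => thom lam pi tau c (F 0)) => [m mF c|c].
  exact: below_thom.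
by apply: cochainP => w; apply: thomP => // v; rewrite dF.
Qed.

Let cob_pullback0 F : tcob lam F 0 = 0 -> coboundary (pullback pi (F 0)) = 0.
Proof.
move=> dF; rewrite coboundary_pullback //; apply: cochainP => w.
rewrite /pullback -[RHS](congr1 (fun f : cochain gT 'F_p => f (map pi w)) dF) tcobE.
rewrite [RHS]cochainDE; case: w => [|x s]; first by rewrite addr0.
by rewrite [X in _ = _ + X]/= lam_pi addr0 subrr addr0.
Qed.

Let sum_delta F : \sum_c delta F c = 0.
Proof. by rewrite sumrB [X in _ - X](reindex_inj (addrI 1)) subrr. Qed.

Let sum_split F f E : (forall c, F c = f + tcob lam E c) ->
  \sum_c F c = coboundary (\sum_c E c).
Proof.
by move=> FE; under eq_bigr do rewrite FE; rewrite big_split /= sum_const sum_tcob add0r.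
Qed.

Let delta0_const F : (forall c, delta F c = 0) -> forall c, F c = F 0.
Proof.
move=> dF c; rewrite -(natr_Zp c); elim: (c : nat) => // k IHk.
by rewrite mulrS -[RHS]IHk; apply/eqP; rewrite -subr_eq0 -[_ - _]/(delta F k%:R) dF.
Qed.

Let bounded_U c : bounded (U c).
Proof. exact/below_bounded/indeg_below/indeg_homc. Qed.

Let below_prim m F : (forall c, below m (F c)) -> forall c, below m (prim F c).
Proof. by move=> mF c; apply: below_sum => b; apply: belowZ. Qed.

(** A chase through the four-term sequence: [w] measures the failure of a twisted primitive of [y]
    to be constant, and [v] the failure at the next stage. The bounds drop by one and two because
    [homc lam] and [carryc lam] have degrees one and two. *)
Lemma gysin_exact m (y f : cochain gT 'F_p) :
  coboundary y = 0 -> below m y -> pullback pi y = coboundary f -> below m.-1 f ->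
  exists w v b : cochain gT 'F_p,
    [/\ [/\ coboundary w = 0, coboundary v = 0, below m.-1 w & below m.-2 v],
        bounded b & y = homc lam * w + carryc lam * v + coboundary b].
Proof.
move=> dy my yf mf.
have [c|E0 mE0 yE] := @split_tcob (fun _ => y); first by rewrite tcob_const.
(* By Shapiro, a primitive of the pullback makes [y], seen as a constant function, a twisted
   coboundary. *)
pose F c := f + E0 c.
have dF c : tcob lam F c = y.
  by rewrite tcobD tcob_const -yf; exact/esym/yE.
have mF c : below m.-1 (F c) by apply/belowD/mE0.
have dG c : tcob lam (delta F) c = 0 by rewrite tcob_delta /delta !dF subrr.
have [E mE GE] := split_tcob dG.
have mG : below m.-1 (delta F 0) by apply: belowB.
set w := pullback pi _ in GE; have dw : coboundary w = 0 by apply: cob_pullback0.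
(* Summing over F_p kills both [delta F] and the constant [w], so [v] is closed. *)
pose v := \sum_c E c.
have dv : coboundary v = 0 by rewrite -(sum_split GE) sum_delta.
pose X := tcob lam (prim E).
have EE c : tcob lam E c = delta (fun c => U c * v) c + delta X c.
  rewrite -tcob_u // -tcob_delta -tcobD; congr (tcob lam _ c).
  by apply/funext => d; apply: primP.
(* [A], [U] and [X] account for the whole difference of [F], so [H] is constant; applying [tcob] to
   [F] then yields the decomposition of [y], with [H 0] as the error term. *)
pose H c := F c - (c *: w + U c * v + X c).
have H0 c : H c = H 0.
  apply: delta0_const => {}c; rewrite /H /delta.
  have -> : F (1 + c) = F c + (w + tcob lam E c) by rewrite -GE /delta [RHS]addrC subrK.
  rewrite EE /delta scalerDl scale1r; apply: cochainP => s.
  by rewrite !(cochainDE, cochainNE, cochain0E); ring.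
have FE : F = fun c => H 0 + (A c * w + U c * v + X c).
  by apply/funext => c; rewrite -(H0 c) /H mulr_algl subrK.
have mE' c : below m.-2 (E c) by apply: mE.
have mv : below m.-2 v by apply: below_sum.
have mw : below m.-1 w by apply: below_pullback.
exists w, v, (H 0); split; last first.
- rewrite -[LHS](dF 0) FE (tcobD _ (fun=> H 0)).
  rewrite (tcobD _ (fun c => A c * w + U c * v) X) (tcobD _ (fun c => A c * w)).
  rewrite tcobK // addr0 tcob_const !tcobM dw dv !mulr0 !addr0 tcob_A tcob_U.
  by rewrite addrC.
- apply: boundedB; first exact: below_bounded (mF 0).
  apply: boundedD; last exact: below_bounded (below_tcob lam 0 (below_prim mE')).
  apply: boundedD; first exact: boundedZ (below_bounded mw).
  exact: boundedM (bounded_U 0) (below_bounded mv).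
- by split.
Qed.

(** [U * v - b] is a twisted cocycle; write it as a constant plus [tcob E]. Taking differences,
    [u * v - delta E] is closed as well, and its sum over F_p is [v]; summing the Shapiro
    decomposition of this second cocycle exhibits [v] as a coboundary. *)
Lemma gysin_regular (v b : cochain gT 'F_p) :
  coboundary v = 0 -> bounded v -> bounded b -> carryc lam * v = coboundary b ->
  exists2 b', bounded b' & v = coboundary b'.
Proof.
move=> dv mv bb vb.
pose F c := U c * v - b.
have dF c : tcob lam F c = 0.
  by rewrite tcobB tcobM dv mulr0 addr0 tcob_U tcob_const vb subrr.
have [k bF] : exists k, below k (F 0) by apply/bounded_below/boundedB => //; apply: boundedM.
have [E mE FE] := split_tcob dF.
have dG c : tcob lam (fun c => u c * v - delta E c) c = 0.
  rewrite tcobB tcob_u // tcob_delta /delta.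
  have tE d : tcob lam E d = F d - pullback pi (F 0) by rewrite [F d]FE addrC addKr.
  by rewrite !tE /F; apply: cochainP => s; rewrite !(cochainDE, cochainNE, cochain0E); ring.
have [k' bG] : exists k, below k (u 0 * v - delta E 0).
  apply/bounded_below/boundedB; first exact/boundedM/mv/boundedZ/bounded1.
  by apply: boundedB; apply: below_bounded (mE _ bF _).
have [E' mE' GE] := split_tcob dG.
exists (\sum_c E' c).
  by apply/below_bounded/below_sum => c; apply: mE' bG _.
by rewrite -(sum_split GE) sumrB sum_delta subr0 sum_u.
Qed.

(** The difference of the twisted cocycle [F] isolates [v] as a twisted coboundary at 0, and the
    twist is invisible on words with letters in the kernel of [lam]. *)
Lemma gysin_res (v v' b : cochain gT 'F_p) :
  coboundary v = 0 -> coboundary v' = 0 ->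
  bounded v -> bounded v' -> bounded b ->
  homc lam * v + carryc lam * v' = coboundary b ->
  exists2 f, bounded f & forall w, all (fun x => lam x == 0) w ->
    v w = coboundary f w.
Proof.
move=> dv dv' mv mv' bb vb.
pose F c := A c * v + U c * v' - b.
have dF c : tcob lam F c = 0.
  rewrite tcobB tcobD !tcobM dv dv' !mulr0 !addr0 tcob_U tcob_A tcob_const vb.
  by rewrite subrr.
have [k bF] : exists k, below k (F 0).
  apply/bounded_below/boundedB => //; apply: boundedD; last exact: boundedM.
  exact/boundedM/mv/boundedZ/bounded1.
have [E mE FE] := split_tcob dF.
pose X c := delta E c - u c * v'.
have vE : v = tcob lam X 0.
  rewrite tcobB tcob_u // tcob_delta /delta.
  have tE d : tcob lam E d = F d - pullback pi (F 0) by rewrite [F d]FE addrC addKr.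
  rewrite !tE /F /A addr0 scale1r mul1r scale0r mul0r.
  by apply: cochainP => s; rewrite !(cochainDE, cochainNE, cochain0E); ring.
exists (X 0).
  apply: boundedB; last exact/boundedM/mv'/boundedZ/bounded1.
  by apply: boundedB; apply: below_bounded (mE _ bF _).
move=> w wW; rewrite {1}vE tcobE cochainDE; case: w wW => [|x s].
  by rewrite addr0.
by case/andP=> /eqP lx _; rewrite [X in _ + X]/= lx addr0 subrr addr0.
Qed.

End Gysin.

(** * Cohomology classes of degree one *)

Section Representatives.

Variables (gT : finGroupType) (R : comNzRingType).
Implicit Types (c d : cohomology gT R) (f g : cochain gT R).

Definition represents f c := exists2 z : cocycle gT R, c = cclass z & val z = f.

Lemma represents_ex c : exists f, represents f c.
Proof. by rewrite -[c]cclass_repr; do 2 eexists. Qed.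

Lemma represents_cocycle f c : represents f c -> coboundary f = 0.
Proof. by case=> z _ <-; apply: coboundary_cocycle. Qed.

Lemma represents_bounded f c : represents f c -> bounded f.
Proof. by case=> z _ <-; apply: bounded_cocycle. Qed.

Lemma cocycle_represents f : bounded f -> coboundary f = 0 ->
  exists c, represents f c.
Proof.
move=> bf df; have zf : is_cocycle f by apply/asboolP.
by exists (cclass (Cocycle zf)), (Cocycle zf).
Qed.

Lemma representsP f g c d : represents f c -> represents g d ->
  c = d <-> exists2 b, bounded b & f - g = coboundary b.
Proof.
case=> z -> <- [y -> <-]; split=> [/cclassP/asboolP[b bb E]|[b bb E]].
  by exists b; rewrite // -E raddfB.
by apply/cclassP/asboolP; exists b; rewrite // raddfB.
Qed.

Lemma represents0 : represents 0 0.
Proof. by exists 0; rewrite ?cclass0. Qed.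

Lemma represents_eq0 f c : represents f c ->
  c = 0 <-> exists2 b, bounded b & f = coboundary b.
Proof.
move=> fc; have := representsP fc represents0.
by rewrite subr0.
Qed.

Lemma representsD f g c d :
  represents f c -> represents g d -> represents (f + g) (c + d).
Proof. by case=> z -> <- [y -> <-]; exists (z + y); rewrite ?cclassD ?raddfD. Qed.

Lemma representsM f g c d :
  represents f c -> represents g d -> represents (f * g) (c * d).
Proof. by case=> z -> <- [y -> <-]; exists (z * y); rewrite ?cclassM ?rmorphM. Qed.

Lemma representsZ k f c : represents f c -> represents (k *: f) (k *: c).
Proof. by case=> z -> <-; exists (k *: z); rewrite ?cclassZ ?linearZ. Qed.

Lemma represents1 : represents 1 1.
Proof. by exists 1; rewrite ?cclass1 ?rmorph1. Qed.

End Representatives.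

Section Res.
Variables (gT : finGroupType) (R : comNzRingType) (H : {group gT}).

Lemma represents_res (f : cochain gT R) (c : cohomology gT R) :
  represents f c -> represents (res_cochain (H := H) f) (res H c).
Proof. by case=> z -> <-; exists (res_cocycle H z); rewrite ?resE. Qed.

Lemma res0 : res H (0 : cohomology gT R) = 0.
Proof. by apply: (addrI (res H 0)); rewrite -resD !addr0. Qed.

Lemma res1 : res H (1 : cohomology gT R) = 1.
Proof.
have := represents_res (represents1 gT R).
have -> : res_cochain (1 : cochain gT R) = 1 :> cochain (subg_of H) R.
  by apply: cochainP => -[].
by case=> z -> z1; rewrite -cclass1; congr cclass; apply/val_inj; rewrite z1 rmorph1.
Qed.

Lemma resZ k (c : cohomology gT R) : res H (k *: c) = k *: res H c.
Proof.
have [f fc] := represents_ex c.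
apply/(representsP (represents_res (representsZ k fc)) (representsZ k (represents_res fc))).
by exists 0; [apply: bounded0 | rewrite coboundary0; apply: subrr].
Qed.

Lemma resN (c : cohomology gT R) : res H (- c) = - res H c.
Proof. by rewrite -scaleN1r resZ scaleN1r. Qed.

Lemma resB (c d : cohomology gT R) : res H (c - d) = res H c - res H d.
Proof. by rewrite resD resN. Qed.

Lemma res_sum (I : finType) (F : I -> cohomology gT R) :
  res H (\sum_i F i) = \sum_i res H (F i).
Proof. exact: (big_morph _ (@resD _ _ _) res0). Qed.

End Res.

Section DegreeOne.

Variables (p : nat) (gT : finGroupType).
Hypothesis p_pr : prime p.
Implicit Types (c d : cohomology gT 'F_p) (lam mu : gT -> 'F_p).

Lemma has_degree1P c :
  has_degree 1 c <-> exists2 lam, is_hom lam & represents (homc lam) c.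
Proof.
split=> [[z z1 ->]|[lam lamM [z -> zE]]]; last first.
  by exists z => // -[|x [|y s]] // _; rewrite -[cocycle_val z]/(val z) zE.
exists (fun x => val z [:: x]); last first.
  by exists z => //; apply: cochainP => -[|x [|y s]] //=; apply: z1.
move=> x y; have := congr1 (fun f : cochain gT 'F_p => f [:: x; y]) (coboundary_cocycle z).
rewrite /= big_ord_recl big_ord0 /= cochain0E /merge_at /= => /eqP.
rewrite expr1 sqrrN expr1n mulN1r mul1r addr0 addrAC subr_eq0 addrC => /eqP <-.
by [].
Qed.

Lemma represents_homc_inj lam mu c :
  represents (homc lam) c -> represents (homc mu) c -> lam =1 mu.
Proof.
move=> lc mc x; have /(representsP lc mc)[b _ E] := erefl c.
have := congr1 (fun f : cochain gT 'F_p => f [:: x]) E.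
rewrite /= big_ord0 cochainBE expr1 mulN1r addr0 subrr => /eqP.
by rewrite subr_eq0 => /eqP.
Qed.

Lemma bockstein_homc lam : is_hom lam -> bockstein_cochain (homc lam) = carryc lam.
Proof.
move=> lamM; apply: (@indeg_eq _ _ 2).
- move=> w w2; rewrite /bockstein_cochain /red_cochain /div_cochain.
  rewrite (_ : coboundary _ w = 0) ?div0z // (@indeg_coboundary _ _ 1) // => v v1.
  by rewrite /lift_cochain indeg_homc.
- exact: indeg_carryc.
move=> [|x [|y [|z s]]] // _.
rewrite /bockstein_cochain /red_cochain /div_cochain /= big_ord_recl big_ord0 /=.
rewrite /lift_cochain /merge_at /= lamM /carry.
have /(congr1 Posz) := carry_natE (lam x) (lam y); rewrite !PoszD PoszM => E.
rewrite [X in (X %/ _)%Z](_ : _ = (carry_nat (lam x) (lam y))%:Z * #|'F_p|%:Z).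
  by rewrite mulzK // card_ord.
by move/eqP: E; rewrite -subr_eq => /eqP <-; ring.
Qed.

Lemma represents_bockstein lam c : is_hom lam ->
  represents (homc lam) c -> represents (carryc lam) (bockstein c).
Proof.
move=> lamM [z -> zE]; exists (bockstein_cocycle z); first exact: bocksteinE.
by rewrite /= -(bockstein_homc lamM) -zE.
Qed.

Lemma degree1_anticomm c d : has_degree 1 c -> has_degree 1 d -> c * d = - (d * c).
Proof.
move=> /has_degree1P[lam lamM lc] /has_degree1P[mu muM md].
apply/eqP; rewrite -addr_eq0; apply/eqP.
apply/(represents_eq0 (representsD (representsM lc md) (representsM md lc))).
eexists; last exact: homc_anticomm.
rewrite -scaleN1r; exact/boundedZ/below_bounded/indeg_below/indeg_homc.
Qed.

Lemma eq_opp_eq0 c : odd p -> c = - c -> c = 0.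
Proof.
move=> p_odd /eqP; rewrite -addr_eq0 -mulr2n -scaler_nat => /eqP c2.
have nz2 : (2%:R : 'F_p) != 0.
  by rewrite -(dvdn_pcharf (pchar_Fp p_pr)) gtnNdvd // odd_prime_gt2.
by rewrite -[LHS]scale1r -(mulVf nz2) -scalerA c2 scaler0.
Qed.

Lemma degree1_sqr c : odd p -> has_degree 1 c -> c * c = 0.
Proof. by move=> p_odd c1; apply: eq_opp_eq0 (degree1_anticomm c1 c1). Qed.

Lemma bockstein_degree1_comm c d : has_degree 1 c -> has_degree 1 d ->
  bockstein c * d = d * bockstein c.
Proof.
move=> /has_degree1P[lam lamM lc] /has_degree1P[mu muM md].
have lbc := represents_bockstein lamM lc.
apply/(representsP (representsM lbc md) (representsM md lbc)).
eexists; last exact: carryc_homc.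
exact/below_bounded/indeg_below/indeg_cochain2.
Qed.

Lemma bockstein_comm c d : has_degree 1 c -> has_degree 1 d ->
  bockstein c * bockstein d = bockstein d * bockstein c.
Proof.
move=> /has_degree1P[lam lamM lc] /has_degree1P[mu muM md].
have lbc := represents_bockstein lamM lc; have mbd := represents_bockstein muM md.
apply/(representsP (representsM lbc mbd) (representsM mbd lbc)).
eexists; last exact: carryc_comm.
exact/below_bounded/indeg_below/indeg_cochain3.
Qed.

Lemma has_degreeP m c : has_degree m c <-> exists2 f, indeg m f & represents f c.
Proof.
split=> [[z zm ->]|[f fm [z -> zf]]]; first by exists (val z); last by exists z.
by exists z => // w wm; rewrite -[cocycle_val z]/(val z) zf fm.
Qed.

Lemma has_degree0 m : has_degree m (0 : cohomology gT 'F_p).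
Proof. by apply/has_degreeP; exists 0; last exact: represents0. Qed.

Lemma has_degreeD m c d : has_degree m c -> has_degree m d -> has_degree m (c + d).
Proof.
move=> /has_degreeP[f fm fc] /has_degreeP[g gm gd]; apply/has_degreeP.
by exists (f + g); [apply: indegD | apply: representsD].
Qed.

Lemma has_degreeZ m k c : has_degree m c -> has_degree m (k *: c).
Proof.
move=> /has_degreeP[f fm fc]; apply/has_degreeP; exists (k *: f).
  by move=> w wm; rewrite cochainZE fm // mulr0.
exact: representsZ.
Qed.

Lemma bocksteinD c d : has_degree 1 c -> has_degree 1 d ->
  bockstein (c + d) = bockstein c + bockstein d.
Proof.
move=> /has_degree1P[lam lamM lc] /has_degree1P[mu muM md].
have hM : is_hom (fun x => lam x + mu x) by move=> x y; rewrite lamM muM addrACA.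
have hcd : represents (homc (fun x => lam x + mu x)) (c + d).
  have -> : homc (fun x => lam x + mu x) = homc lam + homc mu.
    by apply: cochainP => -[|x [|y s]]; rewrite cochainDE /= ?addr0.
  exact: representsD.
apply/(representsP (represents_bockstein hM hcd)
  (representsD (represents_bockstein lamM lc) (represents_bockstein muM md))).
(* The lift of a sum differs from the sum of the lifts by p times this carry. *)
exists (- homc (fun x => carry (lam x) (mu x))).
  rewrite -scaleN1r; exact/boundedZ/below_bounded/indeg_below/indeg_homc.
apply: (@indeg_eq _ _ 2).
- apply/indegB/indegD/indeg_carryc/indeg_carryc/indeg_carryc.
- exact/indeg_coboundary/indegN/indeg_homc.
move=> [|x [|y [|z s]]] // _; rewrite coboundaryN cochainBE cochainDE cochainNE.
rewrite /= big_ord_recl big_ord0 /= lamM muM.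
move: (lam x) (lam y) (mu x) (mu y) => i j k l.
rewrite (carryAl i k) (carryAl i j) (carryAr k j) (carryAr j k) (carryC k j).
by rewrite (addrC k j) (addrCA k j); ring.
Qed.

Lemma bockstein0 : bockstein (0 : cohomology gT 'F_p) = 0.
Proof.
have := bocksteinD (has_degree0 1) (has_degree0 1).
by rewrite addr0 => /esym/eqP; rewrite -subr_eq0 addrK => /eqP.
Qed.

Lemma bocksteinZ k c : has_degree 1 c -> bockstein (k *: c) = k *: bockstein c.
Proof.
move=> c1; rewrite -(natr_Zp k) !scaler_nat; elim: (k : nat) => [|m IHm].
  by rewrite !mulr0n bockstein0.
rewrite !mulrS bocksteinD ?IHm // -scaler_nat; exact: has_degreeZ.
Qed.

Lemma has_degree_sum (I : finType) m (F : I -> cohomology gT 'F_p) :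
  (forall i, has_degree m (F i)) -> has_degree m (\sum_i F i).
Proof.
move=> Fm; elim/big_ind: _ => //; [exact: has_degree0 | exact: has_degreeD].
Qed.

Lemma bockstein_sum n (k : 'I_n -> 'F_p) (F : 'I_n -> cohomology gT 'F_p) :
  (forall i, has_degree 1 (F i)) ->
  bockstein (\sum_i k i *: F i) = \sum_i k i *: bockstein (F i).
Proof.
move=> F1; suff [] : has_degree 1 (\sum_i k i *: F i) /\
    bockstein (\sum_i k i *: F i) = \sum_i k i *: bockstein (F i) by [].
apply: (big_rec2 (fun c d => has_degree 1 c /\ bockstein c = d)) => [|i d c _ [c1 <-]].
  by split; [apply: has_degree0 | apply: bockstein0].
have kF1 := has_degreeZ (k i) (F1 i).
by split; [apply: has_degreeD | rewrite bocksteinD // bocksteinZ].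
Qed.

End DegreeOne.

(* The commutativity and exponent conditions of an elementary abelian p-group *)
(* in a form that is inherited by subgroup types.                             *)
Definition elementary (p : nat) (gT : finGroupType) :=
  (forall x y : gT, commute x y) /\ (forall x : gT, (x ^+ p)%g = 1%g).

(** * Restriction to the kernel of a homomorphism *)

Section CohomologyGysin.

Variables (p : nat) (gT : finGroupType).
Hypotheses (p_pr : prime p) (gT_el : elementary p gT).
Variable lam : gT -> 'F_p.
Hypothesis lamM : is_hom lam.

Let lam1 : lam 1%g = 0.
Proof. by apply: (addrI (lam 1%g)); rewrite -lamM mulg1 addr0. Qed.

Let lamX x m : lam (x ^+ m)%g = lam x *+ m.
Proof. by elim: m => [|m IHm]; rewrite ?lam1 // expgS lamM IHm mulrS. Qed.

Lemma hom_ker_group_set : group_set [set x | lam x == 0].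
Proof.
apply/group_setP; split=> [|x y]; rewrite !inE ?lam1 // lamM.
by move=> /eqP-> /eqP->; rewrite addr0.
Qed.

Definition hom_ker : {group gT} := Group hom_ker_group_set.

Variable t : gT.
Hypothesis lam_t : lam t = 1.

Let tau (c : 'F_p) : gT := (t ^+ c)%g.
(** The projection onto the kernel of [lam] along the powers of [t]. *)
Let pi x : gT := (x * tau (- lam x))%g.

Let tauD c d : tau (c + d) = (tau c * tau d)%g.
Proof.
by rewrite /tau -expgD carry_natE expgD card_Fp // mulnC expgM gT_el.2 expg1n mul1g.
Qed.

Let lam_tau : cancel tau lam.
Proof. by move=> c; rewrite /tau lamX lam_t natr_Zp. Qed.

Let lam_pi x : lam (pi x) = 0.
Proof. by rewrite /pi lamM lam_tau subrr. Qed.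

Let piM : {morph pi : x y / (x * y)%g}.
Proof.
move=> x y; rewrite /pi lamM opprD tauD !mulgA; congr (_ * _)%g.
by rewrite -!mulgA; congr (_ * _)%g; apply: gT_el.1.
Qed.

Let tauM c x : (tau c * x = pi x * tau (c + lam x))%g.
Proof. by rewrite /pi -mulgA -tauD addrCA addNr addr0; apply: gT_el.1. Qed.

Let pi_ker x : pi x \in hom_ker.
Proof. by rewrite inE lam_pi. Qed.

Let W := hom_ker.
Let piW (x : gT) : subg_of W := subg W (pi x).

Let piWM : {morph piW : x y / (x * y)%g}.
Proof.
move=> x y; apply: val_inj; rewrite /= /piW piM.
by rewrite subgM.
Qed.

Let piW_sgval f : pullback piW (res_cochain (H := W) f) = pullback pi f :> cochain gT 'F_p.
Proof.
apply: cochainP => w; rewrite /pullback /res_cochain -map_comp; congr (f _).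
by apply: eq_map => x; rewrite /= /piW subgK.
Qed.

Variables (a : cohomology gT 'F_p).
Hypothesis lam_a : represents (homc lam) a.
Let x := bockstein a.
Let lam_x : represents (carryc lam) x := represents_bockstein lamM lam_a.

Definition cbelow m (c : cohomology gT 'F_p) := exists2 f, below m f & represents f c.

Lemma res_eq0 m e : cbelow m e -> res W e = 0 ->
  exists u v, [/\ cbelow m.-1 u, cbelow m.-2 v & e = a * u + x * v].
Proof.
move=> [y my ye] /(represents_eq0 (represents_res W ye))[b bb yb].
have myW : below m (res_cochain (H := W) y) by move=> w mw; apply: my; rewrite size_map.
(* The primitive on the kernel is truncated before it is pulled back, since [gysin_exact] asks for
   one of degree bound [m.-1]. *)
have ybW : pullback pi y = coboundary (pullback piW (cut m.-1 b)).
  rewrite coboundary_pullback // coboundary_cut -piW_sgval -yb cut_below //.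
  exact: below_leq (leqSpred m) myW.
have [w [v [c [[dw dv mw mv] bc yE]]]] := gysin_exact p_pr lamM lam_pi lam_tau piM tauM
  (represents_cocycle ye) my ybW (below_pullback piW (@below_cut _ _ _ _)).
have [u wu] := cocycle_represents (below_bounded mw) dw.
have [v' vv'] := cocycle_represents (below_bounded mv) dv.
exists u, v'; split; [by exists w | by exists v |].
apply/(representsP ye (representsD (representsM lam_a wu) (representsM lam_x vv'))).
by exists c => //; rewrite yE addrC addKr.
Qed.

Lemma res_class0 : res W a = 0.
Proof.
apply/(represents_eq0 (represents_res W lam_a)); exists 0; first exact: bounded0.
rewrite coboundary0; apply: cochainP => -[|z [|z' s]] //.
by rewrite /res_cochain /=; have := subgP z; rewrite inE => /eqP.
Qed.

Lemma res_bockstein0 : res W x = 0.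
Proof.
apply/(represents_eq0 (represents_res W lam_x)); exists 0; first exact: bounded0.
rewrite coboundary0; apply: cochainP => -[|z [|z' [|z'' s]]] //.
rewrite /res_cochain /=; have := subgP z; rewrite inE => /eqP ->.
have := subgP z'; rewrite inE => /eqP ->.
by rewrite /carry /carry_nat /= add0n div0n.
Qed.

Lemma bockstein_regular v : x * v = 0 -> v = 0.
Proof.
have [f fv] := represents_ex v.
move=> /(represents_eq0 (representsM lam_x fv))[b bb fb].
by apply/(represents_eq0 fv)/(gysin_regular p_pr lamM lam_pi lam_tau piM tauM
  (represents_cocycle fv) (represents_bounded fv) bb fb).
Qed.

Lemma res_coef0 v v' : a * v + x * v' = 0 -> res W v = 0.
Proof.
have [f fv] := represents_ex v; have [f' fv'] := represents_ex v'.
move=> /(represents_eq0 (representsD (representsM lam_a fv) (representsM lam_x fv'))).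
case=> b bb fb.
have [g bg fg] := gysin_res lamM lam_pi lam_tau piM tauM (represents_cocycle fv)
  (represents_cocycle fv') (represents_bounded fv) (represents_bounded fv') bb fb.
apply/(represents_eq0 (represents_res W fv)); exists (res_cochain g); first exact: res_bounded.
rewrite -res_coboundary; apply: cochainP => w; apply: fg.
by rewrite all_map; apply/allP => z _ /=; have := subgP z; rewrite inE.
Qed.

Lemma elementary_hom_ker : elementary p (subg_of W).
Proof.
split=> [y z|z]; apply/val_inj; first exact: gT_el.1.
by rewrite -[RHS](gT_el.2 (val z)); elim: p => // m IHm; rewrite !expgS /= IHm.
Qed.

Lemma extend_degree1 (c : cohomology (subg_of W) 'F_p) : has_degree 1 c ->
  exists2 d, has_degree 1 d & res W d = c.
Proof.
move=> /has_degree1P[mu muM mc].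
have hM : is_hom (mu \o piW) by move=> y z; rewrite /= piWM muM.
have [d hd] := cocycle_represents (below_bounded (indeg_below (@indeg_homc _ _ (mu \o piW))))
  (cobd_homc hM).
exists d; first by apply/has_degree1P; exists (mu \o piW).
apply/(representsP (represents_res W hd) mc); exists 0; first exact: bounded0.
rewrite coboundary0; apply: cochainP => -[|y [|z s]]; rewrite cochainBE ?subrr //.
apply/eqP; rewrite subr_eq0 /res_cochain /=; apply/eqP; congr mu.
apply: val_inj; rewrite /= /piW subgK // /pi.
by have := subgP y; rewrite inE => /eqP ->; rewrite oppr0 /tau expg0 mulg1.
Qed.

Lemma res_degree1_eq0 c : has_degree 1 c -> res W c = 0 -> exists k, c = k *: a.
Proof.
move=> /has_degree1P[mu muM mc] /(represents_eq0 (represents_res W mc))[b _ E].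
have mu0 z : lam z = 0 -> mu z = 0.
  move=> z0; have zW : z \in W by rewrite inE z0.
  have := congr1 (fun f : cochain (subg_of W) 'F_p => f [:: subg W z]) E.
  by rewrite /res_cochain /= subgK // big_ord0 expr1 mulN1r addr0 subrr.
have muX z m : mu (z ^+ m)%g = mu z *+ m.
  elim: m => [|m IHm]; last by rewrite expgS muM IHm mulrS.
  by apply: (addrI (mu 1%g)); rewrite -muM mulg1 addr0.
exists (mu t); apply/(representsP mc (representsZ (mu t) lam_a)).
exists 0; first exact: bounded0.
rewrite coboundary0; apply: cochainP => -[|z [|z' s]]; rewrite cochainBE cochainZE ?mulr0 ?subrr //.
have := mu0 _ (lam_pi z); rewrite muM muX -mulr_natr natr_Zp mulrN => /eqP.
by rewrite subr_eq0 => /eqP /= ->; rewrite subrr.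
Qed.

End CohomologyGysin.

(** * Anticommuting families *)

(** In row vectors, a coordinate modulo the row space of [H] that does not vanish at a vector
    outside [H]. *)
Lemma exists_hom (p : nat) (gT : finGroupType) (H : {group gT}) :
  prime p -> (p.-abelem [set: gT])%g -> H \proper [set: gT] ->
  exists lam : gT -> 'F_p,
    [/\ is_hom lam, forall x, x \in H -> lam x = 0 & exists t, lam t != 0].
Proof.
move=> p_pr abV /properP[_ [t _ tH]].
have ntV : [set: gT]%G != 1%G.
  by apply: contraNneq tH => V1; have : t \in [set: gT]%G by []; rewrite V1 => /set1P->.
pose E := abelem_rV abV ntV; pose A := rowg_mx (E @* H).
have EtA : E t *m cokermx A != 0.
  rewrite -submxE; apply: contra tH; rewrite -mem_rowg rowg_mxK.
  by case/morphimP=> z _ zH /abelem_rV_inj->.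
have [j Etj] : exists j, (E t *m cokermx A) 0 j != 0.
  apply/existsP; apply: contraNT EtA; rewrite negb_exists => /forallP E0.
  by apply/eqP/rowP => j; rewrite [RHS]mxE; apply/eqP/negPn/E0.
exists (fun x => (E x *m cokermx A) 0 j); split; last by exists t.
  by move=> x y; rewrite /E abelem_rV_M ?inE // mulmxDl mxE.
move=> x xH; suff /submxP[D ->] : (E x <= A)%MS by rewrite -mulmxA mulmx_coker mulmx0 mxE.
by rewrite -mem_rowg rowg_mxK mem_morphim ?inE.
Qed.

Section AnticommutingFamilies.

Variables (R : nzRingType) (I : eqType) (y : I -> R).
Hypothesis yC : forall i j, y i * y j = - (y j * y i).
Hypothesis y2 : forall i, y i * y i = 0.
Implicit Types s : seq I.

Lemma anti_prod_consC x s :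
  y x * \prod_(i <- s) y i = (-1) ^+ size s * (\prod_(i <- s) y i * y x).
Proof.
elim: s => [|z s IHs]; first by rewrite big_nil mulr1 !mul1r.
rewrite big_cons [LHS]mulrA yC mulNr -[y z * y x * _]mulrA IHs exprS mulN1r mulNr.
by congr (- _); rewrite mulrA commr_sign !mulrA.
Qed.

Lemma anti_prod_catC s1 s2 : exists b : bool,
  \prod_(i <- s1 ++ s2) y i = (-1) ^+ b * \prod_(i <- s2 ++ s1) y i.
Proof.
elim: s1 => [|x s1 [b IHs]]; first by exists false; rewrite cats0 mul1r.
exists (b (+) odd (size s2)); rewrite cat_cons big_cons IHs !big_cat big_cons /=.
rewrite signr_addb signr_odd [LHS]mulrA commr_sign -[LHS]mulrA -[RHS]mulrA.
by congr (_ * _); rewrite [LHS]mulrA anti_prod_consC -!mulrA.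
Qed.

Lemma anti_prod_perm s1 s2 : perm_eq s1 s2 -> exists b : bool,
  \prod_(i <- s1) y i = (-1) ^+ b * \prod_(i <- s2) y i.
Proof.
move=> s12; pose P s := exists b : bool,
  \prod_(i <- s1) y i = (-1) ^+ b * \prod_(i <- s) y i.
apply: (@catCA_perm_ind _ P _ _ _ s12); last by exists false; rewrite mul1r.
move=> t1 t2 t3 [b E]; have [c E'] := anti_prod_catC t1 t2.
exists (b (+) c); rewrite E catA big_cat /= E' catA [in RHS]big_cat /=.
by rewrite signr_addb !mulrA.
Qed.

Lemma anti_prod_dup s : ~~ uniq s -> \prod_(i <- s) y i = 0.
Proof.
elim: s => //= x s IHs; rewrite big_cons negb_and negbK => /orP[xs|/IHs->].
  have [b ->] := anti_prod_perm (perm_to_rem xs).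
  by rewrite big_cons mulrA commr_sign -mulrA (mulrA (y x)) y2 mul0r mulr0.
by rewrite mulr0.
Qed.

End AnticommutingFamilies.

Section ExteriorMonomials.

Variables (R : nzRingType) (n : nat) (y : 'I_n -> R).
Hypothesis yC : forall i j, y i * y j = - (y j * y i).
Hypothesis y2 : forall i, y i * y i = 0.

Definition ext_mon (T : {set 'I_n}) : R := \prod_(i in T) y i.

Let elts (T : {set 'I_n}) := [seq i <- index_enum 'I_n | i \in T].

Let mem_elts T i : (i \in elts T) = (i \in T).
Proof. by rewrite mem_filter mem_index_enum andbT. Qed.

Let uniq_elts T : uniq (elts T).
Proof. exact/filter_uniq/index_enum_uniq. Qed.

Let ext_monE T : ext_mon T = \prod_(i <- elts T) y i.
Proof. by rewrite big_filter. Qed.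

Lemma ext_monU (T U : {set 'I_n}) : [disjoint T & U] -> exists b : bool,
  ext_mon T * ext_mon U = (-1) ^+ b * ext_mon (T :|: U).
Proof.
move=> dTU; rewrite !ext_monE -big_cat; apply: anti_prod_perm => //.
apply: uniq_perm => // [|i]; last by rewrite mem_cat !mem_elts inE.
rewrite cat_uniq !uniq_elts /= andbT; apply/hasPn => i; rewrite /= !mem_elts.
by move=> iU; rewrite (disjointFl dTU).
Qed.

Lemma ext_mon_meet (T U : {set 'I_n}) : ~~ [disjoint T & U] ->
  ext_mon T * ext_mon U = 0.
Proof.
move=> dTU; rewrite !ext_monE -big_cat; apply: anti_prod_dup => //.
apply: contra dTU; rewrite cat_uniq => /and3P[_ /hasPn TU _].
rewrite disjoint_sym disjoints_subset; apply/subsetP => i iU; rewrite inE -mem_elts.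
by apply: TU; rewrite mem_elts.
Qed.

Lemma ext_mon1 i : ext_mon [set i] = y i.
Proof. by rewrite /ext_mon big_set1. Qed.


Lemma ext_mon0 : ext_mon set0 = 1.
Proof. by rewrite /ext_mon big_set0. Qed.

End ExteriorMonomials.

(** * Restriction to a hyperplane and generation *)

Lemma mpoly_alg_ind (n : nat) (R : nzRingType) (P : {mpoly R[n]} -> Prop) :
  (forall c, P c%:MP) -> (forall i, P 'X_i) ->
  (forall f g, P f -> P g -> P (f + g)) -> (forall f g, P f -> P g -> P (f * g)) ->
  forall f, P f.
Proof.
move=> PC PX PD PM f; rewrite (mpolyE f).
have P0 : P 0 by rewrite -(mpolyC0 n R).
have P1 : P 1 by rewrite -(mpolyC1 n R).
apply: (big_ind P) => // m _; rewrite -mul_mpolyC; apply: (PM) => //.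
rewrite mpolyXE_id; apply: (big_ind P) => // i _.
by elim: (m i) => [|k IHk]; rewrite ?exprS //; apply: PM.
Qed.

Definition mdvd (n : nat) (R : comNzRingType) (f g : {mpoly R[n]}) :=
  exists h, g = f * h.

(** Congruence modulo [f] respects sums and products, so it suffices to check the variables. It
    identifies kernels of substitutions with principal ideals. *)
Lemma mdvd_endo (n : nat) (R : comNzRingType) (f : {mpoly R[n]})
    (phi : {rmorphism {mpoly R[n]} -> {mpoly R[n]}}) :
  (forall c, phi c%:MP = c%:MP) -> (forall i, mdvd f ('X_i - phi 'X_i)) ->
  forall g, mdvd f (g - phi g).
Proof.
move=> phiC phiX; apply: mpoly_alg_ind => [c||g h [g' Eg] [h' Eh]|g h [g' Eg] [h' Eh]] //.
- by exists 0; rewrite phiC subrr mulr0.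
- by exists (g' + h'); rewrite rmorphD /= mulrDr -Eg -Eh; ring.
- exists (g' * h + phi g * h'); rewrite rmorphM /= mulrDr [f * (g' * _)]mulrA -Eg.
  by rewrite [f * (phi g * _)]mulrCA -Eh; ring.
Qed.

Section GysinSubgroup.

Variables (p : nat) (gT : finGroupType).
Implicit Types (a c e u v : cohomology gT 'F_p) (W : {group gT}).

(** What later sections retain of the cochain computations: [W] stands for the kernel of [a], and
    the last three clauses are exactness with degree bounds, regularity of the Bockstein, and
    control of relations. *)
Definition gysin_at a W :=
  [/\ W \proper [set: gT], res W a = 0, res W (bockstein a) = 0
   & [/\ forall m e, cbelow m e -> res W e = 0 ->
         exists u v, [/\ cbelow m.-1 u, cbelow m.-2 v & e = a * u + bockstein a * v],
       forall v, bockstein a * v = 0 -> v = 0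
     & forall v v', a * v + bockstein a * v' = 0 -> res W v = 0]].

Lemma exists_gysin a : prime p -> elementary p gT -> has_degree 1 a -> a != 0 ->
  exists W, [/\ gysin_at a W, elementary p (subg_of W),
    forall c : cohomology (subg_of W) 'F_p, has_degree 1 c ->
      exists2 d, has_degree 1 d & res W d = c
  & forall c, has_degree 1 c -> res W c = 0 -> exists k, c = k *: a].
Proof.
move=> p_pr gT_el /has_degree1P[lam lamM la] a_neq0.
have [t lt1] : exists t, lam t = 1.
  have [x lx|lam0] := pickP (fun x => lam x != 0); last first.
    case/eqP: a_neq0; apply/(represents_eq0 la); exists 0; first exact: bounded0.
    rewrite coboundary0; apply: cochainP => -[|x [|y s]] //.
    by have /negbFE/eqP := lam0 x.
  exists (x ^+ ((lam x)^-1%R : 'F_p))%g.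
  have -> m : lam (x ^+ m)%g = lam x *+ m.
    elim: m => [|m IHm]; last by rewrite expgS lamM IHm mulrS.
    by apply: (addrI (lam 1%g)); rewrite -lamM mulg1 addr0.
  by rewrite -mulr_natr natr_Zp mulfV.
exists (hom_ker lamM); split; last 3 first.
- exact: elementary_hom_ker.
- exact: extend_degree1 lt1.
- exact: res_degree1_eq0 lt1 _ la.
split; [|exact: res_class0|exact: res_bockstein0|split].
- apply/properP; split; first exact: subsetT.
  by exists t; rewrite ?inE // lt1 oner_eq0.
- exact: res_eq0 lt1 _ la.
- exact: bockstein_regular lt1 _ la.
- exact: res_coef0 lt1 _ la.
Qed.

Lemma bockstein_res a W : has_degree 1 a -> res W (bockstein a) = bockstein (res W a).
Proof.
move=> /has_degree1P[lam lamM la].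
have rM : is_hom (lam \o (sgval : subg_of W -> gT)) by move=> x y; apply: lamM.
have rl : represents (homc (lam \o sgval)) (res W a).
  rewrite (_ : homc _ = res_cochain (homc lam)); first exact: represents_res.
  by apply: cochainP => -[|x [|y s]].
apply/(representsP (represents_res W (represents_bockstein lamM la))
  (represents_bockstein rM rl)); exists 0; first exact: bounded0.
by rewrite coboundary0; apply: cochainP => -[|x [|y [|z s]]]; rewrite cochainBE subrr.
Qed.

Lemma has_degree_res m a W : has_degree m a -> has_degree m (res W a).
Proof.
move=> /has_degreeP[f fm fa]; apply/has_degreeP; exists (res_cochain f).
  by move=> w; rewrite -(size_map sgval) => /fm.
exact: represents_res.
Qed.

Lemma cbelow_res m e W : cbelow m e -> cbelow m (res W e).
Proof.
case=> f fm fe; exists (res_cochain f); last exact: represents_res.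
by move=> w mw; apply: fm; rewrite size_map.
Qed.

Lemma cbelow_ex e : exists m, cbelow m e.
Proof.
have [f fe] := represents_ex e.
by have /bounded_below[m fm] := represents_bounded fe; exists m, f.
Qed.

Lemma cbelow0 e : cbelow 0 e -> e = 0.
Proof.
case=> f /below0 -> fe; apply/(represents_eq0 fe).
by exists 0; [apply: bounded0 | rewrite coboundary0].
Qed.

End GysinSubgroup.

Section Basis.

Variables (p n : nat) (gT : finGroupType) (a : 'I_n -> cohomology gT 'F_p).

(** Membership in the subalgebra generated by the [a_i] and [x_i], with a degree bound so that an
    induction on the degree closes. It also serves as an induction principle for all classes. *)
Inductive gen_below : nat -> cohomology gT 'F_p -> Prop :=
| GenBelow0 m : gen_below m 0
| GenBelowC m (k : 'F_p) : gen_below m.+1 k%:A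
| GenBelowD m c d : gen_below m c -> gen_below m d -> gen_below m (c + d)
| GenBelowA m i c : gen_below m c -> gen_below m.+1 (a i * c)
| GenBelowX m i c : gen_below m c -> gen_below m.+2 (poly_gen a i * c).

Hypotheses (p_pr : prime p) (a1 : forall i, has_degree 1 (a i)).

Lemma gen_below_cbelow m c : gen_below m c -> cbelow m c.
Proof.
elim=> {m c} [m|m k|m c d _ [f fm fc] _ [g gm gd]|m i c _ [f fm fc]|m i c _ [f fm fc]].
- by exists 0; last exact: represents0.
- exists k%:A; last exact/representsZ/represents1.
  by apply: belowZ => -[].
- by exists (f + g); [apply: belowD | apply: representsD].
- have /has_degree1P[lam lamM la] := a1 i; exists (homc lam * f).
    by apply: (@belowM _ _ 1 m) => //; apply/indeg_below/indeg_homc.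
  exact: representsM.
- have /has_degree1P[lam lamM la] := a1 i; exists (carryc lam * f).
    by apply: (@belowM _ _ 2 m) => //; apply/indeg_below/indeg_carryc.
  by apply: representsM => //; apply: represents_bockstein.
Qed.

End Basis.

Lemma H1_basis_res (p n : nat) (gT : finGroupType)
    (a : 'I_n.+1 -> cohomology gT 'F_p) (W : {group gT}) :
  H1_basis a ->
  res W (a ord0) = 0 ->
  (forall c : cohomology (subg_of W) 'F_p, has_degree 1 c ->
     exists2 d, has_degree 1 d & res W d = c) ->
  (forall c, has_degree 1 c -> res W c = 0 -> exists k, c = k *: a ord0) ->
  H1_basis (fun i => res W (a (lift ord0 i))).
Proof.
move=> [a1 aB] ra0 ext inj; split=> [i|c c1]; first exact: has_degree_res.
have [d d1 <-] := ext _ c1.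
have [k [dE _]] := aB _ d1.
exists (\row_i k 0 (lift ord0 i)); split.
  rewrite dE big_ord_recl resD resZ ra0 scaler0 add0r res_sum.
  by apply: eq_bigr => i _; rewrite resZ mxE.
(* Two expansions on [W] differ by a combination without [a_0] term that vanishes on [W]. It is a
   multiple of [a_0], so uniqueness of coordinates on the whole group makes it zero. *)
move=> k' dE'; pose l : 'rV['F_p]_n.+1 := \row_i
  oapp (fun j => k 0 (lift ord0 j) - k' 0 j) 0 (unlift ord0 i).
have l0 i : l 0 (lift ord0 i) = k 0 (lift ord0 i) - k' 0 i by rewrite mxE liftK.
pose e := \sum_i l 0 i *: a i.
have e1 : has_degree 1 e by apply: has_degree_sum => i; apply: has_degreeZ.
have [] := inj e e1.
  rewrite /e big_ord_recl resD resZ ra0 scaler0 add0r res_sum.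
  under eq_bigr do rewrite resZ l0 scalerBl.
  rewrite sumrB -dE' dE big_ord_recl resD resZ ra0 scaler0 add0r res_sum.
  by apply/eqP; rewrite subr_eq0; apply/eqP/eq_bigr => i _; rewrite resZ.
move=> m eE; have [r [_ r_uniq]] := aB _ e1.
have lr := r_uniq l (erefl _).
have mr : r = \row_i (if i == ord0 then m else 0).
  apply: r_uniq; rewrite eE big_ord_recl mxE /= big1 ?addr0 // => // i _.
  by rewrite mxE /= scale0r.
apply/rowP => i; rewrite mxE; apply/eqP; rewrite -subr_eq0 -l0 -lr mr mxE.
by [].
Qed.

Lemma H1_basis_neq0 (p n : nat) (gT : finGroupType)
    (a : 'I_n -> cohomology gT 'F_p) (k : 'rV_n) :
  H1_basis a -> k != 0 -> \sum_i k 0 i *: a i != 0.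
Proof.
move=> [a1 aB]; apply: contra_neq => k0.
have [r [_ r_uniq]] := aB _ (has_degree0 p gT 1).
rewrite -(r_uniq k) // -(r_uniq 0) // big1 // => // i _.
by rewrite mxE scale0r.
Qed.

Lemma H1_basis_gen_neq0 (p n : nat) (gT : finGroupType)
    (a : 'I_n -> cohomology gT 'F_p) (j : 'I_n) : H1_basis a -> a j != 0.
Proof.
move=> /(@H1_basis_neq0 _ _ _ _ (\row_i (i == j)%:R)).
rewrite (bigD1 j) //= mxE eqxx scale1r big1 ?addr0 => [|i /negPf ij].
  by apply; apply/eqP => /rowP/(_ j)/eqP; rewrite !mxE eqxx oner_eq0.
by rewrite mxE ij scale0r.
Qed.

(** Prefixing the identity letter contracts the bar complex. *)
Lemma trivial_cohomology (R : comNzRingType) (gT : finGroupType)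
    (f : cochain gT R) :
  (forall x : gT, x = 1%g) -> coboundary f = 0 ->
  f = (f [::])%:A + coboundary (lshiftc 1%g f).
Proof.
move=> gT1 df; apply: cochainP => w; rewrite cochainDE cochainZE.
have : coboundary f (1%g :: w) = 0 by rewrite df.
have d_cons (g : cochain gT R) v : coboundary g v = face0 g v + cobd1 g v.
  by rewrite /cobd1 cochainBE addrC subrK.
rewrite d_cons cobd1_cons [coboundary _ w]d_cons.
case: w => [|x s]; first by rewrite cobd1_nil /= mulr1 !addr0.
have -> : lmerge 1%g f (x :: s) = f (x :: s) by rewrite /= mul1g.
rewrite [(1 : cochain gT R) (x :: s)]/(0 : R) mulr0 add0r [face0 (lshiftc _ _) _]/= [face0 f _]/=.
rewrite addrA subrr add0r => /eqP; rewrite oppr_eq0 => /eqP ->.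
by rewrite addr0 /lshiftc (gT1 x).
Qed.

(** Induction on the rank, then on the degree. The restriction to [W] is generated in lower rank;
    subtracting a lift of its expression leaves a class that is zero on [W], hence of the form
    [a_0 u + x_0 v] with [u] and [v] of smaller degree. *)
Lemma cbelow_gen (p n : nat) (gT : finGroupType)
    (a : 'I_n -> cohomology gT 'F_p) :
  prime p -> elementary p gT -> H1_basis a ->
  forall m e, cbelow m e -> gen_below a m e.
Proof.
move=> p_pr; elim: n gT a => [|n IHn] gT a gT_el aB m e me.
  (* An empty basis in degree one leaves no nonzero homomorphism, so the group is trivial. *)
  have gT1 x : x = 1%g :> gT.
    have abT : (p.-abelem [set: gT])%g.
      apply/abelemP => //; split=> [|y _]; last exact: gT_el.2.
      by apply/centsP => y _ z _; apply: gT_el.1.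
    apply/eqP; rewrite -in_set1; apply: contraT => x1.
    have [|lam [lamM _ [t lt0]]] := exists_hom p_pr abT (H := 1%G).
      by apply/properP; split; [apply: subsetT | exists x].
    have [c lc] := cocycle_represents (below_bounded (indeg_below (indeg_homc lam)))
      (cobd_homc lamM).
    have c1 : has_degree 1 c by apply/has_degree1P; exists lam.
    have [k [cE _]] := aB.2 _ c1; rewrite big_ord0 in cE.
    have lc0 : represents (homc (fun _ => 0 : 'F_p)) c.
      rewrite cE (_ : homc _ = 0); first exact: represents0.
      by apply: cochainP => -[|y [|z s]].
    by rewrite (represents_homc_inj lc lc0 t) eqxx in lt0.
  case: m me => [|m] [f fm fe]; last first.
    rewrite (_ : e = (f [::])%:A); first exact: GenBelowC.
    apply/(representsP fe (representsZ _ (represents1 _ _))).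
    exists (lshiftc 1%g f).
      by apply: (@below_bounded _ _ m.+1) => w mw; apply: fm; apply: leqW.
    by rewrite {1}(trivial_cohomology gT1 (represents_cocycle fe)) addrC addKr.
  by rewrite (cbelow0 (ex_intro2 _ _ f fm fe)); apply: GenBelow0.
have a1 := aB.1; have a00 := H1_basis_gen_neq0 ord0 aB.
have [W [[_ ra rx [exa _ _]] W_el ext inj]] := exists_gysin p_pr gT_el (a1 ord0) a00.
have {}IHn := IHn _ _ W_el (H1_basis_res aB ra ext inj).
have lift_gen k c : gen_below (fun i => res W (a (lift ord0 i))) k c ->
    exists2 d, gen_below a k d & res W d = c.
  elim=> {k c} [k|k r|k c c' _ [d gd <-] _ [d' gd' <-]|k i c _ [d gd <-]|k i c _ [d gd <-]].
  - by exists 0; [apply: GenBelow0 | apply: res0].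
  - by exists r%:A; [apply: GenBelowC | rewrite resZ res1].
  - by exists (d + d'); [apply: GenBelowD | apply: resD].
  - by exists (a (lift ord0 i) * d); [apply: GenBelowA | rewrite resM].
  - exists (poly_gen a (lift ord0 i) * d); first exact: GenBelowX.
    by rewrite resM bockstein_res.
have [k] := ubnP m; elim: k m e me => // k IHk m e me ltmk.
have [b gb rb] := lift_gen _ _ (IHn _ _ (cbelow_res W me)).
have [f fm fe] := me; have [g gm gb'] := gen_below_cbelow a1 gb.
have eb : cbelow m (e - b).
  exists (f - g); first exact: belowB.
  by rewrite -!scaleN1r; apply: representsD => //; apply: representsZ.
have [|u [v [mu mv ebE]]] := exa m _ eb; first by rewrite resB rb subrr.
rewrite -(subrK b e) ebE; apply: GenBelowD => //.
case: m {eb gm gb' gb fm} ltmk me mu mv => [|m] ltmk me mu mv.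
  by rewrite (cbelow0 mu) (cbelow0 mv) !mulr0 addr0; apply: GenBelow0.
apply: GenBelowD; first by apply: GenBelowA; apply: IHk mu _.
case: m ltmk me mu mv => [|m] ltmk me mu mv.
  by rewrite (cbelow0 mv) mulr0; apply: GenBelow0.
by apply: GenBelowX; apply: IHk mv _; apply: ltnW.
Qed.

(** * The action of the polynomial subring *)

Section PolynomialAction.

Variables (p n : nat) (gT : finGroupType) (a : 'I_n -> cohomology gT 'F_p).
Hypotheses (p_pr : prime p) (p_odd : odd p) (gT_el : elementary p gT).
Hypothesis aB : H1_basis a.

Local Notation P := {mpoly 'F_p[n]}.
Local Notation ev := (poly_eval a).
Implicit Types (f g : P) (c e : cohomology gT 'F_p).

Let a1 i : has_degree 1 (a i). Proof. exact: aB.1. Qed.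

Lemma gen_below_ex c : exists m, gen_below a m c.
Proof. by have [m mc] := cbelow_ex c; exists m; apply: cbelow_gen mc. Qed.

(** Checked on generators, where explicit homotopies are available. It makes [poly_eval]
    multiplicative although [H] is not commutative. *)
Lemma bockstein_central c e : has_degree 1 c -> bockstein c * e = e * bockstein c.
Proof.
move=> c1; have [m ge] := gen_below_ex e.
elim: ge => {m e} [m|m k|m c' d _ IHc _ IHd|m i d _ IHd|m i d _ IHd].
- by rewrite mul0r mulr0.
- by rewrite -scalerAr -scalerAl mulr1 mul1r.
- by rewrite mulrDl mulrDr IHc IHd.
- by rewrite mulrA (bockstein_degree1_comm c1 (a1 i)) -mulrA IHd mulrA.
- by rewrite mulrA (bockstein_comm c1 (a1 i)) -mulrA IHd mulrA.
Qed.

(** [e'] is [e] with signs. Only its existence is used, to move a class across a product next to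
    another copy of itself. *)
Lemma degree1_twist c e : has_degree 1 c -> exists e', c * e = e' * c.
Proof.
move=> c1; have [m ge] := gen_below_ex e.
elim: ge => {m e} [m|m k|m c' d _ [e1 IHc] _ [e2 IHd]|m i d _ [e1 IHd]|m i d _ [e1 IHd]].
- by exists 0; rewrite mul0r mulr0.
- by exists k%:A; rewrite -scalerAr -scalerAl mulr1 mul1r.
- by exists (e1 + e2); rewrite mulrDl mulrDr IHc IHd.
- exists (- (a i * e1)).
  by rewrite mulrA (degree1_anticomm c1 (a1 i)) mulNr -mulrA IHd mulrA mulNr.
- by exists (poly_gen a i * e1); rewrite mulrA -bockstein_central // -mulrA IHd mulrA.
Qed.

Lemma poly_evalD : {morph ev : f g / f + g}.
Proof. exact: mmapD. Qed.

Lemma poly_eval0 : ev 0 = 0. Proof. exact: mmap0. Qed.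

Lemma poly_evalN : {morph ev : f / - f}. Proof. exact: mmapN. Qed.

Lemma poly_evalB : {morph ev : f g / f - g}. Proof. exact: mmapB. Qed.

Lemma poly_eval_sum (I : Type) (r : seq I) (Q : pred I) (F : I -> P) :
  ev (\sum_(i <- r | Q i) F i) = \sum_(i <- r | Q i) ev (F i).
Proof. exact: (big_morph ev poly_evalD poly_eval0). Qed.

Lemma poly_evalC (k : 'F_p) : ev k%:MP = k%:A. Proof. exact: mmapC. Qed.

Lemma poly_evalX i : ev 'X_i = poly_gen a i.
Proof. by rewrite /poly_eval mmapX mmap1U. Qed.

Let ev_mult : multiplicative ev.
Proof.
apply: commr_mmap_is_multiplicative => [i x|f m m'].
  by rewrite /GRing.comm /poly_gen bockstein_central.
by rewrite /GRing.comm /= mulr_algr mulr_algl.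
Qed.

Lemma poly_evalM : {morph ev : f g / f * g}. Proof. exact: ev_mult.1. Qed.
Lemma poly_eval1 : ev 1 = 1. Proof. exact: ev_mult.2. Qed.

Lemma poly_eval_prod (I : Type) (r : seq I) (Q : pred I) (F : I -> P) :
  ev (\prod_(i <- r | Q i) F i) = \prod_(i <- r | Q i) ev (F i).
Proof. exact: (big_morph ev poly_evalM poly_eval1). Qed.

Lemma poly_evalXn f m : ev (f ^+ m) = ev f ^+ m.
Proof. by elim: m => [|m IHm]; rewrite ?poly_eval1 // !exprS poly_evalM IHm. Qed.

Lemma poly_eval_central f c : ev f * c = c * ev f.
Proof.
move: f; apply: mpoly_alg_ind => [k|i|f g fC gC|f g fC gC].
- by rewrite poly_evalC mulr_algl mulr_algr.
- by rewrite poly_evalX /poly_gen bockstein_central.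
- by rewrite poly_evalD mulrDl mulrDr fC gC.
- by rewrite poly_evalM -mulrA gC mulrA fC mulrA.
Qed.

Definition in_span (I : finType) (m : I -> cohomology gT 'F_p) c :=
  exists k : {ffun I -> P}, c = \sum_i ev (k i) * m i.

Section Span.
Variables (I : finType) (m : I -> cohomology gT 'F_p).

Lemma in_span_gen i : in_span m (m i).
Proof.
exists [ffun j => (j == i)%:R]; rewrite (bigD1 i) //= ffunE eqxx poly_eval1 mul1r.
rewrite big1 ?addr0 // => j /negPf ji.
by rewrite ffunE ji poly_eval0 mul0r.
Qed.

Lemma in_span0 : in_span m 0.
Proof.
by exists [ffun=> 0]; rewrite big1 // => i _; rewrite ffunE poly_eval0 mul0r.
Qed.

Lemma in_spanD c d : in_span m c -> in_span m d -> in_span m (c + d).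
Proof.
move=> [k ->] [l ->]; exists [ffun i => k i + l i]; rewrite -big_split.
by apply: eq_bigr => i _; rewrite ffunE poly_evalD mulrDl.
Qed.

Lemma in_spanM f c : in_span m c -> in_span m (ev f * c).
Proof.
move=> [k ->]; exists [ffun i => f * k i]; rewrite mulr_sumr.
by apply: eq_bigr => i _; rewrite ffunE poly_evalM mulrA.
Qed.

Lemma in_span_sign b c : in_span m c -> in_span m ((-1) ^+ b * c).
Proof.
move=> mc; suff -> : (-1) ^+ b = ev ((-1) ^+ b) by apply: in_spanM.
by rewrite poly_evalXn poly_evalN poly_eval1.
Qed.

Lemma in_span_sum (J : finType) (F : J -> cohomology gT 'F_p) :
  (forall j, in_span m (F j)) -> in_span m (\sum_j F j).
Proof. by move=> mF; apply: (big_ind (in_span m)); [apply: in_span0|apply: in_spanD|]. Qed.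

(** Used with [f = 1] for the exterior monomials and with the Moore determinant for the Mui
    invariants. *)
Lemma in_span_stable f :
  in_span m (ev f) -> (forall i j, in_span m (a i * m j)) ->
  forall c, in_span m (ev f * c).
Proof.
move=> mf ma c; have [d gc] := gen_below_ex c.
elim: gc => {d c} [d|d k|d c c' _ IHc _ IHc'|d i c _ [k IHc]|d i c _ IHc].
- by rewrite mulr0; apply: in_span0.
- by rewrite mulr_algr -mulr_algl -poly_evalC; apply: in_spanM.
- by rewrite mulrDr; apply: in_spanD.
- rewrite mulrA poly_eval_central -mulrA IHc mulr_sumr; apply: in_span_sum => j.
  by rewrite mulrA -poly_eval_central -mulrA; apply: in_spanM.
- by rewrite mulrA poly_eval_central -mulrA -poly_evalX; apply: in_spanM.
Qed.

End Span.

Let aC i j : a i * a j = - (a j * a i). Proof. exact: degree1_anticomm. Qed.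
Let a2 i : a i * a i = 0. Proof. exact: degree1_sqr. Qed.

Lemma ext_mon_span c : in_span (ext_mon a) c.
Proof.
rewrite -[c]mul1r -poly_eval1; apply: in_span_stable => [|i T].
  by rewrite poly_eval1 -(ext_mon0 a); apply: in_span_gen.
rewrite -ext_mon1; have [dT|/(ext_mon_meet aC a2) ->] := boolP [disjoint [set i] & T].
  by have [b ->] := ext_monU aC dT; apply/in_span_sign/in_span_gen.
exact: in_span0.
Qed.

End PolynomialAction.

(** * Independence of the exterior monomials *)

Section Recursion.

Variables (R : nzRingType) (n : nat).

Let up (T : {set 'I_n}) := [set lift ord0 i | i in T].

Lemma sum_set_ordS (V : nmodType) (F : {set 'I_n.+1} -> V) :
  \sum_T F T = \sum_(T : {set 'I_n}) (F [set lift ord0 i | i in T]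
    + F (ord0 |: [set lift ord0 i | i in T])).
Proof.
pose down (T : {set 'I_n.+1}) := [set i | lift ord0 i \in T].
have upK : cancel up down.
  move=> T; apply/setP => i; rewrite inE mem_imset //; exact: lift_inj.
have ord0_up T : ord0 \notin up T.
  by apply/imsetP => -[i _ /eqP]; rewrite (negPf (neq_lift _ _)).
have downK (T : {set _}) : ord0 \notin T -> up (down T) = T.
  move=> T0; apply/setP => i; have [j ->|->] := unliftP ord0 i.
    by rewrite mem_imset ?inE //; apply: lift_inj.
  by rewrite (negPf T0) (negPf (ord0_up _)).
rewrite big_split (bigID (fun T : {set 'I_n.+1} => ord0 \notin T)) /=; congr (_ + _).
  rewrite (reindex_onto up down) => [|T]; last exact: downK.
  by apply: eq_bigl => T; rewrite ord0_up upK eqxx.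
rewrite (reindex_onto (fun T => ord0 |: up T) (fun T => down (T :\ ord0))) => [|T].
  apply: eq_bigl => T; rewrite setU11 setU1K ?upK ?eqxx //; exact: ord0_up.
by rewrite negbK => T0; rewrite downK ?setD1K // !inE eqxx.
Qed.

Lemma set_ordSP (T : {set 'I_n.+1}) : exists U : {set 'I_n},
  T = [set lift ord0 i | i in U] \/ T = ord0 |: [set lift ord0 i | i in U].
Proof.
pose U := [set i | lift ord0 i \in T]; exists U.
have TU i : (lift ord0 i \in [set lift ord0 i | i in U]) = (lift ord0 i \in T).
  by rewrite mem_imset ?inE //; apply: lift_inj.
have U0 : (ord0 \in [set lift ord0 i | i in U]) = false.
  by apply/imsetP => -[i _ /eqP]; rewrite (negPf (neq_lift _ _)).
case T0: (ord0 \in T); [right|left]; apply/setP => i; rewrite ?in_setU1;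
  by case: (unliftP ord0 i) => [j|] ->; rewrite ?TU ?U0 ?T0 ?eqxx // eq_sym (negPf (neq_lift _ _)).
Qed.

Lemma ext_mon_up (y : 'I_n.+1 -> R) (T : {set 'I_n}) :
  ext_mon y [set lift ord0 i | i in T] = ext_mon (y \o lift ord0) T.
Proof.
rewrite /ext_mon [LHS]big_mkcond big_ord_recl ifF ?mul1r /=; last first.
  by apply/imsetP => -[i _ /eqP]; rewrite (negPf (neq_lift _ _)).
rewrite [RHS]big_mkcond. rewrite mul1r; apply: eq_bigr => i _ /=.
by rewrite mem_imset //; apply: lift_inj.
Qed.

Lemma ext_mon_up0 (y : 'I_n.+1 -> R) (T : {set 'I_n}) :
  ext_mon y (ord0 |: [set lift ord0 i | i in T]) =
  y ord0 * ext_mon (y \o lift ord0) T.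
Proof.
rewrite /ext_mon [LHS]big_mkcond big_ord_recl setU11; congr (_ * _).
rewrite [RHS]big_mkcond; apply: eq_bigr => i _ /=.
by rewrite in_setU1 eq_sym (negPf (neq_lift _ _)) mem_imset //; apply: lift_inj.
Qed.

End Recursion.

(** The effect of restriction to [W] on polynomial coefficients. *)
Definition mpoly_res0 (F : fieldType) n : {rmorphism {mpoly F[n.+1]} -> {mpoly F[n]}} :=
  mmap (@mpolyC n F) (fun i => if unlift ord0 i is Some j then 'X_j else 0).

Lemma mpoly_res0_eq0 (F : fieldType) n (f : {mpoly F[n.+1]}) :
  mpoly_res0 F n f = 0 -> mdvd 'X_ord0 f.
Proof.
pose h i : {mpoly F[n.+1]} := 'X_(lift ord0 i).
pose phi : {rmorphism {mpoly F[n.+1]} -> {mpoly F[n.+1]}} :=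
  mmap (@mpolyC n.+1 F) h \o mpoly_res0 F n.
move=> f0; have -> : f = f - phi f by rewrite /phi /= f0 rmorph0 subr0.
apply: mdvd_endo => [c|i]; rewrite /phi /=.
  by rewrite /mpoly_res0 /= !mmapC.
rewrite /mpoly_res0 /= mmapX mmap1U; case: unliftP => [j|] ->.
  by exists 0; rewrite mmapX mmap1U subrr mulr0.
by exists 1; rewrite rmorph0 subr0 mulr1.
Qed.

(** Induction on the rank and descent on the degree: [X_0] divides all coefficients of a relation,
    and the quotients again form a relation because [x_0] is regular. *)
Lemma ext_mon_indep (p n : nat) (gT : finGroupType)
    (a : 'I_n -> cohomology gT 'F_p) (k : {set 'I_n} -> {mpoly 'F_p[n]}) :
  prime p -> elementary p gT -> H1_basis a ->
  \sum_T poly_eval a (k T) * ext_mon a T = 0 -> forall T, k T = 0.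
Proof.
move=> p_pr; elim: n gT a k => [|n IHn] gT a k gT_el aB.
  have set_ord0 (T : {set 'I_0}) : T = set0 by apply/setP => -[].
  rewrite (bigD1 set0) //= big1 ?addr0 => [E T|T]; last by rewrite (set_ord0 T) eqxx.
  rewrite ext_mon0 mulr1 in E.
  rewrite (set_ord0 T).
  have kC : k set0 = ((k set0)@_0)%:MP.
    apply/mpolyP => m; have -> : m = 0%MM by apply/mnmP => -[].
    by rewrite mcoeffC eqxx mulr1.
  move: E; rewrite kC poly_evalC => /eqP; rewrite scaler_eq0 oner_eq0 orbF.
  by move=> /eqP ->; rewrite mpolyC0.
have a1 := aB.1; have a00 := H1_basis_gen_neq0 ord0 aB.
have [W [[_ ra rx [_ reg coef0]] W_el ext inj]] := exists_gysin p_pr gT_el (a1 ord0) a00.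
have WB := H1_basis_res aB ra ext inj; pose b i := res W (a (lift ord0 i)).
have {}IHn k' := IHn _ b k' W_el WB.
have res_ev f : res W (poly_eval a f) = poly_eval b (mpoly_res0 _ _ f).
  move: f; apply: mpoly_alg_ind => [c|i|f g fE gE|f g fE gE].
  - by rewrite /mpoly_res0 /= mmapC !poly_evalC resZ res1.
  - rewrite poly_evalX /mpoly_res0 /= mmapX mmap1U; case: unliftP => [j|] ->.
      by rewrite poly_evalX /poly_gen bockstein_res.
    by rewrite poly_eval0 rx.
  - by rewrite rmorphD !poly_evalD resD fE gE.
  - by rewrite rmorphM !poly_evalM // resM fE gE.
have res_mon T : res W (ext_mon (a \o lift ord0) T) = ext_mon b T.
  by apply: (big_morph _ (@resM _ _ W) (res1 _ _)).
have dvd (k' : {set 'I_n} -> {mpoly 'F_p[n.+1]}) :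
    res W (\sum_T poly_eval a (k' T) * ext_mon (a \o lift ord0) T) = 0 ->
    forall T, mdvd 'X_ord0 (k' T).
  rewrite res_sum => E T; apply/mpoly_res0_eq0; move: T; apply: IHn.
  by rewrite -[RHS]E; apply: eq_bigr => T _; rewrite resM res_ev res_mon.
have step k' : \sum_T poly_eval a (k' T) * ext_mon a T = 0 ->
    exists2 l, \sum_T poly_eval a (l T) * ext_mon a T = 0 &
      forall T, k' T = 'X_ord0 * l T.
  move=> E; have E' := E; rewrite sum_set_ordS big_split /= in E'.
  pose S0 := \sum_(T : {set 'I_n}) poly_eval a (k' [set lift ord0 i | i in T]) * ext_mon (a \o lift ord0) T.
  pose S1 := \sum_(T : {set 'I_n}) poly_eval a (k' (ord0 |: [set lift ord0 i | i in T]))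
    * ext_mon (a \o lift ord0) T.
  have {E'}E' : S0 + a ord0 * S1 = 0.
    rewrite -[RHS]E'; congr (_ + _); first by apply: eq_bigr => T _; rewrite ext_mon_up.
    rewrite mulr_sumr; apply: eq_bigr => T _.
    by rewrite ext_mon_up0 !mulrA poly_eval_central.
  (* On [W] the class [a_0] vanishes, so [S0] restricts to zero and independence in lower rank
     applies to its coefficients. *)
  have /fin_all_exists[l0 l0E] : forall T : {set 'I_n}, mdvd 'X_ord0 (k' [set lift ord0 i | i in T]).
    by apply: dvd; have := congr1 (res W) E'; rewrite resD resM ra mul0r addr0 res0.
  pose Q := \sum_T poly_eval a (l0 T) * ext_mon (a \o lift ord0) T.
  have S0E : S0 = bockstein (a ord0) * Q.
    rewrite mulr_sumr; apply: eq_bigr => T _.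
    by rewrite l0E poly_evalM // poly_evalX mulrA.
  (* Now the relation reads [a_0 S1 + x_0 Q = 0], which forces [S1] to vanish on [W] too. *)
  have l1E : forall T : {set 'I_n}, mdvd 'X_ord0 (k' (ord0 |: [set lift ord0 i | i in T])).
    by apply: dvd; apply: (coef0 S1 Q); rewrite -S0E addrC.
  have /fin_all_exists[l lE] : forall T, mdvd 'X_ord0 (k' T).
    by move=> T; have [U [->|->]] := set_ordSP T; [exists (l0 U) | apply: l1E].
  exists l => //; apply: reg; rewrite -[RHS]E mulr_sumr; apply: eq_bigr => T _.
  by rewrite lE poly_evalM // poly_evalX mulrA.
suff main d : forall k, \sum_T poly_eval a (k T) * ext_mon a T = 0 ->
    (forall T, msize (k T) <= d)%N -> forall T, k T = 0.
  move=> E; apply: (main (\max_T msize (k T))%N) => // T.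
  exact: leq_bigmax.
elim: d => [|d IHd] k' E kd T.
  by apply/eqP; rewrite -msize_poly_eq0 -leqn0.
have [l lE kl] := step _ E.
rewrite kl (IHd l) ?mulr0 // => U; have [->|l0] := eqVneq (l U) 0; first by rewrite msize0.
have := kd U; rewrite kl msizeM // ?msizeX ?mdeg1 //.
by rewrite -msize_poly_eq0 msizeX.
Qed.

(** * Linear forms *)

Section Divisibility.

Variables (n : nat) (R : comNzRingType).
Implicit Types f g h : {mpoly R[n]}.

Lemma mdvd0 f : mdvd f 0. Proof. by exists 0; rewrite mulr0. Qed.

Lemma mdvdD f g h : mdvd f g -> mdvd f h -> mdvd f (g + h).
Proof. by move=> [g' ->] [h' ->]; exists (g' + h'); rewrite mulrDr. Qed.

Lemma mdvd_mulr f g h : mdvd f g -> mdvd f (g * h).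
Proof. by move=> [g' ->]; exists (g' * h); rewrite mulrA. Qed.

Lemma mdvd_mull f g h : mdvd f h -> mdvd f (g * h).
Proof. by rewrite mulrC; apply: mdvd_mulr. Qed.

Lemma mdvd_sum f (I : finType) (F : I -> {mpoly R[n]}) :
  (forall i, mdvd f (F i)) -> mdvd f (\sum_i F i).
Proof. by move=> fF; apply: (big_ind (mdvd f)); [apply: mdvd0|apply: mdvdD|]. Qed.

(* Cramer's rule: det B * v = adj B * (B v). *)
Lemma mdvd_det f (B : 'M[{mpoly R[n]}]_n) (v : 'I_n -> {mpoly R[n]}) :
  (forall s, mdvd f (\sum_i B s i * v i)) -> forall j, mdvd f (\det B * v j).
Proof.
move=> fBv j; have -> : \det B * v j = \sum_s \adj B j s * (\sum_i B s i * v i).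
  have -> : \det B * v j = (\adj B *m (B *m \col_i v i)) j 0.
    by rewrite mulmxA mul_adj_mx mul_scalar_mx !mxE.
  rewrite mxE; apply: eq_bigr => s _; rewrite [X in _ * X]mxE; congr (_ * _).
  by apply: eq_bigr => i _; rewrite mxE.
by apply: mdvd_sum => s; apply: mdvd_mull.
Qed.

End Divisibility.

Section LinearForms.

Variables (F : fieldType) (n : nat).
Implicit Types (l m : 'rV[F]_n) (f g h : {mpoly F[n]}).

Definition linform l : {mpoly F[n]} := \sum_i l 0 i *: 'X_i.

Lemma mcoeff_linform l i : (linform l)@_U_(i) = l 0 i.
Proof.
rewrite /linform raddf_sum (bigD1 i) //= mcoeffZ mcoeffX eqxx mulr1 big1 ?addr0 // => j ji.
by rewrite mcoeffZ mcoeffXU (negPf ji) mulr0.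
Qed.

(** Normalising the last nonzero coordinate to 1 picks one form on each line. *)
Definition monic_at (j : 'I_n) l := l 0 j = 1 /\ forall i : 'I_n, (j < i)%N -> l 0 i = 0.

Section Elimination.

Variables (j : 'I_n) (l : 'rV[F]_n).
Hypothesis lj : monic_at j l.

(** The substitution that solves [linform l = 0] for [X_j]. Its kernel is the ideal of [linform l],
    which is therefore prime. *)
Definition elim_form : {rmorphism {mpoly F[n]} -> {mpoly F[n]}} :=
  mmap (@mpolyC n F) (fun i => if i == j then 'X_j - linform l else 'X_i).

Lemma elim_formX i : elim_form 'X_i = if i == j then 'X_j - linform l else 'X_i.
Proof. by rewrite /elim_form /= mmapX mmap1U. Qed.

Let elim_formZ c f : elim_form (c *: f) = c *: elim_form f.
Proof. by rewrite /elim_form /= mmapZ mul_mpolyC. Qed.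

Lemma elim_form_linform m : elim_form (linform m) = linform m - m 0 j *: linform l.
Proof.
rewrite {1 2}/linform rmorph_sum (bigD1 j) //= [in RHS](bigD1 j) //=.
rewrite elim_formZ elim_formX eqxx scalerBr [RHS]addrAC; congr (_ + _).
by apply: eq_bigr => i /negPf ij; rewrite elim_formZ elim_formX ij.
Qed.

Let lj1 : l 0 j = 1 := lj.1.

Let elim_form_self : elim_form (linform l) = 0.
Proof. by rewrite elim_form_linform lj1 scale1r subrr. Qed.

Lemma linform_dvdP f : mdvd (linform l) f <-> elim_form f = 0.
Proof.
split=> [[g ->]|f0]; first by rewrite rmorphM /= elim_form_self mul0r.
have -> : f = f - elim_form f by rewrite f0 subr0.
apply: mdvd_endo => [c|i]; first by rewrite /elim_form /= mmapC.
rewrite elim_formX; case: eqP => [->|_]; last by exists 0; rewrite subrr mulr0.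
by exists 1; rewrite mulr1 opprB addrCA subrr addr0.
Qed.

Lemma linform_prime f g :
  mdvd (linform l) (f * g) -> mdvd (linform l) f \/ mdvd (linform l) g.
Proof.
rewrite !linform_dvdP rmorphM => /eqP.
by rewrite mulf_eq0 => /orP[] /eqP; [left|right].
Qed.

Lemma linform_neq0 : linform l != 0.
Proof.
apply: contraTneq (oner_neq0 F) => l0.
by rewrite -lj1 -mcoeff_linform l0 mcoeff0 eqxx.
Qed.

Lemma msize_linform : msize (linform l) = 2.
Proof.
apply/eqP; rewrite eqn_leq; apply/andP; split.
  apply: (big_ind (fun f => msize f <= 2)%N) => [|f g f2 g2|i _].
  - by rewrite msize0.
  - by apply: leq_trans (msizeD_le _ _) _; rewrite geq_max f2.
  - by apply: leq_trans (msizeZ_le _ _) _; rewrite msizeX mdeg1.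
have /msize_mdeg_lt : U_(j)%MM \in msupp (linform l).
  by rewrite mcoeff_msupp mcoeff_linform lj1 oner_neq0.
by rewrite mdeg1.
Qed.

Lemma linform_dvd_linform j' m :
  monic_at j' m -> mdvd (linform l) (linform m) -> m = l.
Proof.
move=> [mj' mgt]; rewrite linform_dvdP elim_form_linform => /eqP.
rewrite subr_eq0 => /eqP E.
have {E} mE i : m 0 i = m 0 j * l 0 i by rewrite -[LHS]mcoeff_linform E mcoeffZ mcoeff_linform.
have mj0 : m 0 j != 0.
  by apply: contraTneq (oner_neq0 F) => m0; rewrite -mj' mE m0 mul0r eqxx.
have lej : (j <= j')%N by rewrite leqNgt; apply: contra mj0 => /mgt ->.
have lej' : (j' <= j)%N.
  rewrite leqNgt; apply: contraTN (oner_neq0 F) => /lj.2 lj'0.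
  by rewrite -mj' mE lj'0 mulr0 eqxx.
have jj' : j = j' by apply/val_inj/eqP; rewrite eqn_leq lej lej'.
by apply/rowP => i; rewrite mE jj' mj' mul1r.
Qed.

End Elimination.

Definition monic_row l := exists j, monic_at j l.

Lemma monic_row_neq0 l : monic_row l -> l != 0.
Proof.
by case=> j [lj _]; apply: contraTneq (oner_neq0 F) => l0; rewrite -lj l0 mxE eqxx.
Qed.

Lemma linform_dvd_prod l (s : seq 'rV[F]_n) : monic_row l ->
  (forall m, m \in s -> monic_row m) ->
  mdvd (linform l) (\prod_(m <- s) linform m) -> l \in s.
Proof.
move=> [j lj]; elim: s => [|m s IHs] sM.
  rewrite big_nil (linform_dvdP lj) rmorph1 => /eqP.
  by rewrite oner_eq0.
rewrite big_cons => /(linform_prime lj)[|/IHs ls]; rewrite inE.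
  have [j' mj'] := sM m (mem_head _ _).
  by move=> /(linform_dvd_linform lj mj') ->; rewrite eqxx.
by rewrite ls ?orbT // => k ks; apply: sM; rewrite inE ks orbT.
Qed.

(** Distinct monic forms are primes that do not divide one another. *)
Lemma prod_linform_dvd f (s : seq 'rV[F]_n) : uniq s ->
  (forall m, m \in s -> monic_row m) -> (forall m, m \in s -> mdvd (linform m) f) ->
  mdvd (\prod_(m <- s) linform m) f.
Proof.
elim: s => [|m s IHs]; first by exists f; rewrite big_nil mul1r.
rewrite cons_uniq big_cons => /andP[ms us] sM sf.
have [k ks|k ks|g fE] := IHs us; first by apply: sM; rewrite inE ks orbT.
  by apply: sf; rewrite inE ks orbT.
have mM : monic_row m by apply: sM; apply: mem_head.
have [j mj] := mM; have := sf m (mem_head _ _); rewrite fE.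
case/(linform_prime mj)=> [m_dvd|[h ->]].
  case/negP: ms; apply: linform_dvd_prod m_dvd => // k ks.
  by apply: sM; rewrite inE ks orbT.
by exists h; rewrite mulrCA mulrA.
Qed.

Lemma msize_prod_linform (s : seq 'rV[F]_n) :
  (forall m, m \in s -> monic_row m) ->
  msize (\prod_(m <- s) linform m) = (size s).+1 /\ \prod_(m <- s) linform m != 0.
Proof.
elim: s => [|m s IHs] sM; first by rewrite big_nil msize1 oner_neq0.
have [|sE s0] := IHs; first by move=> k ks; apply: sM; rewrite inE ks orbT.
have [j mj] := sM m (mem_head _ _).
rewrite big_cons mulf_neq0 ?(linform_neq0 mj) //; split=> //.
by rewrite msizeM ?(linform_neq0 mj) // sE (msize_linform mj).
Qed.

End LinearForms.

Section MonicRows.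

Variables (F : finFieldType) (n : nat).

Let T : finType := {j : 'I_n & {ffun 'I_j -> F}}.

(** The tag is the pivot, and the coordinates before it are free. *)
Let row (t : T) : 'rV[F]_n :=
  \row_i (if insub (i : nat) is Some k then tagged t k else (i == tag t)%:R).

Let row_monic t : monic_at (tag t) (row t).
Proof.
split=> [|i ti]; rewrite mxE.
  by rewrite insubF ?ltnn // eqxx.
rewrite insubF; last by apply/negbTE; rewrite -leqNgt ltnW.
by rewrite -val_eqE gtn_eqF.
Qed.

Let row_inj : injective row.
Proof.
move=> t u tu; have [t1 tgt] := row_monic t; have [u1 ugt] := row_monic u.
have tagE : tag t = tag u.
  apply/val_inj/eqP; rewrite eqn_leq; apply/andP; split; rewrite leqNgt.
    apply: contraTN (oner_neq0 F) => /ugt; rewrite -tu t1 => ->.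
    by rewrite eqxx.
  apply: contraTN (oner_neq0 F) => /tgt; rewrite tu u1 => ->.
  by rewrite eqxx.
case: t u tu tagE {t1 tgt u1 ugt} => [j f] [j' f'] /= tu jj'.
case: j' / jj' f' tu => f' tu; congr existT; apply/ffunP => k.
have := congr1 (fun r : 'rV_n => r 0 (widen_ord (ltnW (ltn_ord j)) k)) tu.
by rewrite !mxE /= valK.
Qed.

Lemma monic_rows_ex : exists s : seq 'rV[F]_n,
  [/\ uniq s, forall m, m \in s -> monic_row m & size s = (\sum_(j < n) #|F| ^ j)%N].
Proof.
exists [seq row t | t <- enum T]; split.
- by rewrite map_inj_uniq ?enum_uniq //; apply: row_inj.
- by move=> _ /mapP[t _ ->]; exists (tag t); apply: row_monic.
- rewrite size_map -cardE card_tagged sumnE big_map big_enum.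
  by apply: eq_bigr => j _; rewrite card_ffun card_ord.
Qed.

End MonicRows.

(** * The Moore determinant *)

Section Moore.

Variables (p n : nat).
Hypothesis p_pr : prime p.
Local Notation P := {mpoly 'F_p[n]}.
Implicit Types (l : 'rV['F_p]_n) (f g : P).

Definition moore_mx : 'M[P]_n := \matrix_(s, i) 'X_i ^+ (p ^ s).
Definition moore_det : P := \det moore_mx.

Lemma linform_frob l (s : nat) :
  linform l ^+ (p ^ s) = \sum_i l 0 i *: 'X_i ^+ (p ^ s).
Proof.
have pP : p \in [pchar P] by rewrite (pchar_lalg P) pchar_Fp.
have ps : ([pchar P].-nat (p ^ s))%N by rewrite pnatX pnatE // pP.
have expZ (c : 'F_p) : c ^+ (p ^ s) = c.
  elim: s {ps} => [|s IHs]; first by rewrite expr1.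
  rewrite expnSr exprM IHs -{1}(natr_Zp c) -(pFrobenius_autE (pchar_Fp p_pr)).
  by rewrite rmorph_nat natr_Zp.
have p0 : (0 < p ^ s)%N by rewrite expn_gt0 prime_gt0.
transitivity (\sum_i (l 0 i *: 'X_i : P) ^+ (p ^ s)).
  apply: (big_morph (fun f : P => f ^+ (p ^ s))) => [f g|].
    exact: exprDn_pchar.
  by rewrite expr0n -(negbK (_ == _)) -lt0n p0.
by apply: eq_bigr => i _; rewrite exprZn expZ.
Qed.

(** The Moore matrix sends the vector [l] to the Frobenius powers of [linform l], all multiples of
    it; Cramer's rule applies at a nonzero coordinate of [l]. *)
Lemma linform_dvd_moore l : l != 0 -> mdvd (linform l) moore_det.
Proof.
move=> l0; have /existsP[j lj] : [exists j, l 0 j != 0].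
  apply: contraNT l0; rewrite negb_exists => /forallP l0.
  by apply/eqP/rowP => j; rewrite mxE; apply/eqP/negPn/l0.
have [|h E] := @mdvd_det _ _ (linform l) moore_mx (fun i => (l 0 i)%:MP) _ j.
  move=> s; exists (linform l ^+ (p ^ s).-1).
  rewrite -exprS prednK ?expn_gt0 ?prime_gt0 // linform_frob.
  by apply: eq_bigr => i _; rewrite mxE mulrC mul_mpolyC.
exists (h * ((l 0 j)^-1)%:MP); rewrite mulrA -E -mulrA -mpolyCM mulfV //.
by rewrite mpolyC1 mulr1.
Qed.

Let mon_of (s : 'S_n) : 'X_{1..n} := \sum_i (U_(s i) *+ p ^ i)%MM.

Let moore_detE : moore_det = \sum_(s : 'S_n) (-1) ^+ s * 'X_[mon_of s].
Proof.
apply: eq_bigr => s _; congr (_ * _).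
by rewrite -mprodXnE; apply: eq_bigr => i _; rewrite mxE.
Qed.

Let mon_ofE (s : 'S_n) i : mon_of s (s i) = (p ^ i)%N.
Proof.
rewrite /mon_of mnm_sumE (bigD1 i) //= mulmnE mnm1E eqxx mul1n.
rewrite big1 ?addn0 // => j ji; rewrite mulmnE mnm1E (inj_eq perm_inj).
by rewrite (negPf ji).
Qed.

Let mon_of_inj : injective mon_of.
Proof.
move=> s t st; apply/permP => i.
have := mon_ofE s i; rewrite st -(permKV t (s i)) mon_ofE => /eqP.
rewrite eqn_exp2l ?prime_gt1 // => /eqP/val_inj E.
by rewrite -{2}E permKV.
Qed.

(** Distinct permutations contribute distinct monomials. *)
Lemma moore_det_neq0 : moore_det != 0.
Proof.
have: moore_det@_(mon_of 1%g) != 0; last first.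
  by apply: contraNneq => ->; rewrite mcoeff0.
have sgnE (s : 'S_n) : (-1) ^+ s * 'X_[mon_of s] = (-1) ^+ s *: ('X_[mon_of s] : P).
  by case: (s : bool); rewrite ?expr0 ?expr1 ?mul1r ?scale1r // mulN1r scaleN1r.
rewrite moore_detE raddf_sum (bigD1 1%g) //= sgnE mcoeffZ mcoeffX eqxx mulr1.
rewrite odd_perm1 big1 ?addr0 ?oner_neq0 // => s /negPf s1.
by rewrite sgnE mcoeffZ mcoeffX (inj_eq mon_of_inj) s1 mulr0.
Qed.

Lemma msize_moore_det : (msize moore_det <= (\sum_(i < n) p ^ i).+1)%N.
Proof.
rewrite moore_detE; apply: (big_ind (fun f => msize f <= _)%N) => [|f g fP gP|s _].
- by rewrite msize0.
- by apply: leq_trans (msizeD_le _ _) _; rewrite geq_max fP.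
- have -> : (-1) ^+ s * 'X_[mon_of s] = (-1) ^+ s *: ('X_[mon_of s] : P).
    by case: (s : bool); rewrite ?expr0 ?expr1 ?mul1r ?scale1r // mulN1r scaleN1r.
  apply: leq_trans (msizeZ_le _ _) _; rewrite msizeX ltnS /mon_of mdeg_sum.
  by rewrite leq_sum // => i _; rewrite mdegMn mdeg1 mul1n.
Qed.

(** The product of the monic forms divides [moore_det] and already has the largest possible degree,
    the sum of the p^i, so the cofactor is constant. *)
Lemma moore_factor : exists s : seq 'rV['F_p]_n, exists2 c : 'F_p, c != 0 &
  [/\ uniq s, forall m, m \in s -> monic_row m
    & moore_det = (\prod_(m <- s) linform m) * c%:MP].
Proof.
have [s [us sM ss]] := monic_rows_ex 'F_p n.
have [h Lh] : mdvd (\prod_(m <- s) linform m) moore_det.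
  by apply: prod_linform_dvd => // m ms; apply/linform_dvd_moore/monic_row_neq0/sM.
have [sE s0] := msize_prod_linform sM.
have h0 : h != 0 by apply: contraNneq moore_det_neq0 => h0; rewrite Lh h0 mulr0.
have := msize_moore_det; rewrite Lh msizeM // sE ss card_Fp //= => hle.
rewrite -addn1 leq_add2l in hle; have hC := msize1_polyC hle.
exists s, h@_0; last by rewrite -hC.
by apply: contraNneq h0 => h00; rewrite hC h00 mpolyC0.
Qed.

Lemma moore_det_dvd f : (forall l, l != 0 -> mdvd (linform l) f) -> mdvd moore_det f.
Proof.
move=> lf; have [s [c c0 [us sM ->]]] := moore_factor.
have [h ->] : mdvd (\prod_(m <- s) linform m) f.
  by apply: prod_linform_dvd => // m ms; apply/lf/monic_row_neq0/sM.
by exists ((c^-1)%:MP * h); rewrite mulrA -[_ * _ * _%:MP]mulrA -mpolyCM mulfV // mpolyC1 mulr1.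
Qed.

Lemma moore_det_squarefree l h : monic_row l ->
  moore_det = linform l * h -> ~ mdvd (linform l) h.
Proof.
move=> lM LE [g hE]; have [s [c c0 [us sM LE']]] := moore_factor.
have [j lj] := lM.
have l_nunit : ~ mdvd (linform l) c%:MP.
  case=> k E; have k0 : k != 0.
    by apply: contraNneq c0 => k0; rewrite -(mpolyC_eq0 n) E k0 mulr0.
  have := congr1 (fun f : P => msize f) E.
  rewrite msizeC c0 msizeM ?(linform_neq0 lj) // (msize_linform lj) /=.
  by move: k0; rewrite -msize_poly_eq0; case: (mmeasure mdeg k).
have ls : l \in s.
  apply: (@linform_dvd_prod _ _ l) => //.
  have [] // := linform_prime lj (f := \prod_(m <- s) linform m) (g := c%:MP).
  by exists h; rewrite -LE' LE.
have := LE'; rewrite LE hE (big_rem l) //= -mulrA => /(mulfI (linform_neq0 lj)) E.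
have [|l_dvd|//] := linform_prime lj (f := \prod_(m <- rem l s) linform m) (g := c%:MP).
  by exists g.
have := @linform_dvd_prod _ _ l (rem l s) lM _ l_dvd.
rewrite mem_rem_uniq // inE eqxx /= => F; suff : false by [].
by apply: F => m /mem_rem /sM.
Qed.

End Moore.

(** * The essential ideal *)

Section AnticommutingPermutations.

Variable R : nzRingType.

Lemma anti_prod_lift n (y : 'I_n.+1 -> R) (j : 'I_n.+1) :
  (forall i k, y i * y k = - (y k * y i)) ->
  y j * \prod_(i < n) y (lift j i) = (-1) ^+ j * \prod_i y i.
Proof.
elim: n y j => [|n IHn] y j yC.
  by rewrite big_ord0 mulr1 (ord1 j) big_ord1 mul1r.
have [j' ->|->] := unliftP ord0 j; last by rewrite mul1r [RHS]big_ord_recl.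
have liftl0 : lift (lift ord0 j') ord0 = ord0 :> 'I_n.+2 by apply: val_inj.
have liftS i : lift (lift ord0 j') (lift ord0 i) = lift ord0 (lift j' i) :> 'I_n.+2.
  by apply: val_inj; rewrite /= /bump /= !add1n ltnS addnS.
rewrite big_ord_recl liftl0 [in RHS]big_ord_recl mulrA yC mulNr -mulrA.
under eq_bigr do rewrite liftS.
rewrite (IHn (y \o lift ord0)) // => [|i k]; last exact: yC.
by rewrite mulrA commr_sign -mulrA lift0 exprS mulN1r mulNr.
Qed.

Lemma perm_liftE n (s : 'S_n.+1) : exists t, s = lift_perm ord0 (s ord0) t.
Proof.
pose f k := odflt k (unlift (s ord0) (s (lift ord0 k))).
have fK k : lift (s ord0) (f k) = s (lift ord0 k).
  rewrite /f; case: unliftP => //= /perm_inj/eqP.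
  by rewrite eq_sym (negPf (neq_lift _ _)).
have f_inj : injective f.
  by move=> k l /(congr1 (lift (s ord0))); rewrite !fK => /perm_inj/lift_inj.
exists (perm f_inj); apply/permP => k.
have [l ->|->] := unliftP ord0 k; last by rewrite lift_perm_id.
by rewrite lift_perm_lift permE fK.
Qed.

Lemma anti_prod_sign n (y : 'I_n -> R) (s : 'S_n) :
  (forall i k, y i * y k = - (y k * y i)) ->
  \prod_i y (s i) = (-1) ^+ s * \prod_i y i.
Proof.
elim: n y s => [|n IHn] y s yC.
  rewrite !big_ord0 mulr1 (_ : s = 1%g) ?odd_perm1 //.
  by apply/permP => -[].
have [t sE] := perm_liftE s; rewrite big_ord_recl.
rewrite (eq_bigr (fun i => (y \o lift (s ord0)) (t i))) => [|i _]; last first.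
  by rewrite sE lift_perm_lift /= lift_perm_id.
rewrite (IHn (y \o _)) => [|i k]; last exact: yC.
rewrite mulrA commr_sign -mulrA anti_prod_lift // mulrA; congr (_ * _).
have -> : odd_perm s = t (+) odd (s ord0) by rewrite {1}sE odd_lift_perm addbC.
by rewrite signr_addb signr_odd.
Qed.

End AnticommutingPermutations.

Lemma monic_row_scale (F : fieldType) n (l : 'rV[F]_n) : l != 0 ->
  exists c m, [/\ c != 0, monic_row m & l = c *: m].
Proof.
move=> l0; have /existsP[i0 li0] : [exists j, l 0 j != 0].
  apply: contraNT l0; rewrite negb_exists => /forallP l0.
  by apply/eqP/rowP => j; rewrite mxE; apply/eqP/negPn/l0.
have [j lj jmax] := @arg_maxnP _ i0 (fun j => l 0 j != 0) (fun j => j : nat) li0.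
exists (l 0 j), ((l 0 j)^-1 *: l); split=> //; last by rewrite scalerA mulfV // scale1r.
exists j; split=> [|i ji]; rewrite mxE ?mulVf //.
have -> : l 0 i = 0; last by rewrite mulr0.
by apply: contraTeq ji => /jmax; rewrite -leqNgt.
Qed.

(** Only the first row of [mui_E] is not central, so the Leibniz formula expands along it. In [B i]
    that row is replaced by the i-th unit vector. *)
Lemma mui_M_adj (p n : nat) (gT : finGroupType) (a : 'I_n.+1 -> cohomology gT 'F_p) s :
  prime p -> elementary p gT -> H1_basis a ->
  mui_M a s = (-1) ^+ s * \sum_i poly_eval a (\adj (moore_mx p n.+1) i s) * a i.
Proof.
move=> p_pr gT_el aB; have evM := poly_evalM p_pr gT_el aB.
have ev1 := poly_eval1 p_pr gT_el aB; have evXn := poly_evalXn p_pr gT_el aB.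
have ev_sign m : poly_eval a ((-1) ^+ m) = (-1) ^+ m by rewrite evXn poly_evalN ev1.
pose B i : 'M[{mpoly 'F_p[n.+1]}]_n.+1 := \matrix_(j, k)
  if val j is m.+1 then 'X_k ^+ (p ^ bump s m) else (k == i)%:R.
have detB i : \det (B i) = (-1) ^+ s * \adj (moore_mx p n.+1) i s.
  rewrite (expand_det_row _ ord0) (bigD1 i) //= mxE eqxx mul1r big1 ?addr0; last first.
    by move=> k /negPf ki; rewrite mxE /= ki mul0r.
  have -> : cofactor (B i) ord0 i
      = (-1) ^+ i * \det (row' s (col' i (moore_mx p n.+1))).
    by congr (_ * \det _); apply/matrixP => j k; rewrite !mxE.
  rewrite [\adj _ _ _]mxE /cofactor [RHS]mulrA (exprD _ s) [in RHS]mulrA -[in RHS]exprD.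
  by rewrite addnn -mul2n exprM sqrrN !expr1n mul1r.
transitivity (\sum_i poly_eval a (\det (B i)) * a i); last first.
  rewrite mulr_sumr; apply: eq_bigr => i _.
  by rewrite detB evM ev_sign mulrA.
under [RHS]eq_bigr do rewrite poly_eval_sum mulr_suml.
rewrite exchange_big; apply: eq_bigr => t _ /=.
rewrite big_ord_recl (bigD1 (t ord0)) //= [X in _ = _ + X]big1 ?addr0.
  rewrite evM ev_sign big_ord_recl [B _ _ _]mxE /= eqxx mul1r -!mulrA; congr (_ * _).
  rewrite (poly_eval_central p_pr gT_el aB) mxE /= (poly_eval_prod p_pr gT_el aB).
  congr (_ * _); apply: eq_bigr => j _.
  by rewrite !mxE /= evXn poly_evalX.
move=> i /negPf it; rewrite big_ord_recl [B _ _ _]mxE /= eq_sym it mul0r mulr0.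
by rewrite poly_eval0 mul0r.
Qed.

Section EssentialIdeal.

Variables (p n : nat) (gT : finGroupType) (a : 'I_n -> cohomology gT 'F_p).
Hypotheses (p_pr : prime p) (p_odd : odd p) (gT_ab : (p.-abelem [set: gT])%g).
Hypothesis aB : H1_basis a.

Local Notation P := {mpoly 'F_p[n]}.
Local Notation H := (cohomology gT 'F_p).
Local Notation ev := (poly_eval a).
Local Notation L := (moore_det p n).
Local Notation mon := (ext_mon a).
Implicit Types (f g : P) (c e : H) (l : 'rV['F_p]_n) (S T : {set 'I_n}).

Let gT_el : elementary p gT.
Proof.
have [abT expT] := abelemP p_pr gT_ab.
split=> [x y|x]; last by apply: expT; rewrite inE.
by apply: (centsP abT); rewrite inE.
Qed.

Let a1 i : has_degree 1 (a i). Proof. exact: aB.1. Qed.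
Let aC i j : a i * a j = - (a j * a i). Proof. exact: degree1_anticomm. Qed.
Let a2 i : a i * a i = 0. Proof. exact: degree1_sqr. Qed.
Let evM := poly_evalM p_pr gT_el aB.
Let ev1 := poly_eval1 p_pr gT_el aB.
Let evC := poly_eval_central p_pr gT_el aB.
Let evX := poly_evalXn p_pr gT_el aB.

Let evZ (k : 'F_p) f : ev (k *: f) = k *: ev f.
Proof. by rewrite -mul_mpolyC evM poly_evalC mulr_algl. Qed.

Let ev_sign m : ev ((-1) ^+ m) = (-1) ^+ m.
Proof. by rewrite evX poly_evalN ev1. Qed.

Let ev_mulC f g c : ev f * (ev g * c) = ev g * (ev f * c).
Proof. by rewrite !mulrA -!evM mulrC. Qed.

Let ev_signK m c : ev ((-1) ^+ m) * (ev ((-1) ^+ m) * c) = c.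
Proof. by rewrite mulrA -evM -expr2 sqrr_sign ev1 mul1r. Qed.

Let ev_mulACA f g c e : ev f * c * (ev g * e) = ev (f * g) * (c * e).
Proof. by rewrite evM -!mulrA; congr (_ * _); rewrite !mulrA evC. Qed.

Let ev_mulCA f c e : c * (ev f * e) = ev f * (c * e).
Proof. by rewrite mulrA -evC mulrA. Qed.

Lemma ext_mon_basis e : exists k : {set 'I_n} -> P, e = \sum_T ev (k T) * mon T.
Proof. by have [k ->] := ext_mon_span p_pr p_odd gT_el aB e; exists k. Qed.

Lemma ext_mon_uniq (k k' : {set 'I_n} -> P) :
  \sum_T ev (k T) * mon T = \sum_T ev (k' T) * mon T -> k =1 k'.
Proof.
move=> E T; apply/eqP; rewrite -subr_eq0; apply/eqP; move: T.
apply: (ext_mon_indep p_pr gT_el aB); apply/eqP.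
under eq_bigr do rewrite poly_evalB mulrBl.
by rewrite sumrB E subrr.
Qed.

Definition cdvd f e := exists e', e = ev f * e'.

(** Freeness on the exterior monomials reduces divisibility to the coefficients. *)
Lemma cdvdP f (k : {set 'I_n} -> P) :
  cdvd f (\sum_T ev (k T) * mon T) <-> forall T, mdvd f (k T).
Proof.
split=> [[e' E] T|/fin_all_exists[h hE]]; last first.
  exists (\sum_T ev (h T) * mon T); rewrite mulr_sumr; apply: eq_bigr => T _.
  by rewrite hE evM mulrA.
have [h hE] := ext_mon_basis e'; exists (h T); move: T.
apply: ext_mon_uniq; rewrite E hE mulr_sumr; apply: eq_bigr => T _.
by rewrite evM mulrA.
Qed.

Lemma ev_inj f e : f != 0 -> ev f * e = 0 -> e = 0.
Proof.
move=> f0; have [k ->] := ext_mon_basis e => E.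
suff k0 T : k T = 0 by rewrite big1 // => T _; rewrite k0 poly_eval0 mul0r.
suff /eqP : f * k T = 0 by rewrite mulf_eq0 (negPf f0) => /eqP.
apply: (@ext_mon_uniq (fun T => f * k T) (fun=> 0)).
rewrite [RHS]big1 => [|U _]; last by rewrite poly_eval0 mul0r.
by rewrite -[RHS]E mulr_sumr; apply: eq_bigr => U _; rewrite evM mulrA.
Qed.

Lemma ev_cancel f e e' : f != 0 -> ev f * e = ev f * e' -> e = e'.
Proof.
by move=> f0 /eqP; rewrite -subr_eq0 -mulrBr => /eqP/(ev_inj f0)/eqP; rewrite subr_eq0 => /eqP.
Qed.

Lemma cdvdM f g e : cdvd f e -> cdvd f (ev g * e).
Proof. by move=> [e' ->]; exists (ev g * e'); apply: ev_mulC. Qed.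

Definition acomb l := \sum_i l 0 i *: a i.

Let acomb1 l : has_degree 1 (acomb l).
Proof. by apply: has_degree_sum => i; apply: has_degreeZ. Qed.

Let acomb_sqr l : acomb l * acomb l = 0. Proof. exact: degree1_sqr. Qed.

Let bockstein_acomb l : bockstein (acomb l) = ev (linform l).
Proof.
rewrite /acomb bockstein_sum // /linform poly_eval_sum; apply: eq_bigr => i _.
by rewrite evZ poly_evalX.
Qed.

Lemma Ess_decomp e l : Ess e -> l != 0 ->
  exists u v, e = acomb l * u + ev (linform l) * v.
Proof.
move=> eE l0; have al0 : acomb l != 0 by apply: H1_basis_neq0.
have [W [[Wp _ _ [exa _ _]] _ _ _]] := exists_gysin p_pr gT_el (acomb1 l) al0.
have [m me] := cbelow_ex e.
have [u [v [_ _ E]]] := exa m e me (eE W Wp).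
by exists u, v; rewrite -bockstein_acomb.
Qed.

(** If [e = a u + x v], then [a e = x a v] up to order of factors, since [a] squares to zero.
    Conversely, a relation [a e = x e'] makes [e] vanish on the kernel of [a], and every proper
    subgroup lies in such a kernel. *)
Lemma EssP e : Ess e <-> forall l, l != 0 -> cdvd (linform l) (acomb l * e).
Proof.
split=> [eE l l0|edvd W Wp].
  have [u [v ->]] := Ess_decomp eE l0; exists (acomb l * v).
  by rewrite mulrDr !mulrA acomb_sqr mul0r add0r evC.
have [lam [lamM lamW [t lt0]]] := exists_hom p_pr gT_ab Wp.
have [c lc] := cocycle_represents (below_bounded (indeg_below (indeg_homc lam)))
  (cobd_homc lamM).
have c1 : has_degree 1 c by apply/has_degree1P; exists lam.
have c0 : c != 0.
  apply: contraNneq lt0 => c0; have lc0 : represents (homc (fun _ => 0 : 'F_p)) c.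
    rewrite c0 (_ : homc _ = 0); first exact: represents0.
    by apply: cochainP => -[|y [|z s]].
  by rewrite (represents_homc_inj lc lc0 t).
have rc : res W c = 0.
  apply/(represents_eq0 (represents_res W lc)); exists 0; first exact: bounded0.
  rewrite coboundary0; apply: cochainP => -[|x [|y s]] //.
  by rewrite /res_cochain /=; apply: lamW; apply: subgP.
have rbc : res W (bockstein c) = 0 by rewrite bockstein_res // rc bockstein0.
have [l [cE _]] := aB.2 _ c1.
have l0 : l != 0.
  by apply: contraNneq c0 => l0; rewrite cE l0 big1 // => i _; rewrite mxE scale0r.
have [e' E] := edvd l l0.
(* [e] vanishes on [W'], so it is a combination of [c] and its Bockstein, both of which vanish on
   [W]. No restriction from [W'] to [W] has to be considered. *)
have [W' [[_ _ _ [exa _ coef0]] _ _ _]] := exists_gysin p_pr gT_el c1 c0.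
have [m me] := cbelow_ex e.
have [|u [v [_ _ ->]]] := exa m e me.
  apply: (coef0 e (- e')); rewrite mulrN cE -/(acomb l) E bockstein_acomb.
  exact: subrr.
by rewrite resD !resM rc rbc !mul0r addr0.
Qed.

Lemma Ess_monic e :
  (forall l, monic_row l -> cdvd (linform l) (acomb l * e)) -> Ess e.
Proof.
move=> eM; apply/EssP => l /monic_row_scale[k [m [k0 mM ->]]].
have -> : linform (k *: m) = k *: linform m.
  by rewrite /linform scaler_sumr; apply: eq_bigr => i _; rewrite mxE scalerA.
have -> : acomb (k *: m) = k *: acomb m.
  by rewrite /acomb scaler_sumr; apply: eq_bigr => i _; rewrite mxE scalerA.
have [e' E] := eM m mM; exists e'.
by rewrite evZ -!scalerAl E.
Qed.

Lemma moore_det_cdvd e : (forall l, l != 0 -> cdvd (linform l) e) -> cdvd L e.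
Proof.
have [k ->] := ext_mon_basis e => ldvd; apply/cdvdP => T.
by apply: moore_det_dvd => // l l0; move: T; apply/cdvdP/ldvd.
Qed.

(** Write [e = A u + x v] and [e' = A u1 + x v1] with [A] squaring to zero: then [x] divides [e e'],
    and [A e e'] is even a multiple of [x] squared. The first fact for all forms gives the factor
    [L], the second the essentiality of the quotient. *)
Lemma Ess_mul_cdvd e e' : Ess e -> Ess e' -> exists2 h, Ess h & e * e' = ev L * h.
Proof.
move=> eE eE'.
have key l : l != 0 -> exists d,
    [/\ cdvd (linform l) (e * e') &
        acomb l * (e * e') = ev (linform l) * (ev (linform l) * d)].
  move=> l0; have [u [v E]] := Ess_decomp eE l0.
  have [u1 [v1 E']] := Ess_decomp eE' l0.
  set A := acomb l in E E' *; set x := ev (linform l) in E E' *.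
  have xC c : c * x = x * c by rewrite -evC.
  have [u' Eu] := degree1_twist p_pr gT_el aB u (acomb1 l).
  have [u2 Eu'] := degree1_twist p_pr gT_el aB u' (acomb1 l).
  have [v2 Ev] := degree1_twist p_pr gT_el aB v (acomb1 l).
  rewrite -/A in Eu Eu' Ev.
  have A2 : A * A = 0 by apply: acomb_sqr.
  have ee : e * e' = x * (u' * A * v1 + v * (A * u1) + x * v * v1).
    rewrite E E' Eu mulrDr !mulrDl.
    rewrite (_ : u' * A * (A * u1) = 0) ?add0r; last first.
      by rewrite mulrA -[u' * A * A]mulrA A2 mulr0 mul0r.
    rewrite [u' * A * (x * v1)]mulrA xC -[x * v * (A * u1)]mulrA.
    rewrite [x * v * (x * v1)]mulrA [x * v * x]xC -!mulrA -!mulrDr.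
    by rewrite addrCA !mulrA addrA.
  exists (A * v * v1); split; first by exists (u' * A * v1 + v * (A * u1) + x * v * v1).
  rewrite ee [LHS]mulrA (xC A) -[LHS]mulrA; congr (x * _).
  rewrite !mulrDr (_ : A * (u' * A * v1) = 0) ?add0r; last first.
    by rewrite !mulrA Eu' -[u2 * A * A]mulrA A2 mulr0 mul0r.
  rewrite (_ : A * (v * (A * u1)) = 0) ?add0r; last first.
    by rewrite !mulrA Ev -[v2 * A * A]mulrA A2 mulr0 mul0r.
  by rewrite !mulrA (xC A).
have [|h hE] := @moore_det_cdvd (e * e').
  by move=> l /key[d []].
exists h => //; apply: Ess_monic => l lM; have l0 := monic_row_neq0 lM.
have [d [_ dE]] := key l l0; have [Q LQ] := linform_dvd_moore p_pr l0.
(* One factor [x] is cancelled against [L = x Q]; as [x] is prime and does not divide [Q], the other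
   one divides [A h]. *)
have nQ := moore_det_squarefree p_pr lM LQ.
have [j lj] := lM; have x0 := linform_neq0 lj.
have E : ev Q * (acomb l * h) = ev (linform l) * d.
  apply: (ev_cancel x0); rewrite -dE hE mulrA -evM -LQ [acomb l * (_ * _)]mulrA.
  by rewrite -[acomb l * ev L]evC mulrA.
have [k kE] := ext_mon_basis (acomb l * h); rewrite kE; apply/cdvdP => T.
have : mdvd (linform l) (Q * k T).
  move: T; apply/cdvdP; exists d; rewrite -E kE mulr_sumr.
  by apply: eq_bigr => T _; rewrite evM mulrA.
by case/(linform_prime lj).
Qed.


(** * The Mui invariants *)

Local Notation M := (mui_M a).
Local Notation C := (moore_mx p n).

Lemma poly_eval_det m (B : 'M[P]_m) (B' : 'M[H]_m) :
  (forall i j, B' i j = ev (B i j)) -> \det B' = ev (\det B).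
Proof.
move=> BE; rewrite /determinant poly_eval_sum; apply: eq_bigr => s _.
rewrite evM ev_sign (poly_eval_prod p_pr gT_el aB); congr (_ * _).
by apply: eq_bigr => i _; rewrite BE.
Qed.

Lemma mui_LE : mui_L a = ev L.
Proof. by apply: poly_eval_det => s i; rewrite !mxE evX poly_evalX. Qed.

Lemma mui_ME s : M s = (-1) ^+ s * \sum_i ev (\adj C i s) * a i.
Proof.
move: s; have := aB; move: (a); case: (n) => [|n'] a' a'B s; first by case: s.
exact: mui_M_adj.
Qed.

Lemma moore_det_mul_a j :
  ev L * a j = \sum_(s < n) (-1) ^+ s * ev ('X_j ^+ (p ^ s)) * M s.
Proof.
have adjC i : \sum_s \adj C i s * C s j = L *+ (i == j).
  have -> : \sum_s \adj C i s * C s j = (\adj C *m C) i j by rewrite [RHS]mxE.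
  by rewrite mul_adj_mx mxE.
transitivity (\sum_i ev (\sum_s \adj C i s * C s j) * a i).
  rewrite (bigD1 j) //= adjC eqxx mulr1n big1 ?addr0 // => i /negPf ij.
  by rewrite adjC ij mulr0n poly_eval0 mul0r.
under eq_bigr do rewrite poly_eval_sum mulr_suml.
rewrite exchange_big; apply: eq_bigr => s _ /=.
rewrite mui_ME -ev_sign -mulrA (ev_mulC ('X_j ^+ _)) ev_signK.
rewrite mulr_sumr; apply: eq_bigr => i _.
by rewrite [C s j]mxE [\adj _ _ _ * _]mulrC evM mulrA.
Qed.

Lemma comb_anticomm (g h : 'I_n -> P) :
  (\sum_i ev (g i) * a i) * (\sum_i ev (h i) * a i) =
  - ((\sum_i ev (h i) * a i) * (\sum_i ev (g i) * a i)).
Proof.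
rewrite mulr_suml mulr_suml -sumrN.
under eq_bigr do rewrite mulr_sumr.
under [RHS]eq_bigr do rewrite mulr_sumr -sumrN.
rewrite exchange_big; apply: eq_bigr => i _; apply: eq_bigr => j _ /=.
by rewrite !ev_mulACA [g j * _]mulrC aC mulrN.
Qed.

Let mui_M_comb s : M s = \sum_i ev ((-1) ^+ s * \adj C i s) * a i.
Proof.
by rewrite mui_ME mulr_sumr; apply: eq_bigr => i _; rewrite evM ev_sign mulrA.
Qed.

Let MC s t : M s * M t = - (M t * M s).
Proof. rewrite (mui_M_comb s) (mui_M_comb t); exact: comb_anticomm. Qed.

Let M2 s : M s * M s = 0.
Proof. exact: eq_opp_eq0 (MC s s). Qed.

(** The left-over is the determinant of the Moore matrix with row [s] replaced by a row orthogonal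
    to [l]; all other rows send [l] to powers of [linform l], so Cramer's rule applies again. *)
Lemma adj_moore_dvd l i j s :
  mdvd (linform l) (l 0 j *: \adj C i s - l 0 i *: \adj C j s).
Proof.
have [->|l0] := eqVneq l 0.
  have z k : (0 : 'rV['F_p]_n) 0 k = 0 by rewrite mxE.
  by exists 0; rewrite !z !scale0r subrr mulr0.
have /existsP[k lk] : [exists j, l 0 j != 0].
  apply: contraNT l0; rewrite negb_exists => /forallP l0.
  by apply/eqP/rowP => k; rewrite mxE; apply/eqP/negPn/l0.
pose B : 'M[P]_n := \matrix_(t, k) if t == s then
  (l 0 j)%:MP * (k == i)%:R - (l 0 i)%:MP * (k == j)%:R else C t k.
have detB : \det B = l 0 j *: \adj C i s - l 0 i *: \adj C j s.
  rewrite (expand_det_row _ s) -!mul_mpolyC.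
  have cofE k' : cofactor B s k' = \adj C k' s.
    rewrite [RHS]mxE /cofactor; congr (_ * \det _); apply/matrixP => t u.
    by rewrite !mxE eq_sym (negPf (neq_lift _ _)).
  under eq_bigr do rewrite mxE eqxx cofE mulrBl.
  rewrite sumrB; congr (_ - _).
    rewrite (bigD1 i) //= eqxx mulr1 big1 ?addr0 // => k' /negPf ->.
    by rewrite mulr0 mul0r.
  rewrite (bigD1 j) //= eqxx mulr1 big1 ?addr0 // => k' /negPf ->.
  by rewrite mulr0 mul0r.
have [|h E] := @mdvd_det _ _ (linform l) B (fun i => (l 0 i)%:MP) _ k.
  move=> t; have [->|ts] := eqVneq t s.
    rewrite (_ : \sum__ _ = 0); first exact: mdvd0.
    under eq_bigr do rewrite mxE eqxx mulrBl.
    rewrite sumrB (bigD1 i) //= big1 ?addr0 => [|k' /negPf ->]; last by rewrite mulr0 mul0r.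
    rewrite (bigD1 j) //= big1 ?addr0 => [|k' /negPf ->]; last by rewrite mulr0 mul0r.
    by rewrite !eqxx !mulr1 mulrC subrr.
  exists (linform l ^+ (p ^ t).-1).
  rewrite -exprS prednK ?expn_gt0 ?prime_gt0 // linform_frob //.
  by apply: eq_bigr => k' _; rewrite mxE (negPf ts) mxE mulrC mul_mpolyC.
exists (h * ((l 0 k)^-1)%:MP); rewrite mulrA -E -mulrA -mpolyCM mulfV //.
by rewrite mpolyC1 mulr1 detB.
Qed.

(** Modulo [linform l], the class [M s] is a multiple of [acomb l], which squares to zero. *)
Lemma Ess_mui_M s : Ess (M s).
Proof.
apply: Ess_monic => l [j [lj _]]; rewrite mui_ME mulrA commr_sign -mulrA -ev_sign.
apply: cdvdM; have /fin_all_exists[h hE] := fun i => @adj_moore_dvd l i j s.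
have -> : \sum_i ev (\adj C i s) * a i =
    ev (linform l) * (\sum_i ev (h i) * a i) + ev (\adj C j s) * acomb l.
  rewrite /acomb !mulr_sumr -big_split; apply: eq_bigr => i _ /=.
  rewrite mulrA -evM -hE lj scale1r poly_evalB mulrBl evZ -scalerAl -scalerAr subrK.
  by [].
exists (acomb l * (\sum_i ev (h i) * a i)).
by rewrite mulrDr !ev_mulCA acomb_sqr mulr0 addr0.
Qed.

Lemma Ess_mui_L : Ess (ev L).
Proof.
apply/EssP => l l0; have [Q ->] := linform_dvd_moore p_pr l0.
by exists (ev Q * acomb l); rewrite -evC evM mulrA.
Qed.

Let L0 : L != 0. Proof. exact: moore_det_neq0. Qed.

Let evLX m : ev L ^+ m = ev (L ^+ m). Proof. by rewrite evX. Qed.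

Let LX0 m : L ^+ m != 0. Proof. exact: expf_neq0. Qed.

Lemma Ess_sign (b : bool) e : Ess e -> Ess ((-1) ^+ b * e).
Proof. by have [_ _ E _] := Ess_ideal gT 'F_p => /E. Qed.

(** Adding one index multiplies two essential classes, and [Ess_mul_cdvd] supplies the division by
    [L]. Both sides carry an extra factor [L], so that the empty set needs no negative exponent. *)
Lemma mui_exists S :
  exists2 m, Ess m & ev (L ^+ #|S|) * m = ev L * ext_mon M S.
Proof.
have [k] := ubnP #|S|; elim: k S => // k IHk S ltSk.
have [->|[s sS]] := set_0Vmem S.
  exists (ev L); first exact: Ess_mui_L.
  by rewrite cards0 ext_mon0 mulr1 expr0 ev1 mul1r.
have cardS : #|S| = #|S :\ s|.+1 by rewrite (cardsD1 s) sS.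
have [|m' Em' mE] := IHk (S :\ s); first by rewrite cardS in ltSk.
have [h Eh hE] := Ess_mul_cdvd (Ess_mui_M s) Em'.
have [|b bE] := ext_monU MC (T := [set s]) (U := S :\ s).
  by rewrite disjoints1 !inE eqxx.
rewrite ext_mon1 setD1K // in bE.
exists ((-1) ^+ b * h); first exact: Ess_sign.
rewrite -ev_sign ev_mulC cardS exprSr evM -[ev _ * ev L * h]mulrA -hE.
rewrite -(ev_mulCA _ (M s) m') mE.
by rewrite ev_mulCA bE -ev_sign [LHS]ev_mulC ev_signK.
Qed.

Lemma muiP S : Ess (mui a S) /\ ev (L ^+ #|S|) * mui a S = ev L * ext_mon M S.
Proof.
have [m Em mE] := mui_exists S.
suff muiE : ev (L ^+ #|S|) * mui a S = ev L * ext_mon M S.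
  by split=> //; rewrite (ev_cancel (LX0 #|S|) (etrans muiE (esym mE))).
rewrite /mui; case: eqP => [->|/eqP S0].
  by rewrite cards0 ext_mon0 expr0 ev1 mul1r mulr1 mui_LE.
have cardS : #|S| = #|S|.-1.+1 by rewrite prednK // card_gt0.
rewrite cardS exprS evM -mulrA; congr (_ * _).
rewrite -evLX -mui_LE -cardS.
(* A solution exists, so [xget] returns one instead of its default 0. *)
have ex : exists m', mui_L a ^+ #|S|.-1 * m' = \prod_(s in S) M s.
  exists m; apply: (ev_cancel L0).
  by rewrite -[RHS]mE cardS exprS evM mui_LE evLX mulrA.
exact: (classical_sets.xgetPex 0 ex).
Qed.


(** [L a_i] is a polynomial combination of the [M s], and [M s * mui a S] is zero or, up to sign,
    [L] times [mui a (s |: S)]; the factor [L] cancels. *)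
Lemma a_mul_mui_span i S : in_span a (mui a) (a i * mui a S).
Proof.
have [_ mS] := muiP S.
have /fin_all_exists2[t t_span tE] s : exists2 t, in_span a (mui a) t &
    ev (L ^+ #|S|.+1) * t = ev L * (M s * ext_mon M S).
  rewrite -(ext_mon1 M s); have [dS|dS] := boolP [disjoint [set s] & S]; last first.
    by exists 0; [apply: in_span0 | rewrite (ext_mon_meet MC M2 dS) !mulr0].
  have [b ->] := ext_monU MC dS; exists ((-1) ^+ b * mui a (s |: S)).
    exact/in_span_sign/in_span_gen.
  have [_] := muiP (s |: S); rewrite cardsU1 -disjoints1 dS add1n => E.
  rewrite -ev_sign (ev_mulC _ _ (mui a _)) E; exact: ev_mulC.
have -> : a i * mui a S = \sum_(s < n) ev ((-1) ^+ s * 'X_i ^+ (p ^ s)) * t s.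
  apply: (ev_cancel (LX0 #|S|.+1)); transitivity (ev L * a i * (ev L * ext_mon M S)).
    by rewrite -mS ev_mulACA -exprS.
  rewrite moore_det_mul_a mulr_suml mulr_sumr; apply: eq_bigr => s _.
  by rewrite [RHS]ev_mulC tE -ev_sign -evM ev_mulACA evM -[LHS]mulrA.
by apply: in_span_sum => s; apply: in_spanM.
Qed.

Lemma mui_mul_meet S T : ~~ [disjoint S & T] -> mui a S * mui a T = 0.
Proof.
move=> dST; have [_ mS] := muiP S; have [_ mT] := muiP T.
apply: (ev_inj (LX0 #|S|)); rewrite mulrA mS; apply: (ev_inj (LX0 #|T|)).
by rewrite -ev_mulCA mT ev_mulACA (ext_mon_meet MC M2 dST) mulr0.
Qed.

(** In the expanded product a repeated [a_i] gives zero, and each permutation contributes its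
    sign. *)
Lemma ext_mon_comb (B : 'M[P]_n) :
  \prod_s (\sum_i ev (B s i) * a i) = ev (\det B) * mon [set: 'I_n].
Proof.
rewrite bigA_distr_bigA /=.
have prodE (f : 'I_n -> 'I_n) : \prod_s (ev (B s (f s)) * a (f s)) =
    ev (\prod_s B s (f s)) * \prod_s a (f s).
  apply: (big_rec3 (fun x y z => x = ev y * z)) => [|s x y z _ ->].
    by rewrite ev1 mulr1.
  by rewrite ev_mulACA.
under eq_bigr do rewrite prodE.
rewrite (bigID (fun f : {ffun 'I_n -> 'I_n} => injectiveb f)) /=.
rewrite [X in _ + X]big1 ?addr0 => [|f f_ninj]; last first.
  suff -> : \prod_s a (f s) = 0 by rewrite mulr0.
  rewrite -(big_map f xpredT a); apply: anti_prod_dup => //.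
  by rewrite /index_enum unlock /= -enumT.
rewrite (reindex (fun s : 'S_n => pval s)) /=; last first.
  have s0 : 'S_n := 1%g.
  exists (insubd s0) => [s|f] /=; first by rewrite valKd.
  by move=> f_inj; rewrite insubdK.
rewrite (eq_bigl xpredT) => [|s]; last by rewrite (valP s).
rewrite poly_eval_sum mulr_suml; apply: eq_bigr => s _.
rewrite evM ev_sign (eq_bigr (fun i => B i (s i))) => [|i _]; last by rewrite pvalE.
rewrite (eq_bigr (fun i => a (s i))) => [|i _]; last by rewrite pvalE.
rewrite anti_prod_sign // -ev_sign [LHS]ev_mulC mulrA; congr (_ * _).
by apply: eq_bigl => i; rewrite inE.
Qed.

Lemma prod_mui_M : exists b : bool,
  ev L * ext_mon M [set: 'I_n] = (-1) ^+ b * (ev (L ^+ n) * mon [set: 'I_n]).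
Proof.
pose B : 'M[P]_n := \matrix_(s, i) ((-1) ^+ s * \adj C i s).
have -> : ext_mon M [set: 'I_n] = ev (\det B) * mon [set: 'I_n].
  rewrite -ext_mon_comb /ext_mon (eq_bigl xpredT) => [|s]; last by rewrite inE.
  apply: eq_bigr => s _; rewrite mui_M_comb; apply: eq_bigr => i _.
  by rewrite [B s i]mxE.
have BE : B = diag_mx (\row_s (-1) ^+ s) *m (\adj C)^T.
  apply/matrixP => s i; rewrite mul_diag_mx [LHS]mxE [RHS]mxE.
  by rewrite [(\row_s _) _ _]mxE [(\adj C)^T s i]mxE.
(* The adjugate has determinant [L] to the power n - 1, stated after multiplication by [L]; the
   first factor collects the row signs. *)
have detB : L * \det B = (-1) ^+ (\sum_(s < n) s) * L ^+ n.
  rewrite BE det_mulmx det_tr mulrCA det_diag; congr (_ * _).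
    by rewrite -prodrXr; apply: eq_bigr => s _; rewrite mxE.
  by rewrite -det_mulmx mul_mx_adj det_scalar.
exists (odd (\sum_(s < n) s)); rewrite signr_odd mulrA -evM detB evM ev_sign.
by rewrite mulrA.
Qed.

Lemma mui_mul_setC S : exists b : bool,
  mui a S * mui a (~: S) = (-1) ^+ b * (ev L * mon [set: 'I_n]).
Proof.
have [_ mS] := muiP S; have [_ mT] := muiP (~: S).
have [|b bE] := ext_monU MC (T := S) (U := ~: S).
  by rewrite disjoints_subset setCK.
have [c cE] := prod_mui_M; exists (b (+) c); apply: (ev_cancel (LX0 n)).
have cardS : L ^+ n = L ^+ #|S| * L ^+ #|~: S| by rewrite -exprD cardsC card_ord.
rewrite {1}cardS -ev_mulACA mS mT ev_mulACA bE setUCr evM -!mulrA.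
rewrite -[(-1) ^+ b]ev_sign (ev_mulC L _ (ext_mon M _)) cE.
rewrite -(ev_sign c) -(ev_sign (b (+) c)) signr_addb evM -[_ * _ * (ev L * _)]mulrA.
rewrite (ev_mulC L) (ev_mulC (L ^+ n) ((-1) ^+ b)); congr (_ * _).
rewrite (ev_mulC L) (ev_mulC (L ^+ n) ((-1) ^+ c)); congr (_ * _).
exact: ev_mulC.
Qed.

(** * Coefficients of essential classes, and freeness *)

Lemma Ess_comb (f : {set 'I_n} -> P) : Ess (\sum_S ev (f S) * mui a S).
Proof.
have [E0 ED EM _] := Ess_ideal gT 'F_p.
by apply: (big_ind (@Ess gT 'F_p)) => // S _; apply: EM; have [] := muiP S.
Qed.

(* Multiplying by mui (~: S) kills every mui U with U not contained in S, so  *)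
(* that the coefficient at S is isolated by induction on S.                   *)
Lemma mui_coef_dvd (f : P) e (g : {set 'I_n} -> P) :
  Ess e -> ev f * e = \sum_S ev (g S) * mui a S -> forall S, mdvd f (g S).
Proof.
move=> Ee eE S; have [k] := ubnP #|S|; elim: k S => // k IHk S ltSk.
have /fin_all_exists[q qE] (U : {set 'I_n}) : exists h, U \proper S -> g U = f * h.
  have [US|] := boolP (U \proper S); last by exists 0.
  have [|h ->] := IHk U; last by exists h.
  by rewrite (leq_trans (proper_card US)).
(* Removing the terms at proper subsets of [S], already known to be divisible by [f], keeps the
   class essential. Of the remaining terms, only the one at [S] survives multiplication by
   [mui a (~: S)]. *)
pose d := \sum_(U : {set 'I_n}) ev (if U \proper S then q U else 0) * mui a U.
have Ed : Ess (e - d).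
  have [_ ED EM _] := Ess_ideal gT 'F_p.
  by apply: ED => //; rewrite -mulN1r; apply/EM/Ess_comb.
have EC : Ess (mui a (~: S)) by have [] := muiP (~: S).
(* Essentiality is used here: the product is [L h], and this [L] cancels the one in [mui_mul_setC].
   Comparing coefficients of the top exterior monomial then gives the divisibility. *)
have [h _ hE] := Ess_mul_cdvd Ed EC; have [b bE] := mui_mul_setC S.
have fd : ev f * (e - d) = \sum_(U : {set 'I_n}) ev (if U \proper S then 0 else g U) * mui a U.
  rewrite mulrBr eE /d mulr_sumr -sumrB; apply: eq_bigr => U _.
  rewrite (mulrA (ev f)) -(evM f) -mulrBl -poly_evalB; congr (ev _ * _).
  by case: ifP => [/qE ->|]; rewrite ?subrr // mulr0 subr0.
have E : ev f * h = ev ((-1) ^+ b * g S) * mon [set: 'I_n].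
  apply: (ev_cancel L0); rewrite ev_mulC -hE mulrA fd mulr_suml.
  rewrite (bigD1 S) //= properxx big1 ?addr0 => [|U US].
    rewrite -[LHS]mulrA bE -(ev_sign b) evM -[_ * _ * mon _]mulrA.
    rewrite (ev_mulC (g S)) (ev_mulC L ((-1) ^+ b)); congr (_ * _).
    exact: ev_mulC.
  case: ifP => [_|UnS]; first by rewrite poly_eval0 !mul0r.
  rewrite -mulrA mui_mul_meet ?mulr0 // disjoints_subset setCK.
  by apply: contraFN UnS; rewrite properEneq US.
have [l lE] := ext_mon_basis h; exists ((-1) ^+ b * l [set: 'I_n]).
have := @ext_mon_uniq (fun T => f * l T)
  (fun T => if T == [set: 'I_n] then (-1) ^+ b * g S else 0).
move=> /(_ _ [set: 'I_n]); rewrite eqxx mulrCA => -> //.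
  by rewrite mulrA -expr2 sqrr_sign mul1r.
rewrite [RHS](bigD1 [set: 'I_n]) //= eqxx [X in _ = _ + X]big1 ?addr0.
  by rewrite -E lE mulr_sumr; apply: eq_bigr => T _; rewrite evM mulrA.
by move=> T /negPf ->; rewrite poly_eval0 mul0r.
Qed.

Lemma free_on_mui : free_on a (@Ess gT 'F_p) (mui a).
Proof.
split=> [S|e Ee]; first by have [] := muiP S.
have mui0 : mui a set0 = ev L by rewrite /mui eqxx mui_LE.
have [g gE] : in_span a (mui a) (ev L * e).
  apply: in_span_stable => //; last exact: a_mul_mui_span.
  by rewrite -mui0; apply: in_span_gen.
have /fin_all_exists[f fE] := mui_coef_dvd Ee gE.
exists [ffun S => f S]; split=> [|f' f'E].
  apply: (ev_cancel L0); rewrite gE mulr_sumr; apply: eq_bigr => S _.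
  by rewrite ffunE fE evM mulrA.
apply/ffunP => S; rewrite ffunE.
(* Divisibility by 0 says that the differences of coefficients vanish. *)
have [||h] := @mui_coef_dvd 0 0 (fun S => f S - f' S) _ _ S.
- by have [] := Ess_ideal gT 'F_p.
- rewrite mulr0; under eq_bigr do rewrite poly_evalB mulrBl.
  rewrite sumrB -f'E; apply/esym/eqP; rewrite subr_eq0 eq_sym; apply/eqP.
  apply: (ev_cancel L0); rewrite gE mulr_sumr; apply: eq_bigr => T _.
  by rewrite fE evM mulrA.
by rewrite mul0r => /eqP; rewrite subr_eq0 => /eqP.
Qed.

End EssentialIdeal.

Theorem theorem1p2 (p n : nat) (V : finGroupType)
    (a : 'I_n -> cohomology V 'F_p) :
  prime p -> odd p -> (p.-abelem [set: V])%g -> 'r([set: V])%g = n ->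
  H1_basis a ->
  free_on a (@Ess V 'F_p) (mui a).
Proof. by move=> p_pr p_odd V_ab _ aB; apply: free_on_mui. Qed.
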